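(* Let $(X,\mu)$ be a measure space equipped with a (separable) ball-basis $\mathscr B$, let $\mathbb U,\mathbb V$ be Banach spaces, let $r>0$, $\varrho\ge\rho>0$, and let $T$ be a bounded oscillation operator from $L^r(X,\mathbb U)$ to $L^0(X,\mathbb V)$. Then for any function $f\in L^r(X,\mathbb U)$ with $\operatorname{supp} f\subset B\in\mathscr B$ there exist a ball $B'\supset B$, a $\gamma$-sparse family of balls $\mathscr A$ and a martingale type family of measurable sets $\bar{\mathscr A}\Subset\mathscr A$ such that $$\bigcup_{G\in\mathscr A}G\subset B',\qquad \mu(B')\lesssim\mu(B),$$ $$\mu\Big\{x\in X:\ \sum_{G\in\mathscr A}\mathbf 1_{\bar G}(x)>\lambda\Big\}\lesssim \exp(-c\lambda)\,\mu(B),\qquad \lambda>0,$$ $$\|Tf(x)\|_{\mathbb V}\lesssim C(T)\sum_{G\in\mathscr A}\langle f\rangle_G\,\mathbf 1_{\bar G}(x)\quad\text{for a.e. }x\in B,$$ where $0<\gamma<1$, $c>0$ are admissible constants and $C(T)=\mathcal L_0(T)+\mathcal L_1(T)+\mathcal L_2(T)$. The same inequality holds also for the truncated operator $T^*$ (that is, with $T^*f(x)$ in place of $\|Tf(x)\|_{\mathbb V}$).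
   Context: Ball-basis. Let $(X,\mathfrak M,\mu)$ be a measure space. A family $\mathscr B$ of measurable sets (called balls) is a ball-basis if: (B1) $0<\mu(B)<\infty$ for any $B\in\mathscr B$; (B2) for any $x,y\in X$ there is a ball containing $x$ and $y$; (B3) for any $E\in\mathfrak M$ and $\varepsilon>0$ there is a finite or infinite sequence of balls $B_k$ with $\mu(E\triangle\bigcup_kB_k)<\varepsilon$; (B4) for any $B\in\mathscr B$ there is a ball $[B]\in\mathscr B$ (hull-ball) with $B^*:=\bigcup_{A\in\mathscr B:\ \mu(A)\le2\mu(B),\ A\cap B\ne\varnothing}A\subset[B]$ and $\mu([B])\le\mathcal K\mu(B)$, where $\mathcal K$ is a positive constant independent of $B$. All ball-bases are assumed separable: the union of an arbitrary (not necessarily countable) collection of balls is measurable. Operators. $L^0(X,\mathbb V)$ is the space of measurable $\mathbb V$-valued functions on $X$. $T:L^r(X,\mathbb U)\to L^0(X,\mathbb V)$ is sublinear if $\|T(f+g)\|_{\mathbb V}\le\|Tf\|_{\mathbb V}+\|Tg\|_{\mathbb V}$ for all $f,g\in L^r(X,\mathbb U)$. Put $\langle f\rangle_B=\mu(B)^{-\rho}\big(\int_B\|f\|_{\mathbb U}^r\big)^{\varrho}$, $\langle f\rangle_B^*=\sup_{A\in\mathscr B:A\supset B}\langle f\rangle_A$, $\mathrm{OSC}_B(g)=\operatorname{esssup}_{x,x'\in B}\|g(x)-g(x')\|$, $\mathrm{SUP}_B(g)=\operatorname{esssup}_{x\in B}\|g(x)\|$ (norm of the space of values). A sublinear $T$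 is a bounded oscillation (BO) operator if, with constants $\mathcal L_0=\mathcal L_0(T)$, $\mathcal L_1=\mathcal L_1(T)$, $\mathcal L_2=\mathcal L_2(T)$ depending only on $T$, the following hold whenever $f\in L^r(X,\mathbb U)$: (T0) for every $B\in\mathscr B$: $\mu\{x\in B:\|T(f\mathbf 1_B)(x)\|_{\mathbb V}>\lambda\langle f\rangle_B\}\le(\mathcal L_0/\lambda)^{1/\rho}\mu(B)$, $\lambda>0$; (T1) for every $B\in\mathscr B$: $\mathrm{OSC}_B(T(f\mathbf 1_{X\setminus B^*}))\le\mathcal L_1\langle f\rangle_B^*$; (T2) for any $A\in\mathscr B$ with $A^*\ne X$ there exists a ball $B\supsetneq A$ such that $\mathrm{SUP}_A(T(f\mathbf 1_{B^*\setminus A^*}))\le\mathcal L_2\langle f\rangle_{B^*}$. Truncated operator: $T^*f(x)=\sup_{B\in\mathscr B,\,x\in B}\|T(f\mathbf 1_{X\setminus B^*})(x)\|_{\mathbb V}$. Families of sets. A collection $\mathcal S$ of measurable sets is $\gamma$-sparse ($0<\gamma<1$) if for any $B\in\mathcal S$ there is a set $E_B\subset B$ with $\mu(E_B)\ge\gamma\mu(B)$ and the sets $E_B$, $B\in\mathcal S$, are pairwise disjoint. A family is of martingale type if any two members $A,B$ satisfy $A\cap B=\varnothing$, $A\subset B$ or $B\subset A$. $\bar{\mathcal S}\Subset\mathcal S$ means that there is a one-to-one mapping from $\mathcal S$ to $\bar{\mathcal S}$ taking every $A\in\mathcal S$ to a set $\bar A\in\bar{\mathcal S}$ with $\bar A\subset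 A$. Constants. Admissible constants are positive constants depending only on $\mathcal K,r,\varrho,\rho$ (and on the doubling constant of the ball-basis, when it is assumed doubling); $a\lesssim b$ means $a\le c\,b$ with $c$ admissible.
   Formalization: T*f is taken as the essential supremum over balls (least measurable a.e. upper bound) instead of the pointwise supremum, which is ill-defined for a.e. classes and for which the claim fails with uncountably many balls; the two agree a.e. for countably many balls. *)

(* Defs.v *)
From HB Require Import structures.
From mathcomp Require Import all_boot all_order all_algebra.
From mathcomp Require Import all_classical all_reals all_analysis.
From mathcomp Require Import measurable_realfun ess_sup_inf.

Set Implicit Arguments.
Unset Strict Implicit.
Unset Printing Implicit Defensive.

Import Order.TTheory GRing.Theory Num.Theory.
Import numFieldNormedType.Exports.

Local Open Scope classical_set_scope.
Local Open Scope ring_scope.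
Local Open Scope ereal_scope.

Section BallBasis.
Context (R : realType) (d : measure_display) (X : measurableType d).
Variable mu : {measure set X -> \bar R}.
Variable Bs : set (set X).

Definition ball_star (B : set X) : set X :=
  \bigcup_(A in [set A | Bs A /\ mu A <= 2%:E * mu B /\ A `&` B !=set0]) A.

Record ball_basis (K : R) : Prop := BallBasis {
  ball_measurable : forall B, Bs B -> measurable B ;
  ball_finite : forall B, Bs B -> 0 < mu B < +oo ;
  ball_joins : forall x y : X, exists B, [/\ Bs B, B x & B y] ;
  (* A finite or infinite sequence of balls enters only through its
     union, so it is given by its (countable) set of terms. *)
  ball_approx : forall (E : set X) (eps : R), measurable E -> (0 < eps)%R ->
    exists D : set (set X), [/\ countable D, D `<=` Bs &
      mu (E `+` \bigcup_(A in D) A) < eps%:E] ;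
  ball_hull : forall B, Bs B -> exists H,
    [/\ Bs H, ball_star B `<=` H & mu H <= K%:E * mu B] }.

Definition separable_balls : Prop :=
  forall D : set (set X), D `<=` Bs -> measurable (\bigcup_(A in D) A).

End BallBasis.

Section FunctionSpaces.
Context (R : realType) (d : measure_display) (X : measurableType d).
Variable mu : {measure set X -> \bar R}.

Definition simple_map (V : normedModType R) (s : X -> V) : Prop :=
  finite_set (range s) /\ forall v : V, measurable (s @^-1` [set v]).

(* Measurability of functions with values in a Banach space is meant in the
   sense of Bochner: it is the notion for which the measurable functions form
   a vector space without separability of V. *)
Definition L0_fun (V : normedModType R) (f : X -> V) : Prop :=
  exists s : nat -> X -> V, (forall n, simple_map (s n)) /\
    forall x, s ^~ x @ \oo --> f x.

Definition Lr_fun (U : normedModType R) (r : R) (f : X -> U) : Prop :=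
  L0_fun f /\ \int[mu]_x ((`|f x| `^ r)%R)%:E < +oo.

Definition cut (U : normedModType R) (f : X -> U) (D : set X) : X -> U :=
  fun x => (\1_D x *: f x)%R.

Definition avg (U : normedModType R) (r vrho rho : R) (f : X -> U)
    (B : set X) : \bar R :=
  ((fine (mu B) `^ (- rho))%R)%:E *
  (\int[mu]_(x in B) ((`|f x| `^ r)%R)%:E) `^ vrho.

Definition avg_star (U : normedModType R) (r vrho rho : R)
    (Bs : set (set X)) (f : X -> U) (B : set X) : \bar R :=
  ereal_sup [set avg r vrho rho f A | A in [set A | Bs A /\ B `<=` A]].

(* Essential supremum over pairs of points of B: the pairs are taken off a
   null subset of X. *)
Definition OSC (V : normedModType R) (B : set X) (g : X -> V) : \bar R :=
  ereal_inf [set M : \bar R | exists2 N : set X, mu.-negligible N &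
    forall x x', (B `\` N) x -> (B `\` N) x' -> `|(g x - g x')%R|%:E <= M].

(* The norm vanishes off B, so for 0 < mu B this is the supremum over B. *)
Definition SUP (V : normedModType R) (B : set X) (g : X -> V) : \bar R :=
  ess_sup mu (fun x => `|cut g B x|%:E).

End FunctionSpaces.

Section BoundedOscillation.
Context (R : realType) (d : measure_display) (X : measurableType d).
Variable mu : {measure set X -> \bar R}.
Variable Bs : set (set X).
Variables U V : completeNormedModType R.
Variables r vrho rho : R.
Implicit Type T : (X -> U) -> (X -> V).

Local Notation star := (ball_star mu Bs).
Local Notation avg := (avg mu r vrho rho).
Local Notation avg_star := (avg_star mu r vrho rho Bs).
Local Notation OSC := (OSC mu).
Local Notation SUP := (SUP mu).

(* Elements of L^r and L^0 are classes modulo equality almost everywhere;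
   T acts on representatives, compatibly with that equality. *)
Record Lr_L0_operator T : Prop := LrL0Operator {
  operator_L0 : forall f, Lr_fun mu r f -> L0_fun (T f) ;
  operator_ae : forall f g, Lr_fun mu r f -> Lr_fun mu r g ->
    {ae mu, forall x, f x = g x} -> {ae mu, forall x, T f x = T g x} }.

Definition sublinear_op T : Prop :=
  forall f g, Lr_fun mu r f -> Lr_fun mu r g ->
    {ae mu, forall x, (`|T (f \+ g)%R x| <= `|T f x| + `|T g x|)%R}.

Definition BO_T0 T (L0 : R) (f : X -> U) : Prop :=
  forall B, Bs B -> forall lambda : R, (0 < lambda)%R ->
    mu [set x | B x /\ lambda%:E * avg f B < `|T (cut f B) x|%:E]
      <= (((L0 / lambda) `^ (rho^-1))%R)%:E * mu B.

Definition BO_T1 T (L1 : R) (f : X -> U) : Prop :=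
  forall B, Bs B -> OSC B (T (cut f (~` star B))) <= L1%:E * avg_star f B.

Definition BO_T2 T (L2 : R) (f : X -> U) : Prop :=
  forall A, Bs A -> star A <> setT ->
    exists B, [/\ Bs B, A `<` B &
      SUP A (T (cut f (star B `\` star A))) <= L2%:E * avg f (star B)].

Record BO_operator T (L0 L1 L2 : R) : Prop := BOOperator {
  BO_operator_LrL0 : Lr_L0_operator T ;
  BO_sublinear : sublinear_op T ;
  BO_constants : [/\ (0 <= L0)%R, (0 <= L1)%R & (0 <= L2)%R] ;
  BO_conditions : forall f, Lr_fun mu r f ->
    [/\ BO_T0 T L0 f, BO_T1 T L1 f & BO_T2 T L2 f] }.

(* The truncated operator
     T^* f (x) = sup_{B ball, x in B} `|T (f 1_{X \ B^*}) (x)|.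
   T (f 1_{X \ B^*}) is defined up to a null set depending on B, and the
   collection of balls may be uncountable, so the supremum defining T^* f is
   the supremum in the lattice of measurable functions modulo equality almost
   everywhere.  It is the pointwise supremum (a.e.) when the balls are countable. *)
Definition is_truncated T (f : X -> U) (h : X -> \bar R) : Prop :=
  let upper (k : X -> \bar R) := measurable_fun setT k /\
    forall B, Bs B ->
      {ae mu, forall x, B x -> `|T (cut f (~` star B)) x|%:E <= k x} in
  upper h /\ forall k, upper k -> {ae mu, forall x, h x <= k x}.

(* The default value is +oo, so that an upper bound for [truncated T f] on a
   set of positive measure is never vacuous. *)
Definition truncated T (f : X -> U) : X -> \bar R :=
  xget (cst +oo) [set h | is_truncated T f h].

End BoundedOscillation.

Section Families.
Context (R : realType) (d : measure_display) (X : measurableType d).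
Variable mu : {measure set X -> \bar R}.

Definition sparse (gamma : R) (S : set (set X)) : Prop :=
  (forall B, S B -> measurable B) /\
  exists E : set X -> set X,
    (forall B, S B ->
      [/\ measurable (E B), E B `<=` B & gamma%:E * mu B <= mu (E B)]) /\
    trivIset S E.

Definition martingale_type (S : set (set X)) : Prop :=
  forall A B, S A -> S B -> [\/ A `&` B = set0, A `<=` B | B `<=` A].

(* [bar] is the one-to-one mapping A |-> \bar A witnessing \bar S \Subset S. *)
Definition subordinate (bar : set X -> set X) (Sbar S : set (set X)) : Prop :=
  set_bij S Sbar bar /\ forall A, S A -> bar A `<=` A.

End Families.

(* Main.v *)
(* Let W0 be a hull of B.  For a ball W, the set [bad W] collects the balls on which
   f 1_W has a large average, or on which some truncation of T (f 1_W) is large, and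
   the points where T (f 1_W) is large, all measured against <f>_W.  By T0, T1 and the
   Vitali lemma it has small measure compared with W, and off it T (f 1_W) and its
   truncations are at most a multiple of C(T) <f>_W.

   Starting from bad W0, one repeatedly takes a ball (the core) of nearly maximal
   measure among those at least half filled by the part of bad W0 that is not yet
   treated; enlarging it by (B4) gives a node W, and the points of the core outside
   bad W are declared treated.  The treated sets are disjoint and fill fixed
   proportions of their nodes, so the nodes form a sparse family.  Around a body of W,
   a ball G of nearly minimal size that sees a good point of another node V connects W
   to its parent V: by T1 and T2 the values of T (f 1_V) and T (f 1_W) near the core
   differ by at most a multiple of C(T) (<f>_V + <f>_W).  Summing along the branch from
   a point to the root gives the domination, with \bar V the union of the treated
   sets of the descendants of V.

   The exponential estimate uses sparsity only.  For E = {sum 1_{\bar G} > lambda},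
   integrate the sum over E and split the balls G according to the dyadic size of
   mu(G `&` E) / mu(G): each dyadic class contributes at most C mu(E) by the Vitali
   lemma, and the classes beyond the J-th together at most C 2^-J mu(W0) by the
   Carleson condition.  Hence lambda mu(E) <= C (J mu(E) + 2^-J mu(W0)), and J is taken
   proportional to lambda. *)
Require Import Defs.
From HB Require Import structures.
From mathcomp Require Import all_boot all_order all_algebra.
From mathcomp Require Import all_classical all_reals all_analysis.
From mathcomp Require Import measurable_realfun ess_sup_inf.
From mathcomp Require Import lra ring.

Set Implicit Arguments.
Unset Strict Implicit.
Unset Printing Implicit Defensive.

Import Order.TTheory GRing.Theory Num.Theory.
Import numFieldNormedType.Exports.

Local Open Scope classical_set_scope.
Local Open Scope ring_scope.
Local Open Scope ereal_scope.

Local Notation cut := Defs.cut.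

(** The main obstacle is T2: it supplies some ball strictly larger than [A], with no bound on its
    size, so a chain of balls growing by bounded factors need not exist. The connecting ball [G] is
    therefore taken of nearly minimal measure among all balls that strictly contain a body of [W];
    every ball that T2 supplies for such a body is then at least half as large as [G], and a bounded
    enlargement of it sees a good point of the parent. The inclusions must stay strict, which is why
    bodies are kept apart from nodes. The proportion of bad points is dictated by the passage from a
    core to its node, which costs a factor [2 * K ^+ 5]: when [bad W] has measure at most
    [(8 * K ^+ 6)^-1] times that of [W], it takes at most a quarter of the core, and since half of
    the core is untreated, another quarter becomes treated. T0 is used at levels proportional to
    [L0], which requires [0 < L0]. For [L0 = 0] it forces [T f] and its truncations to vanish almost
    everywhere on [B], and the empty family suffices. *)

Lemma ler_sum_mem (R : numDomainType) (I : eqType) (s : seq I) (F G : I -> R) :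
  (forall i, i \in s -> (F i <= G i)%R) ->
  (\sum_(i <- s) F i <= \sum_(i <- s) G i)%R.
Proof. by move=> FG; rewrite big_seq [leRHS]big_seq; apply: ler_sum. Qed.

Lemma ex_natSinv_lt (R : realType) (e : R) : (0 < e)%R ->
  exists n : nat, (n.+1%:R^-1 < e)%R.
Proof.
move=> e0; exists (Num.truncn e^-1).
by rewrite invf_plt ?posrE ?ltr0n// truncnS_gt.
Qed.

(** Suprema of measures need not be attained; the greedy choices below are made up to this factor
    2. *)
Lemma near_max (R : realType) (T : Type) (P : set T) (g : T -> R) (C : R) :
  P !=set0 -> (forall t, P t -> (0 < g t <= C)%R) ->
  exists2 t, P t & forall u, P u -> (g u < 2 * g t)%R.
Proof.
move=> [t0 Pt0] gP.
have hs : has_sup [set g t | t in P].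
  split; first by exists (g t0), t0.
  by exists C => _ [t Pt <-]; have /andP[] := gP _ Pt.
have s0 : (0 < sup [set g t | t in P])%R.
  have /andP[g0 _] := gP _ Pt0; apply: lt_le_trans g0 _.
  by apply: sup_ubound; [exact: hs.2|exists t0].
have h0 : (0 < sup [set g t | t in P] / 2)%R by lra.
have [_ [t Pt <-] ht] := sup_adherent h0 hs.
exists t => // u Pu; have : (g u <= sup [set g t | t in P])%R.
  by apply: sup_ubound; [exact: hs.2|exists u].
lra.
Qed.

Lemma near_min (R : realType) (T : Type) (P : set T) (g : T -> R) (c : R) :
  P !=set0 -> (0 < c)%R -> (forall t, P t -> (c <= g t)%R) ->
  exists2 t, P t & forall u, P u -> (g t <= 2 * g u)%R.
Proof.
move=> P0 c0 gP.
have g0 t : P t -> (0 < g t)%R by move=> Pt; apply: lt_le_trans c0 (gP _ Pt).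
have [t Pt|t Pt ht] := @near_max R T P (fun t => (g t)^-1)%R (c^-1)%R P0.
  by rewrite invr_gt0 g0//= lef_pV2 ?posrE ?g0//; exact: gP.
exists t => // u Pu; have := ht _ Pu.
have gt0 := g0 _ Pt; have gu0 := g0 _ Pu.
rewrite ltr_pdivlMr// mulrC -ltr_pdivlMr ?invr_gt0// => h; apply: ltW.
by move: h; rewrite invrK.
Qed.

Lemma countable_enum (I : pointedType) (D : set I) : countable D ->
  exists (P : set nat) (k : nat -> I), set_bij P D k.
Proof.
move=> /countable_injP[e einj].
pose k n := xget point (D `&` e @^-1` [set n]).
have kP i : D i -> D (k (e i)) /\ e (k (e i)) = e i.
  by move=> Di; rewrite /k; case: xgetP => [j _ []//|none]; case: (none i).
exists (e @` D), k; split.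
- by move=> _ [i /kP[? _] <-].
- move=> _ _ /set_mem[i /kP[_ ei] <-] /set_mem[j /kP[_ ej] <-] kij.
  by rewrite -ei -ej kij.
- move=> i Di; exists (e i); first by exists i.
  by have [Dk ek] := kP _ Di; apply: (einj _ i) => //; rewrite inE.
Qed.

Lemma bigcup_set_bij (I J : Type) (X : Type) (P : set J) (D : set I) (k : J -> I)
  (F : I -> set X) : set_bij P D k -> \bigcup_(i in D) F i = \bigcup_(n in P) F (k n).
Proof.
move=> [kD _ kS]; apply/seteqP; split=> [x [i /kS[n Pn <-] Fx]|x [n Pn Fx]].
  by exists n.
by exists (k n) => //; exact: kD.
Qed.

Lemma countable_bigcup_measurable (d : measure_display) (X : measurableType d)
    (I : pointedType) (D : set I) (F : I -> set X) : countable D ->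
  (forall i, D i -> measurable (F i)) -> measurable (\bigcup_(i in D) F i).
Proof.
move=> /countable_enum[P [k kb]] mF; rewrite (bigcup_set_bij _ kb).
by apply: bigcup_measurable => n Pn; apply: mF; case: kb => + _ _; apply.
Qed.

Lemma measure_bigcup_le_esum (R : realType) (d : measure_display)
    (X : measurableType d) (mu : {measure set X -> \bar R}) (I : pointedType)
    (D : set I) (F : I -> set X) : countable D ->
  (forall i, D i -> measurable (F i)) ->
  mu (\bigcup_(i in D) F i) <= \esum_(i in D) mu (F i).
Proof.
move=> /countable_enum[P [k kb]] mF; rewrite (bigcup_set_bij _ kb).
have mFk n : P n -> measurable (F (k n)) by move=> Pn; apply: mF; case: kb => + _ _; apply.
rewrite (reindex_esum P D k)// bigcup_mkcond.
apply: (@le_trans _ _ (\sum_(n <oo) mu (if n \in P then F (k n) else set0))).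
  have mG n : measurable (if n \in P then F (k n) else set0).
    by case: ifPn => // /set_mem; exact: mFk.
  by apply: measure_sigma_subadditive => //; exact: bigcup_measurable.
rewrite nneseries_esumT// [leRHS]esum_mkcond.
by apply: le_esum => n _; case: ifPn; rewrite ?measure0.
Qed.

(** * Ball-bases and the Vitali lemma *)

Section Geometry.
Context (R : realType) (d : measure_display) (X : measurableType d).
Variables (mu : {measure set X -> \bar R}) (Bs : set (set X)) (K : R).
Hypotheses (K1 : (1 <= K)%R) (bb : ball_basis mu Bs K) (sep : separable_balls Bs).

Local Notation m A := (fine (mu A)).
Local Notation star := (ball_star mu Bs).

Lemma ball_mble A : Bs A -> measurable A.
Proof. by move=> BA; exact: (ball_measurable bb BA). Qed.

Lemma ball_fin A : Bs A -> mu A \is a fin_num.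
Proof. by move=> BA; have /andP[? ?] := ball_finite bb BA; rewrite ge0_fin_numE. Qed.

Lemma ball_muE A : Bs A -> mu A = (m A)%:E.
Proof. by move=> BA; rewrite fineK// ball_fin. Qed.

Lemma ball_gt0 A : Bs A -> (0 < m A)%R.
Proof.
by move=> BA; rewrite -lte_fin -ball_muE//; have /andP[] := ball_finite bb BA.
Qed.

Lemma ball_neq0 A : Bs A -> A !=set0.
Proof.
move=> BA; apply/set0P/eqP => A0; have := ball_gt0 BA.
by rewrite A0 measure0/= ltxx.
Qed.

Lemma ball_le A B : Bs A -> Bs B -> A `<=` B -> (m A <= m B)%R.
Proof.
move=> BA BB AB; rewrite -lee_fin -!ball_muE//.
by apply: le_measure => //; rewrite inE; exact: ball_mble.
Qed.

Lemma star_mble A : measurable (star A).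
Proof. by apply: sep => B []. Qed.

Lemma sub_star A B : Bs A -> Bs B -> A `&` B !=set0 -> (m A <= 2 * m B)%R ->
  A `<=` star B.
Proof.
move=> BA BB AB mAB x Ax; exists A => //; split => //; split => //.
by rewrite (ball_muE BA) (ball_muE BB) -EFinM lee_fin.
Qed.

Lemma star_ge A : Bs A -> A `<=` star A.
Proof.
move=> BA; apply: sub_star => //; first by rewrite setIid; exact: ball_neq0.
by have := ball_gt0 BA; lra.
Qed.

Lemma star_mono A B : Bs A -> Bs B -> A `<=` B -> star A `<=` star B.
Proof.
move=> BA BB AB x [C [BC [+ CA]] Cx].
rewrite (ball_muE BC) (ball_muE BA) -EFinM lee_fin => mC.
apply: (@sub_star C B) => //.
  by case: CA => y [Cy Ay]; exists y; split=> //; exact: AB.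
by have := ball_le BA BB AB; lra.
Qed.

Lemma hull_ex A : Bs A ->
  exists H, [/\ Bs H, star A `<=` H & (m H <= K * m A)%R].
Proof.
move=> BA; have [H [BH AH mH]] := ball_hull bb BA; exists H; split => //.
by rewrite -lee_fin EFinM -(ball_muE BH) -(ball_muE BA).
Qed.

Definition hull A := xget A [set H | [/\ Bs H, star A `<=` H & (m H <= K * m A)%R]].

Lemma hullP A : Bs A -> [/\ Bs (hull A), star A `<=` hull A & (m (hull A) <= K * m A)%R].
Proof.
move=> BA; rewrite /hull; case: xgetP => [H _ //|none].
by have [H HA] := hull_ex BA; case: (none H).
Qed.

Lemma hull_ball A : Bs A -> Bs (hull A). Proof. by move=> /hullP[]. Qed.

Lemma star_hull A : Bs A -> star A `<=` hull A. Proof. by move=> /hullP[]. Qed.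

Lemma hull_le A : Bs A -> (m (hull A) <= K * m A)%R. Proof. by move=> /hullP[]. Qed.

Lemma sub_hull A : Bs A -> A `<=` hull A.
Proof. by move=> BA; apply: subset_trans (star_ge BA) (star_hull BA). Qed.

Lemma sub_hull2 A B : Bs A -> Bs B -> A `&` B !=set0 -> (m A <= 2 * m B)%R ->
  A `<=` hull B.
Proof. by move=> BA BB AB mAB; apply: subset_trans (star_hull BB); exact: sub_star. Qed.

(** The smaller of two meeting balls lies in the hull of the larger one. *)
Lemma ball_merge A B : Bs A -> Bs B -> A `&` B !=set0 ->
  exists G, [/\ Bs G, A `<=` G, B `<=` G & (m G <= K * Num.max (m A) (m B))%R].
Proof.
have K0 : (0 <= K)%R by apply: le_trans K1.
move=> BA BB AB; have [mAB|mBA] := leP (m A) (m B).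
  exists (hull B); split; [exact: hull_ball| |exact: sub_hull|exact: hull_le].
  by apply: sub_hull2 => //; have := ball_gt0 BB; lra.
exists (hull A); split; [exact: hull_ball|exact: sub_hull| |exact: hull_le].
by apply: sub_hull2 => //; [rewrite setIC|have := ball_gt0 BA; lra].
Qed.

Lemma ball_join2 A B : Bs A -> Bs B -> exists G, [/\ Bs G, A `<=` G & B `<=` G].
Proof.
move=> BA BB; have [x Ax] := ball_neq0 BA; have [y By] := ball_neq0 BB.
have [C [BC Cx Cy]] := ball_joins bb x y.
have [G [BG AG CG _]] := ball_merge BA BC (ex_intro _ x (conj Ax Cx)).
have [H [BH GH BBH _]] := ball_merge BG BB (ex_intro _ y (conj (CG _ Cy) By)).
by exists H; split => //; exact: subset_trans GH.
Qed.

Lemma ball_join_seq A (s : seq (set X)) : Bs A -> (forall B, B \in s -> Bs B) ->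
  exists G, [/\ Bs G, A `<=` G & forall B, B \in s -> B `<=` G].
Proof.
move=> BA; elim: s => [|B s IH] hs; first by exists A; split.
have [|G [BG AG sG]] := IH; first by move=> C Cs; apply: hs; rewrite inE Cs orbT.
have [|H [BH GH BBH]] := @ball_join2 G B BG; first by apply: hs; rewrite mem_head.
exists H; split => //; first exact: subset_trans GH.
move=> C; rewrite inE => /orP[/eqP->//|Cs]; exact: subset_trans (sG _ Cs) GH.
Qed.

(** The family may be uncountable, so the greedy selection goes through Zorn's lemma. The invariant
    in [P] is that a ball of [Z] meeting [D] meets a member of at least half its measure, hence lies
    in the hull of that member. *)
Lemma vitali_cover (Z : set (set X)) (C : R) : Z `<=` Bs ->
  (forall A, Z A -> (m A <= C)%R) ->
  exists D : set (set X), [/\ D `<=` Z, trivIset D id &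
    forall A, Z A -> exists2 B, D B & A `<=` hull B].
Proof.
move=> ZB ZC.
pose P (D : set (set X)) := [/\ D `<=` Z, trivIset D id &
  forall A, Z A -> (exists2 B, D B & A `&` B !=set0) ->
    exists B, [/\ D B, A `&` B !=set0 & (m A <= 2 * m B)%R] ].
have [] := @Zorn_bigcup _ P.
  move=> F FP Ftot; split.
  - by move=> A [D FD DA]; have [+ _ _] := FP _ FD; apply.
  - move=> A B [D1 F1 A1] [D2 F2 B2] AB; wlog D12 : A B D1 D2 F1 F2 A1 B2 AB / D1 `<=` D2.
      move=> W; have [D12|D21] := Ftot _ _ F1 F2; first exact: (W A B D1 D2).
      by apply/esym/(W B A D2 D1) => //; rewrite setIC.
    by have [_ + _] := FP _ F2; apply => //; exact: D12.
  - move=> A ZA [B [D FD DB] AB]; have [_ _ h] := FP _ FD.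
    by have [|B' [DB' AB' mAB']] := h A ZA; [exists B|exists B'; split => //; exists D].
move=> D [[DZ Dtriv Dv] Dmax]; exists D; split => // A ZA.
suff h : exists2 B, D B & A `&` B !=set0.
  have [B [DB AB mAB]] := Dv _ ZA h; exists B => //.
  by apply: sub_hull2 => //; apply: ZB => //; exact: DZ.
apply: contrapT => noB.
(* A nearly largest ball that misses [D] can be added to [D]: a ball of [Z] that meets it but not
   [D] is in [Q] too, hence less than twice as large. *)
pose Q : set (set X) := [set E | Z E /\ ~ exists2 B, D B & E `&` B !=set0].
have [|E QE|E [ZE nE] Emax] := @near_max R (set X) Q (fun E => m E) C.
- by exists A.
- by rewrite ball_gt0/= ?ZC//; [exact: QE.1|apply: ZB; exact: QE.1].
apply: (Dmax (D `|` [set E])).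
  split; first by move=> B DB; left.
  move=> /(_ E); apply: contra_not nE => sub; exists E; first by apply: sub; right.
  by rewrite setIid; exact/ball_neq0/ZB.
split.
- by move=> B [/DZ//|->].
- move=> B1 B2 [D1|->] [D2|->]//= B12; first exact: Dtriv.
    by case: nE; exists B1; rewrite // setIC.
  by case: nE; exists B2.
- move=> F ZF [B BD FB]; have [h|h] := pselect (exists2 B, D B & F `&` B !=set0).
    by have [B' [? ? ?]] := Dv _ ZF h; exists B'; split => //; left.
  exists E; split; [by right| |by apply/ltW/Emax].
  by case: BD FB => [DB FB|->//]; case: h; exists B.
Qed.

(** Only finitely many members have measure above [n.+1%:R^-1]. The hypothesis bounds finite sums
    instead of asking for disjointness, so that sparse families are covered too. *)
Lemma countable_disjoint_balls (D : set (set X)) (M : R) : D `<=` Bs ->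
  (forall s : seq (set X), uniq s -> (forall A, A \in s -> D A) ->
     (\sum_(A <- s) m A <= M)%R) ->
  countable D /\ \esum_(A in D) mu A <= M%:E.
Proof.
move=> DB h.
have hM : \esum_(A in D) mu A <= M%:E.
  apply: ge_ereal_sup => _ [F [finF FD] <-]; rewrite fsbig_finite//=.
  rewrite (eq_big_seq (fun A => (m A)%:E)); last first.
    by move=> A; rewrite in_fset_set// inE => /FD/DB/ball_muE.
  rewrite sumEFin lee_fin; apply: h => [|A]; [exact: finmap.fset_uniq|].
  by rewrite in_fset_set// inE; exact: FD.
split => //.
have -> : D = \bigcup_(n in setT) (D `&` [set A | (n.+1%:R^-1 < m A)%R]).
  apply/seteqP; split=> [A DA|A [n _ []]//].
  by have [n An] := ex_natSinv_lt (ball_gt0 (DB _ DA)); exists n.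
apply: bigcup_countable => // n _; apply: finite_set_countable.
apply: contrapT => /(infinite_set_fset (Num.truncn (M * n.+1%:R)).+1)[F FD cF].
have := h (finmap.enum_fset F) (finmap.fset_uniq F).
suff : (M < \sum_(A <- finmap.enum_fset F) m A)%R.
  by move=> h1 h2; have := lt_le_trans h1 (h2 (fun A AF => (FD A AF).1)); rewrite ltxx.
apply: (@lt_le_trans _ _ (\sum_(A <- finmap.enum_fset F) n.+1%:R^-1)%R); last first.
  by apply: ler_sum_mem => A /FD[_ /ltW].
rewrite big_const_seq count_predT iter_addr_0 -[(_ *+ size _)%R]mulr_natl ltr_pdivlMr ?ltr0n//.
apply: (@lt_le_trans _ _ (Num.truncn (M * n.+1%:R)).+1%:R); first exact: truncnS_gt.
by rewrite ler_nat.
Qed.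

(** Reduces bounds on unions of balls to finite disjoint subfamilies, where measures add up; the
    factor [K] comes from covering by hulls. *)
Lemma vitali_measure (Z : set (set X)) (M : R) : Z `<=` Bs ->
  (forall s : seq (set X), uniq s -> (forall A, A \in s -> Z A) ->
     trivIset [set` s] id -> (\sum_(A <- s) m A <= M)%R) ->
  mu (\bigcup_(A in Z) A) <= (K * M)%:E.
Proof.
move=> ZB h.
(* One-element subfamilies give the bound on sizes that [vitali_cover] asks for. *)
have ZM A : Z A -> (m A <= M)%R.
  move=> ZA; have := h [:: A]; rewrite big_seq1; apply => //.
    by move=> B; rewrite mem_seq1 => /eqP ->.
  by move=> B C /=; rewrite !mem_seq1 => /eqP -> /eqP ->.
have [D [DZ Dtriv DH]] := vitali_cover ZB ZM.
have [|s us sD|cD eD] := @countable_disjoint_balls D M; first exact: subset_trans ZB.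
  apply: h => //; first by move=> A /sD/DZ.
  by move=> A B /sD DA /sD DB; exact: Dtriv.
have DB A : D A -> Bs A by move=> /DZ/ZB.
have hm A : D A -> measurable (hull A) by move=> /DB/hull_ball/ball_mble.
apply: (@le_trans _ _ (mu (\bigcup_(A in D) hull A))).
  apply: le_measure; rewrite ?inE; [exact: sep| |].
    exact: countable_bigcup_measurable.
  by move=> x [A ZA Ax]; have [B DBB AB] := DH _ ZA; exists B => //; exact: AB.
apply: (le_trans (measure_bigcup_le_esum mu cD hm)).
apply: (@le_trans _ _ (\esum_(A in D) (K%:E * mu A))).
  apply: le_esum => A /DB BA.
  by rewrite (ball_muE (hull_ball BA)) (ball_muE BA) -EFinM lee_fin; exact: hull_le.
apply: ge_ereal_sup => _ [F [finF FD] <-].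
rewrite -ge0_mule_fsumr// EFinM; apply: lee_wpmul2l; first by rewrite lee_fin (le_trans _ K1).
by apply: le_trans eD; apply: ereal_sup_ubound; exists F.
Qed.

End Geometry.

Lemma sum_measure_le (R : realType) (d : measure_display)
    (X : measurableType d) (mu : {measure set X -> \bar R}) (I : choiceType)
    (s : seq I) (F : I -> set X) (G : set X) : uniq s -> trivIset [set` s] F ->
  (forall i, i \in s -> measurable (F i)) -> measurable G ->
  (mu G < +oo) -> (forall i, i \in s -> F i `<=` G) ->
  (\sum_(i <- s) fine (mu (F i)) <= fine (mu G))%R.
Proof.
move=> us ts ms mG Goo sG.
have Gfin : mu G \is a fin_num by rewrite ge0_fin_numE.
have FE i : i \in s -> mu (F i) = (fine (mu (F i)))%:E.
  move=> js; rewrite fineK// ge0_fin_numE// (le_lt_trans _ Goo)//.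
  by apply: le_measure; rewrite ?inE//; [exact: ms|exact: sG].
rewrite -lee_fin -sumEFin fineK//.
rewrite (eq_big_seq (fun i => mu (F i))); last by move=> i /FE.
rewrite fsbig_seq//= -(measure_fin_bigcup mu (finite_seq s) ts)//.
apply: le_measure; rewrite ?inE//.
  by apply: fin_bigcup_measurable; [exact: finite_seq|].
by move=> x [i /= js Fx]; exact: (sG i).
Qed.

Lemma sum_measureI_le (R : realType) (d : measure_display)
    (X : measurableType d) (mu : {measure set X -> \bar R})
    (s : seq (set X)) (E G : set X) : uniq s -> trivIset [set` s] id ->
  (forall A, A \in s -> measurable A) -> measurable E -> measurable G ->
  (mu G < +oo) -> (forall A, A \in s -> A `&` E `<=` G) ->
  (\sum_(A <- s) fine (mu (A `&` E)) <= fine (mu G))%R.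
Proof.
move=> us ts ms mE mG Goo sG; apply: sum_measure_le => //.
- by move=> A B As Bs [x [[Ax _] [Bx _]]]; apply: ts => //; exists x.
- by move=> A As; apply: measurableI => //; exact: ms.
Qed.

(** * Measurability and integration of sums over countable index sets *)

Section CountableSums.
Context (R : realType) (d : measure_display) (X : measurableType d).
Variables (mu : {measure set X -> \bar R}) (I : pointedType) (D : set I).
Hypothesis cD : countable D.

Lemma esum_countable : exists (P : nat -> bool) (k : nat -> I),
  (forall n, P n -> D (k n)) /\
  forall a : I -> \bar R, (forall i, 0 <= a i) ->
  \esum_(i in D) a i = \sum_(n <oo) (if P n then a (k n) else 0).
Proof.
have [P [k kb]] := countable_enum cD; exists (fun n => n \in P), k; split.
  by move=> n /set_mem Pn; case: kb => + _ _; apply.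
move=> a a0; rewrite (reindex_esum P D k)// esum_mkcond nneseries_esumT//.
by move=> n; case: ifP.
Qed.

Variable g : I -> X -> \bar R.
Hypotheses (g0 : forall i x, 0 <= g i x)
  (mg : forall i, D i -> measurable_fun setT (g i)).

Lemma measurable_esum : measurable_fun setT (fun x => \esum_(i in D) g i x).
Proof.
have [P [k [kD kE]]] := esum_countable.
rewrite (_ : (fun x => _) = fun x => \sum_(n <oo) (if P n then g (k n) x else 0)).
  apply: ge0_emeasurable_sum => //; first by move=> n x _ _; case: ifP.
  move=> n _; case Pn : (P n); last exact: measurable_cst.
  by apply: mg; exact: kD.
by apply/funext => x; rewrite kE.
Qed.

Lemma integral_esum (E : set X) : measurable E ->
  \int[mu]_(x in E) (\esum_(i in D) g i x) = \esum_(i in D) \int[mu]_(x in E) g i x.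
Proof.
move=> mE; have [P [k [kD kE]]] := esum_countable.
rewrite kE; last by move=> i; exact: integral_ge0.
under eq_integral do rewrite kE//.
rewrite integral_nneseries//; last 2 first.
- move=> n; case Pn : (P n); last exact: measurable_cst.
  by apply: measurable_funS (mg (kD n Pn)).
- by move=> n x _; case: ifP.
by apply: eq_eseriesr => n _; case: ifP => // _; rewrite integral0.
Qed.

End CountableSums.

(** Class [j] is [a / 2 ^+ j.+1 < t <= a / 2 ^+ j]. The first alternative is written as a sum so
    that it can be added up over the balls and the two summations exchanged. *)
Lemma dyadic_split (R : realType) (a t : R) (J : nat) : (0 <= t <= a)%R ->
  (t <= \sum_(j < J) (if a < t * 2 ^+ j.+1 <= 2 * a then t else 0))%R \/ (t * 2 ^+ J <= a)%R.
Proof.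
move=> /andP[t0 ta]; elim: J => [|J [IH|IH]]; first by right; rewrite expr0 mulr1.
  by left; rewrite big_ord_recr /= (le_trans IH)// lerDl; case: ifP.
have S0 (n : nat) : (0 <= \sum_(j < n) (if a < t * 2 ^+ j.+1 <= 2 * a then t else 0))%R.
  by apply: sumr_ge0 => j _; case: ifP.
have [h|h] := leP (t * 2 ^+ J.+1)%R a; [by right|left].
rewrite big_ord_recr /= h exprS mulrCA ler_pM2l ?ltr0n// IH lerDr; exact: S0.
Qed.

Section Geometry2.
Context (R : realType) (d : measure_display) (X : measurableType d).
Variables (mu : {measure set X -> \bar R}) (Bs : set (set X)) (K : R).
Hypotheses (K1 : (1 <= K)%R) (bb : ball_basis mu Bs K) (sep : separable_balls Bs).

Local Notation m A := (fine (mu A)).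
Local Notation star := (ball_star mu Bs).

Lemma mD A E : Bs A -> measurable E -> m A = (m (A `&` E) + m (A `\` E))%R.
Proof.
move=> BA mE; have mA := ball_mble bb BA.
have fA := ball_fin bb BA; have Aoo : mu A < +oo by rewrite -ge0_fin_numE.
have f1 : mu (A `&` E) \is a fin_num.
  rewrite ge0_fin_numE// (le_lt_trans _ Aoo)//; apply: le_measure; rewrite ?inE//.
  exact: measurableI.
have f2 : mu (A `\` E) \is a fin_num.
  rewrite ge0_fin_numE// (le_lt_trans _ Aoo)//; apply: le_measure; rewrite ?inE//.
  exact: measurableD.
by rewrite -fineD// addeC -measureDI.
Qed.

(* A lower bound on the balls' share of [~` E] bounds the union of an approximating
   sequence of balls through [vitali_measure], contradicting (B3). *)
Lemma majority_ball E : measurable E -> 0 < mu E -> mu E < +oo ->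
  exists2 A, Bs A & (m A <= 2 * m (A `&` E))%R.
Proof.
move=> mE E0 Eoo; apply: contrapT => none; have hK := K1.
have small A : Bs A -> (m A <= 2 * m (A `\` E))%R.
  move=> BA; have := mD BA mE; have [//|] := leP (m A) (2 * m (A `\` E))%R.
  by move=> h1 h2; case: none; exists A => //; lra.
have fE : mu E \is a fin_num by rewrite ge0_fin_numE.
have e0 : (0 < m E)%R by rewrite -lte_fin fineK.
(* With this tolerance the balls of [D] give [m E <= (2 * K + 1) * eps], which is less than
   [4 * K * eps = m E]. *)
have eps0 : (0 < m E / (4 * K))%R by rewrite divr_gt0//; lra.
have [D [cD DB hD]] := ball_approx bb mE eps0.
set eps := (m E / (4 * K))%R in eps0 hD.
have mU : measurable (\bigcup_(A in D) A) by exact: sep.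
have mUE : measurable ((\bigcup_(A in D) A) `\` E) by exact: measurableD.
have mEU : measurable (E `\` (\bigcup_(A in D) A)) by exact: measurableD.
have mdiff : measurable (E `+` \bigcup_(A in D) A) by exact: measurableU.
have UE : mu ((\bigcup_(A in D) A) `\` E) < eps%:E.
  by apply: le_lt_trans hD; apply: le_measure; rewrite ?inE//; right.
have EU : mu (E `\` (\bigcup_(A in D) A)) < eps%:E.
  by apply: le_lt_trans hD; apply: le_measure; rewrite ?inE//; left.
suff hU : mu (\bigcup_(A in D) A) <= (K * (2 * eps))%:E.
  have : mu E <= (K * (2 * eps) + eps)%:E.
    apply: (@le_trans _ _ (mu (\bigcup_(A in D) A) + mu (E `\` (\bigcup_(A in D) A)))).
      apply: le_trans (measureU2 _ _ _) => //; apply: le_measure; rewrite ?inE//.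
        exact: measurableU.
      by move=> x Ex; have [?|?] := pselect ((\bigcup_(A in D) A) x); [left|right].
    by rewrite EFinD leeD// ltW.
  rewrite -(fineK fE) lee_fin.
  have -> : m E = (4 * K * eps)%R by rewrite /eps mulrC divfK//; apply/eqP; lra.
  nra.
apply: (vitali_measure K1 bb) => // s us sD ts.
apply: (@le_trans _ _ (\sum_(A <- s) (2 * m (A `&` ~` E)))%R).
  apply: ler_sum_mem => A As; rewrite -setDE; apply: small; exact/DB/sD.
rewrite -mulr_sumr ler_pM2l//.
apply: (@le_trans _ _ (m ((\bigcup_(A in D) A) `\` E))).
  apply: sum_measureI_le => //; first by move=> A /sD/DB/(ball_mble bb).
  - exact: measurableC.
  - exact: lt_le_trans UE (leey _).
  - by move=> A As x [Ax nEx]; split => //; exists A => //; exact: sD.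
rewrite -lee_fin fineK ?ltW// ge0_fin_numE//; exact: lt_le_trans UE (leey _).
Qed.

(** (B3) for the whole space: the symmetric difference of [setT] and a union is the complement of
    that union. *)
Lemma balls_cover_ae : exists D : set (set X),
  [/\ countable D, D `<=` Bs & mu (~` \bigcup_(A in D) A) = 0].
Proof.
have h n : exists D : set (set X), [/\ countable D, D `<=` Bs &
    mu (~` \bigcup_(A in D) A) < (n.+1%:R^-1)%:E].
  have [D [cD DB hD]] := ball_approx bb measurableT (eps := n.+1%:R^-1) ltac:(by []).
  exists D; split => //; rewrite (_ : ~` _ = setT `+` \bigcup_(A in D) A)//.
  by rewrite /setY setTD setDT setU0.
have [D hD] := choice h; exists (\bigcup_n D n); split.
- by apply: bigcup_countable => // n _; have [] := hD n.
- by move=> A [n _]; have [_ + _] := hD n; apply.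
have DB n : D n `<=` Bs by have [] := hD n.
have mb n : measurable (\bigcup_(A in D n) A) by exact: sep.
apply/eqP; rewrite eq_le measure_ge0 andbT; apply/lee_addgt0Pr => e e0.
rewrite add0e; have [n ne] := ex_natSinv_lt e0.
have [_ _ /ltW hn] := hD n; apply: le_trans (le_trans hn _); last by rewrite lee_fin ltW.
apply: le_measure; rewrite ?inE.
- by apply: measurableC; apply: sep => A [k _]; exact: DB.
- exact: measurableC.
- by apply: subsetC => x [A DA Ax]; exists A => //; exists n.
Qed.

End Geometry2.

(** * Sparse families *)

Section SparseFamilies.
Context (R : realType) (d : measure_display) (X : measurableType d).
Variables (mu : {measure set X -> \bar R}) (Bs : set (set X)) (K : R).
Hypotheses (K1 : (1 <= K)%R) (bb : ball_basis mu Bs K) (sep : separable_balls Bs).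

Local Notation m A := (fine (mu A)).

Variables (S : set (set X)) (Es : set X -> set X) (gamma : R) (Q : set X).
Hypotheses (gamma0 : (0 < gamma)%R) (SB : S `<=` Bs).
Hypothesis EsP : forall A, S A ->
  [/\ measurable (Es A), Es A `<=` A & (gamma * m A <= m (Es A))%R].
Hypothesis Es_disj : trivIset S Es.
Hypotheses (BQ : Bs Q) (SQ : forall A, S A -> A `<=` Q).

Lemma sparse_countable : countable S.
Proof.
have [] // := @countable_disjoint_balls _ _ _ mu Bs K bb S (gamma^-1 * m Q)%R SB.
move=> s us sS; rewrite -(ler_pM2l gamma0) mulrA divff ?gt_eqF// mul1r mulr_sumr.
apply: (@le_trans _ _ (\sum_(A <- s) m (Es A))%R).
  by apply: ler_sum_mem => A /sS/EsP[].
apply: sum_measure_le => //.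
- by move=> A B /sS SA /sS SB'; exact: Es_disj.
- by move=> A /sS/EsP[].
- exact: (ball_mble bb BQ).
- by rewrite (ball_muE bb BQ) ltry.
- by move=> A /sS SA; apply: subset_trans (SQ SA); have [] := EsP SA.
Qed.

(** The Carleson packing condition: the disjoint sets [Es A] all lie in [U]. It serves both for
    [U = Q] and for the union of a dyadic class. *)
Lemma carleson (s : seq (set X)) (U : set X) : uniq s -> (forall A, A \in s -> S A) ->
  measurable U -> mu U < +oo -> (forall A, A \in s -> A `<=` U) ->
  (\sum_(A <- s) m A <= gamma^-1 * m U)%R.
Proof.
move=> us sS mU Uoo sU; rewrite -(ler_pM2l gamma0) mulrA divff ?gt_eqF// mul1r mulr_sumr.
apply: (@le_trans _ _ (\sum_(A <- s) m (Es A))%R).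
  by apply: ler_sum_mem => A /sS/EsP[].
apply: sum_measure_le => //.
- by move=> A B /sS SA /sS SB'; exact: Es_disj.
- by move=> A /sS/EsP[].
- by move=> A As; apply: subset_trans (sU _ As); have [] := EsP (sS _ As).
Qed.

Variable E : set X.
Hypotheses (mE : measurable E) (EQ : E `<=` Q).

Let Eoo : mu E < +oo.
Proof.
apply: le_lt_trans (_ : mu Q < +oo); last by rewrite (ball_muE bb BQ) ltry.
by apply: le_measure; rewrite ?inE//; exact: (ball_mble bb BQ).
Qed.

Let m0 (A : set X) : (0 <= m A)%R. Proof. by rewrite fine_ge0. Qed.

(* The balls with [m (A `&` E)] comparable to [2 ^- j * m A] cover, by [vitali_measure],
   a set of measure [<= C * 2 ^ j * m E]; their total measure is controlled by
   the Carleson condition. *)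
Lemma sparse_dyadic_class (s : seq (set X)) (t : R) : (0 < t)%R -> uniq s ->
  (forall A, A \in s -> S A) ->
  (forall A, A \in s -> (m A < m (A `&` E) * t <= 2 * m A)%R) ->
  (\sum_(A <- s) m (A `&` E) <= 2 * K / gamma * m E)%R.
Proof.
move=> t0 us sS st.
have sB A : A \in s -> Bs A by move=> /sS/SB.
pose U := \bigcup_(A in [set` s]) A.
have mU : measurable U by apply: sep => A /= /sB.
have UQ : U `<=` Q by move=> x [A /= /sS SA Ax]; exact: SQ Ax.
have Uoo : mu U < +oo.
  apply: le_lt_trans (_ : mu Q < +oo); last by rewrite (ball_muE bb BQ) ltry.
  by apply: le_measure; rewrite ?inE//; exact: (ball_mble bb BQ).
have hU : mu U <= (K * (t * m E))%:E.
  apply: (vitali_measure K1 bb) => // s' us' ss' ts'.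
  apply: (@le_trans _ _ (\sum_(A <- s') t * m (A `&` E))%R).
    by apply: ler_sum_mem => A /ss'/= /st/andP[/ltW]; rewrite mulrC.
  rewrite -mulr_sumr ler_pM2l//; apply: sum_measureI_le => //.
  by move=> A /ss'/sB BA; exact: (ball_mble bb BA).
have {}hU : (m U <= K * (t * m E))%R.
  by rewrite -lee_fin fineK// ge0_fin_numE.
rewrite -(ler_pM2l t0) mulr_sumr.
apply: (@le_trans _ _ (\sum_(A <- s) 2 * m A)%R).
  by apply: ler_sum_mem => A /st/andP[_]; rewrite mulrC.
rewrite -mulr_sumr.
have sU A : A \in s -> A `<=` U by move=> As x Ax; exists A.
apply: (@le_trans _ _ (2 * (gamma^-1 * m U))%R).
  by rewrite ler_pM2l//; exact: carleson.
rewrite (_ : (t * _ = 2 * (gamma^-1 * (K * (t * m E))))%R); last by ring.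
by rewrite ler_pM2l// ler_pM2l// invr_gt0.
Qed.

Lemma sparse_sum (s : seq (set X)) (J : nat) : uniq s -> (forall A, A \in s -> S A) ->
  (\sum_(A <- s) m (A `&` E) <=
   J%:R * (2 * K / gamma * m E) + gamma^-1 * m Q / 2 ^+ J)%R.
Proof.
move=> us sS.
have sB A : A \in s -> Bs A by move=> /sS/SB.
have le1 A : Bs A -> (0 <= m (A `&` E) <= m A)%R.
  by move=> BA; rewrite m0/= (mD bb BA mE) lerDl.
pose c (A : set X) (j : nat) := (m A < m (A `&` E) * 2 ^+ j.+1 <= 2 * m A)%R.
have p2 n : (0 < 2 ^+ n :> R)%R by rewrite exprn_gt0.
apply: (@le_trans _ _ (\sum_(A <- s)
    (\sum_(j < J) (if c A j then m (A `&` E) else 0) + m A / 2 ^+ J))%R).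
  apply: ler_sum_mem => A /sB BA.
  have S0 : (0 <= \sum_(j < J) (if c A j then m (A `&` E) else 0))%R.
    by apply: sumr_ge0 => j _; case: ifP.
  have [h|h] := dyadic_split J (le1 A BA).
    by apply: le_trans h _; rewrite lerDl divr_ge0// ltW.
  by rewrite -ler_pdivlMr// in h; apply: le_trans h _; rewrite lerDr.
rewrite big_split /= exchange_big /= lerD//; last first.
  rewrite -mulr_suml ler_pM2r ?invr_gt0//; apply: carleson => //.
  - exact: (ball_mble bb BQ).
  - by rewrite (ball_muE bb BQ) ltry.
  - by move=> A /sS/SQ.
rewrite mulr_natl -[X in (_ <= _ *+ X)%R](card_ord J) -sumr_const.
apply: ler_sum => j _; rewrite -big_mkcond /= -big_filter.
apply: (@sparse_dyadic_class _ (2 ^+ j.+1)) => //; first exact: filter_uniq.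
  by move=> A; rewrite mem_filter => /andP[_ /sS].
by move=> A; rewrite mem_filter => /andP[].
Qed.

End SparseFamilies.

Lemma sparse_exp (R : realType) (d : measure_display) (X : measurableType d)
    (mu : {measure set X -> \bar R}) (Bs : set (set X)) (K gamma : R)
    (S : set (set X)) (Es bar : set X -> set X) (Q : set X) (lambda : R) :
  (1 <= K)%R -> ball_basis mu Bs K -> separable_balls Bs ->
  (0 < gamma)%R -> S `<=` Bs ->
  (forall A, S A -> [/\ measurable (Es A), Es A `<=` A &
     (gamma * fine (mu A) <= fine (mu (Es A)))%R]) ->
  trivIset S Es -> Bs Q -> (forall A, S A -> A `<=` Q) ->
  (forall A, S A -> measurable (bar A)) -> (forall A, S A -> bar A `<=` A) ->
  (0 < lambda)%R ->
  mu [set x | lambda%:E < \esum_(G in S) (\1_(bar G) x)%:E] <=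
    (2 * expR (- (gamma * ln 2 / (4 * K) * lambda)))%:E * mu Q.
Proof.
move=> K1 bb sep g0 SB EsP Ed BQ SQ mbar barS l0.
have cS := sparse_countable bb g0 SB EsP Ed BQ SQ.
pose N (x : X) : \bar R := \esum_(G in S) (\1_(bar G) x)%:E.
have g_ge0 (A : set X) (x : X) : (0 : \bar R) <= (\1_(bar A) x)%:E by rewrite lee_fin.
have mg (A : set X) : S A -> measurable_fun setT (fun x => (\1_(bar A) x)%:E : \bar R).
  by move=> SA; apply/measurable_EFinP; exact: measurable_indic (mbar _ SA).
have mN : measurable_fun setT N by exact: measurable_esum.
set E := [set x | _].
have mE : measurable E.
  rewrite (_ : E = setT `&` [set x | lambda%:E < N x]); last by rewrite setTI.
  exact: emeasurable_fun_o_infty.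
have EQ : E `<=` Q.
  move=> x Ex; apply: contrapT => nQx.
  suff N0 : N x = 0.
    by move: Ex; rewrite /E /= -/(N x) N0 lte_fin ltNge ltW.
  apply: esum1 => A SA; rewrite indicE memNset// => bAx; apply: nQx.
  by apply: (SQ _ SA); exact: barS bAx.
have muQ := ball_muE bb BQ.
have Eoo : mu E < +oo.
  apply: le_lt_trans (_ : mu Q < +oo); last by rewrite muQ ltry.
  by apply: le_measure; rewrite ?inE//; exact: (ball_mble bb BQ).
have Efin : mu E \is a fin_num by rewrite ge0_fin_numE.
set e := fine (mu E); have e0 : (0 <= e)%R by rewrite fine_ge0.
set q := fine (mu Q) in muQ *; have q0 : (0 < q)%R := ball_gt0 bb BQ.
have muE : mu E = e%:E by rewrite fineK.
have eq : (e <= q)%R.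
  rewrite -lee_fin -muE -muQ; apply: le_measure; rewrite ?inE//.
  exact: (ball_mble bb BQ).
have main J : (lambda * e <= J%:R * (2 * K / gamma * e) + gamma^-1 * q / 2 ^+ J)%R.
  rewrite -lee_fin EFinM -muE -integral_cst//.
  apply: (@le_trans _ _ (\int[mu]_(x in E) N x)).
    apply: ge0_le_integral => //.
    - by move=> x _ /=; rewrite lee_fin ltW.
    - exact: measurable_funTS.
    - by move=> x Ex /=; apply/ltW.
  rewrite integral_esum//; apply: ge_ereal_sup => _ [F [finF FS] <-].
  rewrite fsbig_finite//=.
  have FA A : A \in finmap.enum_fset (fset_set F) -> S A.
    by rewrite in_fset_set// inE => /FS.
  have {}FE A : A \in finmap.enum_fset (fset_set F) ->
      \int[mu]_(x in E) (\1_(bar A) x)%:E <= (fine (mu (A `&` E)))%:E.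
    move=> /FA SA; have mA := ball_mble bb (SB _ SA); rewrite integral_indic//; last exact: mbar.
    have h : mu (A `&` E) < +oo.
      by apply: le_lt_trans Eoo; apply: le_measure; rewrite ?inE//; exact: measurableI.
    rewrite fineK ?ge0_fin_numE//; apply: le_measure; rewrite ?inE//.
    - by apply: measurableI => //; exact: mbar.
    - exact: measurableI.
    - by apply: setSI; exact: barS.
  apply: (@le_trans _ _ (\sum_(A <- finmap.enum_fset (fset_set F)) (fine (mu (A `&` E)))%:E)).
    by rewrite big_seq [leRHS]big_seq; apply: lee_sum => A /FE.
  rewrite sumEFin lee_fin; apply: (sparse_sum K1 bb sep g0 SB EsP Ed BQ SQ) => //.
  exact: finmap.fset_uniq.
rewrite muE muQ -EFinM lee_fin.
(* For [J <= lambda / a] the first term of [main] is at most half of [lambda * e]. *)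
pose a := (4 * K / gamma)%R; have a0 : (0 < a)%R.
  by rewrite divr_gt0// mulr_gt0// (lt_le_trans _ K1).
pose J := Num.truncn (lambda / a).
have la0 : (0 <= lambda / a)%R by rewrite divr_ge0// ltW.
have /andP[Jle ltJ] := Num.Theory.truncn_itv la0; rewrite -/J in Jle ltJ.
have p2 : (0 < 2 ^+ J :> R)%R by rewrite exprn_gt0.
have eJ : (e <= q / 2 ^+ J)%R.
  (* For [J = 0] the claim is [e <= q]. Otherwise [4 / gamma <= a <= lambda], and once the first
     term of [main] is absorbed there remains [2 * e <= q / 2 ^+ J]. *)
  have [J0|Jpos] := posnP J; first by rewrite J0 expr0 divr1.
  have hJ : (J%:R * a <= lambda)%R by rewrite -ler_pdivlMr.
  have aJ : (a <= lambda)%R.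
    by apply: le_trans hJ; rewrite ler_peMl ?(ltW a0)// ler1n.
  have h1 := main J.
  have h2 : (J%:R * (2 * K / gamma * e) <= lambda / 2 * e)%R.
    rewrite mulrA ler_wpM2r//.
    by rewrite (_ : (_ * _ = J%:R * a / 2)%R) ?ler_pM2r//; rewrite /a; field; lra.
  have h3 : (lambda * e <= 2 * gamma^-1 * (q / 2 ^+ J))%R.
    rewrite (_ : (2 * _ * _ = 2 * (gamma^-1 * q / 2 ^+ J))%R); last by ring.
    lra.
  have h4 : (4 * gamma^-1 * e <= lambda * e)%R.
    rewrite ler_wpM2r// (le_trans _ aJ)// /a ler_pM2r ?invr_gt0//.
    by rewrite ler_peMr.
  have h5 : (gamma^-1 * (4 * e) <= gamma^-1 * (2 * (q / 2 ^+ J)))%R.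
    have -> : (gamma^-1 * (4 * e) = 4 * gamma^-1 * e)%R by ring.
    have -> : (gamma^-1 * (2 * (q / 2 ^+ J)) = 2 * gamma^-1 * (q / 2 ^+ J))%R by ring.
    exact: le_trans h3.
  rewrite ler_pM2l ?invr_gt0// in h5.
  have : (0 <= q / 2 ^+ J)%R by rewrite divr_ge0// ltW.
  lra.
apply: (le_trans eJ); rewrite mulrC ler_pM2r//.
have -> : ((2 ^+ J)^-1 = expR (- (ln 2 * J%:R)) :> R)%R.
  by rewrite expRN expRM_natr lnK// posrE.
(* The factor 2, that is [expR (ln 2)], makes up for the truncation, since [lambda / a < J.+1]. *)
rewrite -[X in (_ <= X * _)%R](@lnK R 2%R) ?posrE// -expRD ler_expR.
have -> : (gamma * ln 2 / (4 * K) * lambda = ln 2 * (lambda / a))%R.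
  by rewrite /a; field; lra.
have l2 : (0 <= ln 2 :> R)%R by rewrite ln_ge0// ler1n.
have : (ln 2 * (lambda / a) <= ln 2 * J.+1%:R :> R)%R by rewrite ler_wpM2l// ltW.
rewrite -natr1; lra.
Qed.

(** * Suprema over uncountably many balls *)

Section EssentialUnion.
Context (R : realType) (d : measure_display) (X : measurableType d).
Variables (mu : {measure set X -> \bar R}) (Bs : set (set X)) (K : R).
Hypotheses (bb : ball_basis mu Bs K) (sep : separable_balls Bs).

Local Notation m A := (fine (mu A)).

(** Exhaustion: the measure inside [O] of the union over a countable index set attains its supremum,
    on the join of a maximizing sequence. One more index then adds nothing but a null set. *)
Lemma ess_union_finite (I : pointedType) (P : set I) (U : I -> set X) (O : set X) :
  measurable O -> mu O < +oo -> (forall i, P i -> measurable (U i)) ->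
  exists P0 : set I, [/\ countable P0, P0 `<=` P &
    forall i, P i -> mu ((U i `&` O) `\` \bigcup_(j in P0) U j) = 0].
Proof.
move=> mO Ooo mU.
have Ofin A : measurable A -> mu (A `&` O) \is a fin_num.
  move=> mA; rewrite ge0_fin_numE// (le_lt_trans _ Ooo)//.
  by apply: le_measure; rewrite ?inE//; exact: measurableI.
pose F (C : set I) := \bigcup_(j in C) U j.
pose G := [set C : set I | countable C /\ C `<=` P].
have mF C : G C -> measurable (F C).
  by move=> [cC CP]; apply: countable_bigcup_measurable => // i /CP; exact: mU.
pose f C := m (F C `&` O).
have fle C : G C -> (f C <= m O)%R.
  move=> GC; apply: fine_le; [exact/Ofin/mF|by rewrite ge0_fin_numE|].
  by apply: le_measure; rewrite ?inE//; apply: measurableI => //; exact: mF.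
have hs : has_sup [set f C | C in G].
  split; first by exists (f set0), set0 => //; split => //; exact: countable0.
  by exists (m O) => _ [C GC <-]; exact: fle.
have /choice[C hC] : forall n : nat, exists C, G C /\ (sup [set f C | C in G] - n.+1%:R^-1 < f C)%R.
  move=> n; have n0 : (0 < n.+1%:R^-1 :> R)%R by rewrite invr_gt0.
  have [_ [C GC <-] h] := sup_adherent n0 hs.
  by exists C.
pose C0 := \bigcup_n C n.
have GC0 : G C0.
  split; first by apply: bigcup_countable => // n _; have [[]] := hC n.
  by move=> i [n _]; have [[_ +] _] := hC n; apply.
have FC0 : (sup [set f C | C in G] <= f C0)%R.
  apply/ler_addgt0Pr => e e0; have [n ne] := ex_natSinv_lt e0.
  have [GCn /ltW] := hC n; rewrite lerBlDr => /le_trans; apply.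
  apply: lerD (ltW ne).
  apply: fine_le; [exact/Ofin/mF|exact/Ofin/mF|].
  apply: le_measure; rewrite ?inE; [by apply: measurableI => //; exact: mF..|].
  by apply: setSI => x [i Ci Ux]; exists i => //; exists n.
exists C0; split; [exact: GC0.1|exact: GC0.2|move=> i Pi].
have GC1 : G (C0 `|` [set i]).
  split; last by move=> j [/GC0.2//|->].
  by rewrite -bigcup2E; apply: bigcup_countable => // -[|[|n]] _ /=;
    do ?[exact: GC0.1|exact: countable1|exact: countable0].
have f1 : (f (C0 `|` [set i]) <= f C0)%R.
  by apply: le_trans FC0; apply: sup_ubound; [exact: hs.2|exists (C0 `|` [set i])].
have mD : measurable ((U i `&` O) `\` F C0).
  by apply: measurableD; [apply: measurableI => //; exact: mU|exact: mF].
have E1 : mu (F (C0 `|` [set i]) `&` O) = mu (F C0 `&` O) + mu ((U i `&` O) `\` F C0).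
  rewrite -measureU//; last 2 first.
  - by apply: measurableI => //; exact: mF.
  - by rewrite -subset0 => x [[Fx _] [_ nF]].
  congr (mu _); apply/seteqP; split=> x.
    move=> [[j [C0j|->] Ux] Ox]; first by left; split => //; exists j.
    by have [?|?] := pselect (F C0 x); [left|right].
  move=> [[[j C0j Ux] Ox]|[[Ux Ox] _]]; split => //; first by exists j => //; left.
  by exists i => //; right.
have Dfin : mu ((U i `&` O) `\` F C0) \is a fin_num.
  rewrite ge0_fin_numE// (le_lt_trans _ Ooo)//.
  by apply: le_measure; rewrite ?inE// => x [[]].
apply/eqP; rewrite eq_le measure_ge0 andbT -(fineK Dfin) lee_fin.
have := f1; rewrite /f E1 fineD//; last exact/Ofin/mF.
by rewrite gerDl.
Qed.

(** Countably many balls cover the space up to a null set, so the case of a set [O] of finite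
    measure is applied in each of them. *)
Lemma ess_union (I : pointedType) (P : set I) (U : I -> set X) :
  (forall i, P i -> measurable (U i)) ->
  exists P0 : set I, [/\ countable P0, P0 `<=` P &
    forall i, P i -> mu.-negligible (U i `\` \bigcup_(j in P0) U j)].
Proof.
move=> mU; have [D [cD DB D0]] := balls_cover_ae bb sep.
have h O : exists P0 : set I, Bs O -> [/\ countable P0, P0 `<=` P &
    forall i, P i -> mu ((U i `&` O) `\` \bigcup_(j in P0) U j) = 0].
  have [BO|nBO] := pselect (Bs O); last by exists set0 => /nBO.
  have [|P0 hP0] := @ess_union_finite I P U O (ball_mble bb BO) _ mU; last by exists P0.
  by rewrite (ball_muE bb BO) ltry.
have [C hC] := choice h; exists (\bigcup_(O in D) C O); split.
- by apply: bigcup_countable => // O /DB/hC[].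
- by move=> i [ O /DB/hC[_ + _]]; apply.
- move=> i Pi.
  have sub : U i `\` \bigcup_(j in \bigcup_(O in D) C O) U j `<=`
    ~` (\bigcup_(A in D) A) `|` \bigcup_(O in D) ((U i `&` O) `\` \bigcup_(j in C O) U j).
    move=> x [Ux nx]; have [[ O DO Ox]|] := pselect ((\bigcup_(A in D) A) x); last by left.
    by right; exists O => //; split => // -[j Cj Uj]; apply: nx; exists j => //; exists O.
  apply: negligibleS sub _; apply: negligibleU.
    by apply/negligibleP => //; apply: measurableC; apply: sep.
  have mM O : D O -> measurable ((U i `&` O) `\` \bigcup_(j in C O) U j).
    move=> /DB BO; have [cC CP _] := hC _ BO; apply: measurableD.
      by apply: measurableI; [exact: mU|exact: (ball_mble bb BO)].
    by apply: countable_bigcup_measurable => // j /CP; exact: mU.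
  apply/negligibleP; first exact: countable_bigcup_measurable.
  apply/eqP; rewrite eq_le measure_ge0 andbT.
  apply: (le_trans (measure_bigcup_le_esum mu cD mM)).
  by rewrite esum1// => O /DB/hC[_ _]; apply.
Qed.

(** Makes the truncated operator well defined. For each rational level [q], countably many balls
    carry the superlevel sets [U q B] up to null sets; the supremum over all balls so chosen is the
    required one. *)
Lemma ess_sup_balls (g : set X -> X -> R) :
  (forall B, Bs B -> measurable_fun setT (g B)) ->
  exists h : X -> \bar R,
  [/\ measurable_fun setT h,
    forall B, Bs B -> {ae mu, forall x, B x -> (g B x)%:E <= h x} &
    forall k : X -> \bar R,
      (forall B, Bs B -> {ae mu, forall x, B x -> (g B x)%:E <= k x}) ->
      {ae mu, forall x, h x <= k x}].
Proof.
move=> mg; pose U (q : rat) (B : set X) := B `&` [set x | (ratr q < g B x)%R].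
have mU q B : Bs B -> measurable (U q B).
  move=> BB; have mB := ball_mble bb BB.
  apply: measurableI => //.
  rewrite (_ : [set _ | _] = setT `&` g B @^-1` [set` `]ratr q, +oo[]).
    by apply: (mg _ BB) => //; exact: measurable_itv.
  by rewrite setTI; apply/seteqP; split => x /=; rewrite in_itv/= andbT.
have /choice[C hC] := fun q => @ess_union _ Bs (U q) (mU q).
pose D := \bigcup_q C q.
have cD : countable D by apply: bigcup_countable => // q _; have [] := hC q.
have DB : D `<=` Bs by move=> B [q _]; have [_ + _] := hC q; apply.
have [P [k kb]] := countable_enum cD.
have kD n : P n -> D (k n) by case: kb => + _ _; apply.
(* The value [-oo] off the ball [k n] lets [g (k n)] count only on that ball. *)
pose G (n : nat) (x : X) : \bar R :=
  if (n \in P) && (x \in (k n : set X)) then (g (k n) x)%:E else -oo.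
have mG n : measurable_fun setT (G n).
  rewrite /G; have [nP|nP] := boolP (n \in P); last exact: measurable_cst.
  have BB : Bs (k n) by apply/DB/kD/set_mem.
  apply: measurable_fun_ifT => //=; last by apply/measurable_EFinP; exact: mg.
  apply: (@measurable_fun_bool _ _ _ _ true); rewrite setTI.
  rewrite (_ : _ @^-1` _ = k n); first exact: (ball_mble bb BB).
  by apply/seteqP; split => x /=; [move/set_mem|move/mem_set].
pose h (x : X) := esups (G ^~ x) 0%N; exists h; split.
- exact: measurable_fun_esups.
- move=> B BB.
  have : {ae mu, forall x, forall q : rat, ~ (U q B `\` \bigcup_(j in C q) U q j) x}.
    have /ae_foralln : forall n : nat, {ae mu, forall x,
        if choice.unpickle n is Some q
        then ~ (U q B `\` \bigcup_(j in C q) U q j) x else True}.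
      move=> n; case: choice.unpickle => [q|]; last exact: aeW.
      have [_ _ /(_ B BB) N] := hC q.
      by apply: negligibleS N => x /=; exact: contrapT.
    by apply: filterS => x hx q; have := hx (choice.pickle q); rewrite choice.pickleK.
  apply: filterS => x hx Bx; rewrite leNgt; apply/negP => hlt.
  (* A rational level between [h x] and [g B x] puts [x] into [U q B], hence into some [U q B'] with
     [B'] in [C q], and then [h x] exceeds [q]. *)
  have [q hq qg] : exists2 q : rat, h x <= (ratr q)%:E & (ratr q < g B x)%R.
    move: hlt; case: (h x) => [r|//|_].
    - rewrite lte_fin => /rat_in_itvoo[q]; rewrite in_itv/= => /andP[q1 q2].
      by exists q => //; rewrite lee_fin ltW.
    - have /rat_in_itvoo[q] : (g B x - 1 < g B x)%R by lra.
      by rewrite in_itv/= => /andP[q1 q2]; exists q => //; rewrite leNye.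
  apply: (hx q); split => // -[B' CB' [B'x qB']].
  have [_ _ /(_ B') [|n Pn kn]] := kb; first by exists q.
  suff /le_trans/(_ hq) : (g B' x)%:E <= h x by rewrite lee_fin leNgt (qB' : is_true _).
  by apply: ereal_sup_ubound; exists n => //; rewrite /G !mem_set// kn.
- move=> l hl; have : {ae mu, forall x n, P n -> k n x -> (g (k n) x)%:E <= l x}.
    apply: ae_foralln => n; have [Pn|nPn] := pselect (P n).
      by have := hl _ (DB _ (kD _ Pn)); apply: filterS => x + _.
    by apply: aeW => x /nPn.
  apply: filterS => x hx; apply: ge_ereal_sup => _ [n _ <-]; rewrite /G.
  by case: ifPn => [/andP[/set_mem Pn /set_mem kx]|_]; [exact: hx|rewrite leNye].
Qed.

End EssentialUnion.

(** * Bochner measurability and restriction of functions to sets *)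

Section FunctionSpaces.
Context (R : realType) (d : measure_display) (X : measurableType d).
Variables (mu : {measure set X -> \bar R}).

Lemma simple_map_comp (V W : normedModType R) (phi : V -> W) (s : X -> V) :
  simple_map s -> simple_map (phi \o s).
Proof.
move=> [fs ms]; split.
  rewrite (_ : range _ = phi @` range s); first exact: finite_image.
  by rewrite image_comp.
move=> w; rewrite (_ : _ @^-1` _ = \bigcup_(v in range s `&` phi @^-1` [set w]) s @^-1` [set v]).
  by apply: fin_bigcup_measurable => //; exact: finite_setIl.
apply/seteqP; split => [x /= <-|x [v [_ /= <-] /= -> //]].
by exists (s x).
Qed.

Lemma simple_map_norm (V : normedModType R) (s : X -> V) :
  simple_map s -> measurable_fun setT (fun x => `|s x|%R : R).
Proof.
move=> [fs ms] _ Y mY; rewrite setTI.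
rewrite (_ : _ @^-1` _ = \bigcup_(v in range s `&` [set v | Y `|v|%R]) s @^-1` [set v]).
  by apply: fin_bigcup_measurable => //; exact: finite_setIl.
apply/seteqP; split => [x /= Yx|x [v [_ /= Yv] /= -> //]].
by exists (s x).
Qed.

Lemma simple_map_cut (V : normedModType R) (s : X -> V) (D : set X) : measurable D ->
  simple_map s -> simple_map (cut s D).
Proof.
move=> mD [fs ms].
have cutE x : cut s D x = if x \in D then s x else 0%R.
  by rewrite /cut indicE; case: (x \in D); rewrite ?scale1r ?scale0r.
split.
  apply: (@sub_finite_set _ _ (range s `|` [set 0%R])).
    by move=> _ [x _ <-]; rewrite cutE; case: ifP => _; [left; exists x|right].
  by rewrite finite_setU; split => //; exact: finite_set1.
move=> v; have [->|v0] := eqVneq v 0%R.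
  rewrite (_ : _ @^-1` _ = ~` D `|` s @^-1` [set 0%R]).
    by apply: measurableU => //; exact: measurableC.
  apply/seteqP; split => [x /=|x /=]; rewrite cutE; case: ifPn => // xD.
  - by right.
  - by left => Dx; move/negP: xD; apply; rewrite inE.
  - by move=> [Dx|//]; move: xD; rewrite inE.
rewrite (_ : _ @^-1` _ = D `&` s @^-1` [set v]); first exact: measurableI.
apply/seteqP; split => [x /=|x /=]; rewrite cutE; case: ifPn => // xD.
- by split => //; move: xD; rewrite inE.
- by move=> v0'; move: v0; rewrite v0' eqxx.
- by case.
- by move=> [Dx _]; move/negP: xD; case; rewrite inE.
Qed.

Lemma L0_norm (V : normedModType R) (f : X -> V) :
  L0_fun f -> measurable_fun setT (fun x => `|f x|%R : R).
Proof.
move=> [s [ss sf]].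
apply: (@measurable_fun_cvg _ _ _ _ (fun n x => `|s n x|%R)) => //.
  by move=> n; exact: simple_map_norm.
by move=> x _; apply: cvg_norm; exact: sf.
Qed.

Lemma L0_cut (V : normedModType R) (f : X -> V) (D : set X) : measurable D ->
  L0_fun f -> L0_fun (cut f D).
Proof.
move=> mD [s [ss sf]]; exists (fun n => cut (s n) D); split => [n|x].
  exact: simple_map_cut.
by apply: cvgZr; exact: sf.
Qed.

Lemma L0_opp (V : normedModType R) (f : X -> V) : L0_fun f -> L0_fun (\- f)%R.
Proof.
move=> [s [ss sf]]; exists (fun n => \- (s n))%R; split => [n|x].
  exact: (@simple_map_comp _ _ -%R).
by apply: cvgN; exact: sf.
Qed.

Lemma cut_cut (V : normedModType R) (f : X -> V) (A B : set X) :
  cut (cut f A) B = cut f (A `&` B).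
Proof. by apply/funext => x; rewrite /cut scalerA indicI mulrC. Qed.

(* Named so that the opposite is always taken in the same algebraic instance. *)
Definition negf (V : normedModType R) (f : X -> V) : X -> V := (\- f)%R.

(** Sublinearity bounds [T] on sums only, so removing a piece of [f] is written as adding its
    opposite; the averages do not see the sign. *)
Lemma cut_diff (V : normedModType R) (f : X -> V) (D1 D : set X) : D1 `<=` D ->
  cut f D1 = (cut f D \+ cut (negf f) (D `\` D1))%R.
Proof.
move=> D1D; apply/funext => x /=; rewrite /cut /negf /= scalerN -scalerBl.
congr (_ *: _)%R; rewrite !indicE; have [x1|x1] := boolP (x \in D1).
  have xD : x \in D by move: x1; rewrite !inE => /D1D.
  by rewrite xD memNset ?subr0// => -[_]; apply; exact/set_mem.
have [xD|xD] := boolP (x \in D); last first.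
  by rewrite memNset ?subr0// => -[Dx _]; move: xD; rewrite mem_set.
by rewrite mem_set ?subrr//; split; [exact/set_mem|move/mem_set; exact/negP].
Qed.

Lemma cutU (V : normedModType R) (f : X -> V) (A B : set X) : A `&` B = set0 ->
  cut f (A `|` B) = (cut f A \+ cut f B)%R.
Proof.
move=> AB; apply/funext => x; rewrite /cut /= -scalerDl; congr (_ *: _)%R.
rewrite !indicE in_setU; have [xA|xA] := boolP (x \in A);
  have [xB|xB] := boolP (x \in B); rewrite ?addr0 ?add0r//.
by exfalso; move: xA xB; rewrite !inE => xA xB; rewrite -[False]/(set0 x) -AB.
Qed.

Lemma cut_id (V : normedModType R) (f : X -> V) (A : set X) x : A x -> cut f A x = f x.
Proof. by move=> Ax; rewrite /cut indicE mem_set// scale1r. Qed.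

Lemma cut_out (V : normedModType R) (f : X -> V) (A : set X) x : ~ A x -> cut f A x = 0%R.
Proof. by move=> Ax; rewrite /cut indicE memNset// scale0r. Qed.

End FunctionSpaces.

(** * Real-valued averages *)

Lemma powR_mono (R : realType) (p a b : R) : (0 <= p)%R -> (0 <= a)%R -> (a <= b)%R ->
  (a `^ p <= b `^ p)%R.
Proof.
move=> p0 a0 ab; apply: ge0_ler_powR => //; rewrite nnegrE//; exact: le_trans ab.
Qed.

Section Averages.
Context (R : realType) (d : measure_display) (X : measurableType d).
Variables (mu : {measure set X -> \bar R}) (U : normedModType R) (r vrho rho : R).
Hypotheses (r0 : (0 < r)%R) (rho0 : (0 < rho)%R) (vrho_ge : (rho <= vrho)%R).
Implicit Types (f : X -> U) (A B W : set X).

Local Notation m A := (fine (mu A)).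

Definition mass f A : R := fine (\int[mu]_(x in A) ((`|f x| `^ r)%R)%:E).

Definition av f A : R := (m A `^ (- rho) * mass f A `^ vrho)%R.

Lemma mass_ge0 f A : (0 <= mass f A)%R.
Proof. by rewrite fine_ge0// integral_ge0// => x _; rewrite lee_fin powR_ge0. Qed.

Lemma av_ge0 f A : (0 <= av f A)%R.
Proof. by rewrite mulr_ge0// powR_ge0. Qed.

Lemma measurable_norm_powR f : Lr_fun mu r f ->
  measurable_fun setT (fun x => ((`|f x| `^ r)%R)%:E).
Proof.
move=> [f0 _]; apply/measurable_EFinP.
by apply: (measurableT_comp (measurable_powR r)); exact: L0_norm.
Qed.

Lemma massE f A : Lr_fun mu r f -> measurable A ->
  \int[mu]_(x in A) ((`|f x| `^ r)%R)%:E = (mass f A)%:E.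
Proof.
move=> Lf mA; rewrite fineK// ge0_fin_numE; last first.
  by apply: integral_ge0 => x _; rewrite lee_fin powR_ge0.
apply: le_lt_trans Lf.2; apply: ge0_subset_integral => //.
exact: measurable_norm_powR.
Qed.

Lemma avgE f A : Lr_fun mu r f -> measurable A -> avg mu r vrho rho f A = (av f A)%:E.
Proof. by move=> Lf mA; rewrite /avg massE// poweR_EFin -EFinM. Qed.

Lemma mass_le f A B : Lr_fun mu r f -> measurable A -> measurable B -> A `<=` B ->
  (mass f A <= mass f B)%R.
Proof.
move=> Lf mA mB AB; rewrite -lee_fin -!massE//; apply: ge0_subset_integral => //.
by apply: measurable_funTS; exact: measurable_norm_powR.
Qed.

Lemma mass_sum (s : seq (set X)) f B : Lr_fun mu r f -> measurable B ->
  uniq s -> trivIset [set` s] id -> (forall A, A \in s -> measurable A) ->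
  (forall A, A \in s -> A `<=` B) -> (\sum_(A <- s) mass f A <= mass f B)%R.
Proof.
move=> Lf; elim: s B => [|A s IH] B mB; first by rewrite big_nil mass_ge0.
move=> /= /andP[As us] ts ms sB; rewrite big_cons.
have mA : measurable A by apply: ms; rewrite mem_head.
have AB : A `<=` B by apply: sB; rewrite mem_head.
have mBA : measurable (B `\` A) by exact: measurableD.
have h1 : (\sum_(A <- s) mass f A <= mass f (B `\` A))%R.
  apply: IH => //.
  - by apply: sub_trivIset ts => C /= Cs; rewrite inE Cs orbT.
  - by move=> C Cs; apply: ms; rewrite inE Cs orbT.
  - move=> C Cs x Cx; split; first by apply: (sB C) => //; rewrite inE Cs orbT.
    move=> Ax; move: As; rewrite (ts A C) ?Cs//=; rewrite ?inE ?eqxx ?Cs ?orbT//.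
    by exists x.
have -> : mass f B = (mass f A + mass f (B `\` A))%R.
  apply: EFin_inj; rewrite EFinD -!massE// -ge0_integral_setU//.
  - by rewrite setDUK.
  - by apply: measurable_funTS; exact: measurable_norm_powR.
  - by apply/disj_setPS => x [Ax [_ nAx]].
by rewrite lerD2l.
Qed.

Lemma mass_cut f A W : measurable A -> measurable W ->
  mass (cut f W) A = mass f (A `&` W).
Proof.
move=> mA mW; rewrite /mass; congr (fine _); rewrite integral_mkcondr.
apply: eq_integral => x _; rewrite /cut/= patchE indicE; case: ifPn => xW.
  by rewrite scale1r.
by rewrite scale0r normr0 powR0// gt_eqF.
Qed.

Lemma mass_opp f A : mass (negf f) A = mass f A.
Proof. by rewrite /mass; congr (fine _); apply: eq_integral => x _; rewrite normrN. Qed.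

Lemma Lr_cut f W : measurable W -> Lr_fun mu r f -> Lr_fun mu r (cut f W).
Proof.
move=> mW Lf; split; first by apply: L0_cut => //; case: Lf.
apply: le_lt_trans Lf.2; apply: ge0_le_integral => //.
- apply/measurable_EFinP; apply: (measurableT_comp (measurable_powR r)).
  by apply: L0_norm; apply: L0_cut => //; case: Lf.
- exact: measurable_norm_powR.
- move=> x _; rewrite lee_fin; apply: ge0_ler_powR; rewrite ?nnegrE//; first exact: ltW.
  rewrite /cut normrZ indicE; case: (x \in W) => /=; first by rewrite normr1 mul1r.
  by rewrite normr0 mul0r.
Qed.

Lemma Lr_opp f : Lr_fun mu r f -> Lr_fun mu r (negf f).
Proof.
move=> Lf; split; first by apply: L0_opp; case: Lf.
apply: le_lt_trans Lf.2; rewrite le_eqVlt; apply/orP; left; apply/eqP.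
by apply: eq_integral => x _; rewrite normrN.
Qed.

Lemma vrho0 : (0 < vrho)%R. Proof. exact: lt_le_trans vrho_ge. Qed.

Lemma av_le (C : R) f A B : Lr_fun mu r f -> measurable A -> measurable B ->
  (0 < m A)%R -> (0 < m B)%R -> (m B <= C * m A)%R -> (mass f A <= mass f B)%R ->
  (av f A <= C `^ rho * av f B)%R.
Proof.
move=> Lf mA mB A0 B0 mBA fAB; rewrite mulrA; apply: ler_pM.
- exact: powR_ge0.
- exact: powR_ge0.
- have C0 : (0 < C)%R by rewrite -(pmulr_lgt0 _ A0) (lt_le_trans B0).
  rewrite !powRN ler_pdivlMr ?powR_gt0// mulrC ler_pdivrMr ?powR_gt0//.
  rewrite -powRM; [|exact: ltW|exact: ltW].
  by apply: powR_mono mBA; exact: ltW.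
- by apply: powR_mono fAB; [exact: ltW vrho0|exact: mass_ge0].
Qed.

Lemma av_cut_le f A W : Lr_fun mu r f -> measurable A -> measurable W ->
  (av (cut f W) A <= av f A)%R.
Proof.
move=> Lf mA mW; rewrite /av; apply: ler_wpM2l; first exact: powR_ge0.
apply: (powR_mono (ltW vrho0) (mass_ge0 _ _)); rewrite (mass_cut f mA mW).
by apply: (mass_le Lf) => //; exact: measurableI.
Qed.

Lemma av_cut_mono f A D W : Lr_fun mu r f -> measurable A -> measurable D ->
  measurable W -> A `&` D `<=` W -> (av (cut f D) A <= av (cut f W) A)%R.
Proof.
move=> Lf mA mD mW DW; rewrite /av; apply: ler_wpM2l; first exact: powR_ge0.
apply: (powR_mono (ltW vrho0) (mass_ge0 _ _)).
rewrite (mass_cut f mA mD) (mass_cut f mA mW).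
apply: (mass_le Lf); [exact: measurableI|exact: measurableI|].
by move=> x [Ax Dx]; split => //; exact: DW.
Qed.

Lemma av_cut_neg f A D : measurable A -> measurable D ->
  av (cut (negf f) D) A = av (cut f D) A.
Proof.
by move=> mA mD; rewrite /av (mass_cut (negf f) mA mD) (mass_cut f mA mD) mass_opp.
Qed.

Lemma av_def f A : av f A = (m A `^ (- rho) * mass f A `^ vrho)%R.
Proof. by []. Qed.

End Averages.

(* Keeps [done] from unfolding integrals when comparing averages. *)
#[global] Opaque mass av.

Lemma powRVK (R : realType) (x p : R) : (0 <= x)%R -> p != 0%R -> ((x `^ p) `^ p^-1 = x)%R.
Proof. by move=> x0 p0; rewrite -powRrM divff// powRr1. Qed.

Lemma powRV (R : realType) (x p : R) : (0 <= x)%R -> (x^-1 `^ p = (x `^ p)^-1)%R.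
Proof. by move=> x0; rewrite -powR_inv1// -powRrM mulN1r powRN. Qed.

Lemma sum_le_cross (R : realDomainType) (a b l p q : R) :
  (0 <= a -> 0 <= b -> 0 <= l -> 0 <= p -> 0 <= q ->
  p * l * a + q * l * b <= (p + q) * l * (a + b))%R.
Proof.
move=> a0 b0 l0 p0 q0; rewrite -subr_ge0.
rewrite (_ : (_ - _ = p * l * b + q * l * a)%R); last by ring.
by rewrite addr_ge0// !mulr_ge0.
Qed.

(** * Good and bad points of a ball *)

Section Operator.
Context (R : realType) (d : measure_display) (X : measurableType d).
Variables (mu : {measure set X -> \bar R}) (Bs : set (set X)) (K : R).
Hypotheses (K1 : (1 <= K)%R) (bb : ball_basis mu Bs K) (sep : separable_balls Bs).
Variables (U V : completeNormedModType R) (r vrho rho : R).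
Hypotheses (r0 : (0 < r)%R) (rho0 : (0 < rho)%R) (vrho_ge : (rho <= vrho)%R).
Variables (T : (X -> U) -> (X -> V)) (L0 L1 L2 : R).
Hypothesis BO : BO_operator mu Bs r vrho rho T L0 L1 L2.
Hypothesis L0_gt0 : (0 < L0)%R.

Local Notation m A := (fine (mu A)).
Local Notation star := (ball_star mu Bs).
Local Notation av := (av mu r vrho rho).
Local Notation mass := (mass mu r).
Local Notation Lr f := (Lr_fun mu r f).
Local Notation L := (L0 + L1 + L2)%R.

Let L1_ge0 : (0 <= L1)%R. Proof. by case: BO => _ _ []. Qed.
Let L2_ge0 : (0 <= L2)%R. Proof. by case: BO => _ _ []. Qed.
Let K0 : (0 < K)%R. Proof. exact: lt_le_trans K1. Qed.

Lemma T_norm_mble f : Lr f -> measurable_fun setT (fun x => `|T f x|%R).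
Proof. by move=> Lf; apply: L0_norm; apply: (operator_L0 (BO_operator_LrL0 BO)). Qed.

Lemma T_split f (D1 D2 : set X) : Lr f -> measurable D1 -> measurable D2 ->
  D1 `&` D2 = set0 -> {ae mu, forall x,
    (`|T (cut f (D1 `|` D2)) x| <= `|T (cut f D1) x| + `|T (cut f D2) x|)%R}.
Proof.
move=> Lf m1 m2 D12; rewrite cutU//.
exact: (BO_sublinear BO (Lr_cut r0 m1 Lf) (Lr_cut r0 m2 Lf)).
Qed.

Lemma T_diff f (D1 D : set X) : Lr f -> measurable D1 -> measurable D ->
  D1 `<=` D -> {ae mu, forall x,
    (`|T (cut f D1) x| <= `|T (cut f D) x| + `|T (cut (negf f) (D `\` D1)) x|)%R}.
Proof.
move=> Lf m1 m2 D1D; have mD : measurable (D `\` D1) by exact: measurableD.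
rewrite (cut_diff _ D1D).
exact: (BO_sublinear BO (Lr_cut r0 m2 Lf) (Lr_cut r0 mD (Lr_opp Lf))).
Qed.

(** The infimum defining [OSC] is approached within [n.+1%:R^-1] off a null set; the union of these
    null sets serves for the bound itself. *)
Lemma osc_ae (B : set X) (g : X -> V) (M : R) : OSC mu B g <= M%:E ->
  exists2 N, mu.-negligible N &
    forall x y, (B `\` N) x -> (B `\` N) y -> (`|g x - g y| <= M)%R.
Proof.
move=> oM.
have /choice[N hN] : forall n : nat, exists N, mu.-negligible N /\
    forall x y, (B `\` N) x -> (B `\` N) y -> (`|g x - g y| <= M + n.+1%:R^-1)%R.
  move=> n; have : OSC mu B g < (M + n.+1%:R^-1)%:E.
    by apply: (le_lt_trans oM); rewrite lte_fin ltrDl invr_gt0.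
  move=> /ereal_inf_lt[e [N nN hN] /ltW he]; exists N; split => // x y Bx By.
  by rewrite -lee_fin; apply: le_trans he; exact: hN.
exists (\bigcup_n N n).
  by apply: negligible_bigcup => n; have [] := hN n.
move=> x y [Bx Nx] [By Ny]; apply/ler_addgt0Pr => e e0.
have [n /ltW ne] := ex_natSinv_lt e0; have [_ /(_ x y) h] := hN n.
apply: (@le_trans _ _ (M + n.+1%:R^-1)%R); last by rewrite lerD2l.
by apply: h; split => // h; [apply: Nx|apply: Ny]; exists n.
Qed.

Lemma T0_level f (B : set X) (c : R) : Lr f -> Bs B ->
  measurable [set x | B x /\ (c < `|T (cut f B) x|)%R].
Proof.
move=> Lf BB; have mB := ball_mble bb BB; rewrite (_ : [set _ | _] =
   B `&` (setT `&` (fun x => `|T (cut f B) x|%R) @^-1` [set` `]c, +oo[])).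
  apply: measurableI => //; apply: (T_norm_mble (Lr_cut r0 mB Lf)) => //.
by rewrite setTI; apply/seteqP; split => x /=; rewrite in_itv/= andbT.
Qed.

(** T0 at the level [L0 * t]^ rho[, for which](L0 / lambda) [^ rho^-1] is [t^-1]. *)
Lemma T0_bound f (B : set X) (t c : R) : Lr f -> Bs B -> (0 < t)%R ->
  (L0 * t `^ rho * av f B <= c)%R ->
  mu [set x | B x /\ (c < `|T (cut f B) x|)%R] <= (t^-1 * m B)%:E.
Proof.
move=> Lf BB t0 hc; have mB := ball_mble bb BB.
have [T0 _ _] := BO_conditions BO Lf.
have lam0 : (0 < L0 * t `^ rho)%R by rewrite mulr_gt0// powR_gt0.
have := T0 _ BB _ lam0; rewrite avgE// (ball_muE bb BB) -EFinM.
have -> : (L0 / (L0 * t `^ rho) = t^-1 `^ rho)%R.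
  rewrite invfM mulrA divff ?gt_eqF// mul1r.
  by rewrite powRV// ltW.
rewrite powRVK ?gt_eqF// ?invr_ge0 ?(ltW t0)//; apply: le_trans.
have T0m c' : measurable [set x | B x /\ (c' < `|T (cut f B) x|)%R] by exact: T0_level.
apply: le_measure; rewrite ?inE; [exact: T0m|exact: T0m|].
by move=> x [Bx hx]; split => //; rewrite lte_fin; exact: le_lt_trans hc hx.
Qed.

Lemma ball_not_negligible (Y W N : set X) : Bs Y -> measurable W ->
  mu W < mu Y -> mu.-negligible N -> exists x, [/\ Y x, ~ W x & ~ N x].
Proof.
move=> BY mW WY [N' [mN' N0 NN']]; apply: contrapT => none.
have : mu Y <= mu (W `|` N').
  apply: le_measure; rewrite ?inE; [exact: (ball_mble bb BY)|exact: measurableU|].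
  move=> x Yx; apply: contrapT => h; apply: none; exists x; split => //.
    by move=> Wx; apply: h; left.
  by move=> Nx; apply: h; right; exact: NN'.
by rewrite measureU0// leNgt WY.
Qed.

(* T0 makes [T H] small on half of [Y], and T1 transfers this to all of [Y]. *)
Lemma T_jump (C : R) H (Y G : set X) : Lr H -> Bs Y -> Bs G -> Y `<=` G ->
  (m G <= C * m Y)%R -> H = cut H (G `\` star Y) ->
  {ae mu, forall x, Y x -> (`|T H x| <= (2 * C) `^ rho * L * av H G)%R}.
Proof.
move=> LH BY BG YG mGY HE.
have mY0 := ball_gt0 bb BY; have mG0 := ball_gt0 bb BG.
have C0 : (0 < C)%R by rewrite -(pmulr_lgt0 _ mY0) (lt_le_trans mG0).
have mY := ball_mble bb BY; have mG := ball_mble bb BG.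
have mS : measurable (star Y) by exact: star_mble.
have HG : cut H G = H by rewrite {2}HE {1}HE cut_cut; congr cut; rewrite setIidl// => x [].
have HS : cut H (~` star Y) = H.
  by rewrite {2}HE {1}HE cut_cut; congr cut; rewrite setIidl// => x [].
have a0 := av_ge0 mu r vrho rho H G; set a := av H G in a0 *.
have [_ /(_ _ BY) T1 _] := BO_conditions BO LH; rewrite HS in T1.
have avs : avg_star mu r vrho rho Bs H Y <= ((C `^ rho * a)%R)%:E.
  apply: ge_ereal_sup => _ [Z [BZ YZ] <-]; have mZ := ball_mble bb BZ.
  have mZ0 := ball_gt0 bb BZ; rewrite avgE// lee_fin; apply: av_le => //.
    by apply: (le_trans mGY); rewrite ler_pM2l//; exact: (ball_le bb BY BZ YZ).
  rewrite -{1}HG mass_cut//; apply: mass_le => //; exact: measurableI.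
have {}T1 : OSC mu Y (T H) <= (L1 * (C `^ rho * a))%:E.
  by apply: (le_trans T1); rewrite EFinM lee_wpmul2l// lee_fin.
have [N nN hN] := osc_ae T1.
have C2 : (0 < 2 * C)%R by rewrite mulr_gt0.
(* With [t = 2 * C] the level set is smaller than [Y], so some point of [Y] outside it and outside
   [N] anchors the oscillation bound. *)
have hW := @T0_bound H G (2 * C)%R (L0 * (2 * C) `^ rho * a)%R LH BG C2 (lexx _).
rewrite HG in hW; set W := [set x | _] in hW.
have mW : measurable W by rewrite /W -[X in T X]HG; exact: T0_level.
have WY : mu W < mu Y.
  apply: (le_lt_trans hW); rewrite (ball_muE bb BY) lte_fin ltr_pdivrMl//.
  by apply: (le_lt_trans mGY); rewrite ltr_pM2r//; lra.
have [x0 [Yx0 Wx0 Nx0]] := ball_not_negligible BY mW WY nN.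
have Tx0 : (`|T H x0| <= L0 * (2 * C) `^ rho * a)%R.
  by rewrite leNgt; apply/negP => h; apply: Wx0; split => //; exact: YG.
apply: negligibleS nN => x /= hx; apply: contrapT => Nx; apply: hx => Yx.
have {hN} := hN x x0 (conj Yx Nx) (conj Yx0 Nx0) => h.
have CC : (C `^ rho <= (2 * C) `^ rho)%R.
  apply: ge0_ler_powR => //; rewrite ?nnegrE ?(ltW rho0) ?(ltW C0) ?(ltW C2)//.
  by rewrite ler_peMl ?(ltW C0)// ler1n.
have h1 : (`|T H x| <= `|T H x - T H x0| + `|T H x0|)%R.
  by rewrite -{1}(subrK (T H x0) (T H x)) ler_normD.
have h2 : (L1 * (C `^ rho * a) <= L1 * ((2 * C) `^ rho * a))%R.
  by rewrite ler_wpM2l// ler_wpM2r.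
have h3 : (0 <= L2 * ((2 * C) `^ rho * a))%R by rewrite !mulr_ge0 ?powR_ge0.
apply: (le_trans h1); apply: (le_trans (lerD (le_trans h h2) Tx0)).
rewrite -subr_ge0 (_ : (_ - _ = L2 * ((2 * C) `^ rho * a))%R)//; ring.
Qed.

Lemma T2_ae F (Y : set X) : Lr F -> Bs Y -> star Y <> setT ->
  exists B, [/\ Bs B, Y `<` B & {ae mu, forall x, Y x ->
    (`|T (cut F (star B `\` star Y)) x| <= L * av F (star B))%R}].
Proof.
move=> LF BY Yt; have [_ _ /(_ _ BY Yt)[B [BB YB]]] := BO_conditions BO LF.
rewrite avgE; [|exact: LF|exact: star_mble]; rewrite -EFinM /SUP => h.
exists B; split => //; move/ess_supP : h; apply: filterS => x hx Yx.
move: hx; rewrite cut_id// lee_fin => hx; apply: (le_trans hx).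
rewrite ler_wpM2r ?av_ge0// lerDr addr_ge0 ?(ltW L0_gt0)//.
Qed.

Lemma T_weak (eta : R) f (W Q : set X) : Lr f -> Bs W -> Bs Q -> W `<=` Q -> (0 < eta)%R ->
  mu [set x | Q x /\ (L0 * eta^-1 `^ rho * av f W < `|T (cut f W) x|)%R] <= (eta * m W)%:E.
Proof.
move=> Lf BW BQ WQ e0; have mW := ball_mble bb BW; have mQ := ball_mble bb BQ.
have mW0 := ball_gt0 bb BW; have mQ0 := ball_gt0 bb BQ.
have FQ : cut (cut f W) Q = cut f W by rewrite cut_cut setIidl.
have t0 : (0 < eta^-1 * (m Q / m W))%R by rewrite mulr_gt0 ?invr_gt0// divr_gt0.
have := @T0_bound (cut f W) Q _ (L0 * eta^-1 `^ rho * av f W)%R (Lr_cut r0 mW Lf) BQ t0.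
rewrite FQ => /(_ _) h; apply: (le_trans (h _)); last first.
  by rewrite lee_fin le_eqVlt; apply/orP; left; apply/eqP; field; rewrite ?gt_eqF.
have -> : av (cut f W) Q = ((m Q `^ rho)^-1 * mass f W `^ vrho)%R.
  by rewrite av_def powRN (mass_cut mu r0 f mQ mW) (setIidr WQ).
have -> : av f W = ((m W `^ rho)^-1 * mass f W `^ vrho)%R by rewrite av_def powRN.
rewrite powRM ?invr_ge0 ?(ltW e0) ?divr_ge0 ?(ltW mQ0) ?(ltW mW0)//.
rewrite powRM ?invr_ge0 ?(ltW mW0) ?(ltW mQ0)// [((m W)^-1 `^ rho)%R]powRV ?(ltW mW0)//.
have pQ : (m Q `^ rho)%R != 0%R by rewrite gt_eqF// powR_gt0.
rewrite le_eqVlt; apply/orP; left; apply/eqP.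
move: pQ; move: (m Q `^ rho)%R (m W `^ rho)%R (mass f W `^ vrho)%R (eta^-1 `^ rho)%R.
by move=> q w k e q0; rewrite -!mulrA; congr (_ * (_ * _))%R; rewrite mulrCA mulVKf.
Qed.

Variable eta : R.
Hypothesis eta0 : (0 < eta)%R.

Definition thr : R := (eta^-1 `^ rho)%R.
Definition cT : R := (thr * (1 + (2 * K) `^ rho))%R.

Definition heavy (f : X -> U) (W : set X) : set (set X) :=
  [set Z | Bs Z /\ (thr * av f W < av (cut f W) Z)%R].

(** The last clause bounds [avg_star] on [Z], so that T1 is effective there. It loses no points for
    [bad]: a ball below a heavy one is already covered by [heavy]. *)
Definition wild (f : X -> U) (W : set X) : set (set X) :=
  [set Z | [/\ Bs Z, ~ {ae mu, forall x, Z x ->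
       (`|T (cut f (W `\` star Z)) x| <= cT * L * av f W)%R} &
     forall Z', Bs Z' -> Z `<=` Z' -> (av (cut f W) Z' <= thr * av f W)%R]].

Definition bad (f : X -> U) (W : set X) : set X :=
  \bigcup_(Z in heavy f W) Z `|` \bigcup_(Z in wild f W) Z `|`
  [set x | W x /\ (L0 * thr * av f W < `|T (cut f W) x|)%R].

Lemma thr_gt0 : (0 < thr)%R. Proof. by rewrite powR_gt0// invr_gt0. Qed.

Lemma L_gt0 : (0 < L)%R.
Proof. by rewrite -addrA ltr_pwDl// addr_ge0. Qed.

Lemma cT_gt0 : (0 < cT)%R.
Proof. by rewrite mulr_gt0// ?thr_gt0// ltr_pwDl// powR_ge0. Qed.

Lemma bad_mble f W : Lr f -> Bs W -> measurable (bad f W).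
Proof.
move=> Lf BW; apply: measurableU; last exact: T0_level.
by apply: measurableU; apply: sep => Z [].
Qed.

(** A heavy ball has measure at most [eta * m W] times its share [q] of the mass of [f] on [W], and
    the shares of disjoint balls add up to at most 1. *)
Lemma heavy_measure f (W : set X) : Lr f -> Bs W ->
  mu (\bigcup_(Z in heavy f W) Z) <= (K * (eta * m W))%:E.
Proof.
move=> Lf BW; have mW := ball_mble bb BW; have mW0 := ball_gt0 bb BW.
have LF := Lr_cut r0 mW Lf.
have v0 : (0 < vrho)%R by exact: lt_le_trans vrho_ge.
apply: (vitali_measure K1 bb sep); first by move=> Z [].
move=> s us sh ts.
have hM A : Bs A -> (mass (cut f W) A <= mass f W)%R.
  move=> BA; have mA := ball_mble bb BA; rewrite mass_cut//.
  by apply: mass_le => //; exact: measurableI.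
have M0 := mass_ge0 mu r f W.
have [E|Mn0] := eqVneq (mass f W) 0%R.
  rewrite big_seq big1 ?mulr_ge0 ?(ltW eta0) ?(ltW mW0)// => A /sh[BA].
  have A0 : mass (cut f W) A = 0%R.
    by apply: le_anti; rewrite -{1}E (hM _ BA) mass_ge0.
  by rewrite !av_def A0 E powR0 ?gt_eqF// !mulr0 ltxx.
have {}M0 : (0 < mass f W)%R by rewrite lt_neqAle eq_sym Mn0.
apply: (@le_trans _ _ (\sum_(A <- s) eta * m W / mass f W * mass (cut f W) A)%R).
  apply: ler_sum_mem => A /sh[BA hA]; have mA0 := ball_gt0 bb BA.
  have A0 := mass_ge0 mu r (cut f W) A.
  set q := (mass (cut f W) A / mass f W)%R.
  have q0 : (0 <= q)%R := divr_ge0 A0 (ltW M0).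
  have q1 : (q <= 1)%R by rewrite (ler_pdivrMr _ _ M0) mul1r; exact: hM.
  rewrite -mulrA [(_ * mass _ _)%R]mulrC -/q.
  rewrite leNgt; apply/negP => lt.
  have hq : (q `^ vrho <= m A `^ rho * (thr * (m W `^ rho)^-1))%R.
    rewrite /thr -(powRV _ (ltW mW0)) -!powRM
      ?mulr_ge0 ?invr_ge0 ?(ltW eta0) ?(ltW mA0) ?(ltW mW0)//.
    (* Here [q <= 1] and [rho <= vrho] give [q]^ vrho <= q [^ rho]. *)
    apply: (@le_trans _ _ (q `^ rho)%R).
      have [->|qn0] := eqVneq q 0%R; first by rewrite !powR0 ?gt_eqF.
      by apply: ger_powR => //; rewrite lt_neqAle eq_sym qn0 q0.
    apply: ge0_ler_powR => //; rewrite ?nnegrE ?(ltW rho0)//.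
      by rewrite !mulr_ge0 ?invr_ge0 ?(ltW eta0) ?(ltW mA0) ?(ltW mW0).
    rewrite mulrCA -ler_pdivrMl ?invr_gt0// invrK ler_pdivlMr//.
    by rewrite mulrAC; exact: ltW.
  move: hA; apply/negP; rewrite -leNgt !av_def !powRN.
  have -> : mass (cut f W) A = (q * mass f W)%R by rewrite divfK.
  rewrite powRM ?(ltW M0)// mulrA [leRHS]mulrA.
  apply: ler_wpM2r; first exact: powR_ge0.
  by rewrite ler_pdivrMl ?powR_gt0.
rewrite -mulr_sumr -mulrA ler_piMr// ?mulr_ge0 ?(ltW eta0) ?(ltW mW0)//.
rewrite ler_pdivrMl// mulr1.
rewrite -[X in (_ <= mass f X)%R]setTI -(mass_cut mu r0 f measurableT mW).
by apply: mass_sum => // A /sh[BA _]; exact: (ball_mble bb BA).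
Qed.

(** The truncation [g] is large at one point, hence by T1 at almost every point of [Z]. It differs
    from [T (cut f W)] by the part of [f] in [star Z], which T0 on the hull of [Z] makes small on at
    least half of [Z]; there [T (cut f W)] itself is large. *)
Lemma wild_half f (W Z Q : set X) : Lr f -> Bs W -> Bs Q -> wild f W Z ->
  W `<=` Q -> Z `<=` Q ->
  (m Z <= 2 * m (Z `&` [set x | Q x /\ (L0 * thr * av f W < `|T (cut f W) x|)%R]))%R.
Proof.
move=> Lf BW BQ [BZ nae le] WQ ZQ.
have mW := ball_mble bb BW; have mZ := ball_mble bb BZ; have LF := Lr_cut r0 mW Lf.
have mS : measurable (star Z) by exact: star_mble.
have BHZ := hull_ball bb BZ; have mHZ := ball_mble bb BHZ; have mZ0 := ball_gt0 bb BZ.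
set a := av f W in nae le *; have a0 : (0 <= a)%R by exact: av_ge0.
set g := T (cut f (W `\` star Z)) in nae.
have [_ /(_ _ BZ) T1 _] := BO_conditions BO LF; rewrite cut_cut -setDE -/g in T1.
have {}T1 : OSC mu Z g <= (L1 * (thr * a))%:E.
  apply: (le_trans T1); rewrite EFinM lee_wpmul2l ?lee_fin//.
  apply: ge_ereal_sup => _ [Z' [BZ' ZZ'] <-]; rewrite avgE//; last exact: (ball_mble bb BZ').
  by rewrite lee_fin; exact: le.
have [N nN hN] := osc_ae T1.
have [x0 [Zx0 Nx0 gx0]] : exists x0, [/\ Z x0, ~ N x0 & (cT * L * a < `|g x0|)%R].
  apply: contrapT => none; apply: nae; apply: negligibleS nN => x /= hx.
  apply: contrapT => Nx; apply: hx => Zx; rewrite leNgt; apply/negP => h.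
  by apply: none; exists x.
have mD : measurable (W `\` star Z) by exact: measurableD.
have mE : measurable (W `\` (W `\` star Z)) by exact: measurableD.
have := T_diff Lf mD mW (@subDsetl _ _ _); set H := cut (negf f) _ => Tdiff.
have LH : Lr H := Lr_cut r0 mE (Lr_opp Lf).
have HHZ : cut H (hull mu Bs K Z) = H.
  rewrite cut_cut setIidl// => x [Wx nx]; apply: (star_hull bb BZ).
  by apply: contrapT => Sx; apply: nx.
have avH : (av H (hull mu Bs K Z) <= thr * a)%R.
  apply: le_trans (le _ BHZ (sub_hull bb BZ)).
  rewrite /H (av_cut_neg mu vrho rho r0 f mHZ mE).
  by apply: (av_cut_mono r0 rho0 vrho_ge Lf mHZ mE mW) => x [_ []].
set c := (L0 * (2 * K) `^ rho * (thr * a))%R.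
have K2 : (0 < 2 * K)%R by rewrite mulr_gt0.
(* The hull has measure at most [K * m Z], so [t = 2 * K] leaves an exceptional set of measure at
   most [m Z / 2]. *)
have := @T0_bound H _ (2 * K)%R c LH BHZ K2.
rewrite HHZ => /(_ _) hV; set V1 := [set x | _] in hV.
have {}hV : mu V1 <= (m Z / 2)%:E.
  apply: le_trans (hV _) _; first by rewrite ler_wpM2l// mulr_ge0 ?powR_ge0 ?ltW.
  rewrite lee_fin ler_pdivrMl// (le_trans (hull_le bb BZ))//.
  by rewrite le_eqVlt; apply/orP; left; apply/eqP; field.
have mV1 : measurable V1 by rewrite /V1 -[X in T X]HHZ; exact: T0_level.
set S := [set x | Q x /\ _].
have mSS : measurable S.
  have FQ : cut (cut f W) Q = cut f W by rewrite cut_cut setIidl.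
  rewrite /S -[X in T X]FQ; exact: (T0_level _ LF BQ).
have [N2 [mN2 N20 NN2]] := negligibleU nN Tdiff.
have sub : Z `<=` (Z `&` S) `|` (V1 `|` N2).
  move=> x Zx; have [N2x|N2x] := pselect (N2 x); first by right; right.
  have [V1x|V1x] := pselect (V1 x); first by right; left.
  left; split => //; split; first exact: ZQ.
  have Nx : ~ N x by move=> Nx; apply: N2x; apply: NN2; left.
  have dx : (`|g x| <= `|T (cut f W) x| + `|T H x|)%R.
    by apply: contrapT => h; apply: N2x; apply: NN2; right.
  have Hx : (`|T H x| <= c)%R.
    rewrite leNgt; apply/negP => h; apply: V1x; split => //.
    exact: (sub_hull bb BZ).
  have ox := hN x0 x (conj Zx0 Nx0) (conj Zx Nx).
  have tri : (`|g x0| <= `|g x0 - g x| + `|g x|)%R.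
    by rewrite -{1}(subrK (g x) (g x0)) ler_normD.
  (* This fixes [cT]: the level of [T (cut f W)] off [S], the oscillation of [g] and the level of
     [T H] must together stay below the value of [g] at [x0]. *)
  have key : (L0 * thr * a + L1 * (thr * a) + c <= cT * L * a)%R.
    have ta : (0 <= thr * a)%R by rewrite mulr_ge0// ltW// thr_gt0.
    have p0 : (0 <= (2 * K) `^ rho)%R by exact: powR_ge0.
    have -> : (cT * L * a = (1 + (2 * K) `^ rho) * L * (thr * a))%R by rewrite /cT; ring.
    rewrite /c -subr_ge0 (_ : (_ - _ = ((2 * K) `^ rho * (L1 + L2) + L2) * (thr * a))%R).
      by rewrite mulr_ge0// addr_ge0// mulr_ge0// addr_ge0.
    ring.
  lra.
have fin (A : set X) : measurable A -> A `<=` Z -> mu A = (m A)%:E.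
  move=> mA AZ; rewrite fineK// ge0_fin_numE// (le_lt_trans _ (ltry (m Z)))//.
  by rewrite -(ball_muE bb BZ); apply: le_measure; rewrite ?inE.
have mZS : measurable (Z `&` S) by exact: measurableI.
have : (m Z)%:E <= (m (Z `&` S))%:E + (m Z / 2)%:E.
  rewrite -(fin _ mZS)// -(ball_muE bb BZ).
  apply: (@le_trans _ _ (mu ((Z `&` S) `|` (V1 `|` N2)))).
    by apply: le_measure; rewrite ?inE//; apply: measurableU => //; exact: measurableU.
  apply: (le_trans (measureU2 _ _ _)) => //; first exact: measurableU.
  apply: leeD => //; apply: (le_trans _ hV); rewrite le_eqVlt; apply/orP; left; apply/eqP.
  exact: measureU0.
rewrite -EFinD lee_fin; lra.
Qed.

(** Finitely many disjoint wild balls and [W] fit into one ball [Q]; half of each wild ball lies in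
    the level set of [T_weak], whose bound does not depend on [Q]. *)
Lemma wild_measure f (W : set X) : Lr f -> Bs W ->
  mu (\bigcup_(Z in wild f W) Z) <= (K * (2 * (eta * m W)))%:E.
Proof.
move=> Lf BW; have mW := ball_mble bb BW.
apply: (vitali_measure K1 bb sep); first by move=> Z [].
move=> s us sh ts; have sB Z : Z \in s -> Bs Z by move=> /sh[].
have [Q [BQ WQ sQ]] := ball_join_seq K1 bb BW sB.
set S := [set x | Q x /\ (L0 * thr * av f W < `|T (cut f W) x|)%R].
have mS : measurable S.
  have FQ : cut (cut f W) Q = cut f W by rewrite cut_cut setIidl.
  rewrite /S -[X in T X]FQ; exact: (T0_level _ (Lr_cut r0 mW Lf) BQ).
have SQ : mu S <= (eta * m W)%:E by exact: T_weak.
have Soo : mu S < +oo by apply: le_lt_trans SQ (ltry _).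
apply: (@le_trans _ _ (\sum_(Z <- s) 2 * m (Z `&` S))%R).
  by apply: ler_sum_mem => Z Zs; apply: wild_half => //; [exact: sh|exact: sQ].
rewrite -mulr_sumr ler_pM2l//; apply: (@le_trans _ _ (m S)).
  by apply: sum_measureI_le => // Z /sB BZ; exact: (ball_mble bb BZ).
by rewrite -lee_fin fineK// ge0_fin_numE.
Qed.

Lemma bad_measure f (W : set X) : Lr f -> Bs W ->
  mu (bad f W) <= (4 * K * eta * m W)%:E.
Proof.
move=> Lf BW; have mW := ball_mble bb BW; have mW0 := ball_gt0 bb BW.
have m1 : measurable (\bigcup_(Z in heavy f W) Z) by apply: sep => Z [].
have m2 : measurable (\bigcup_(Z in wild f W) Z) by apply: sep => Z [].
have m3 : measurable [set x | W x /\ (L0 * thr * av f W < `|T (cut f W) x|)%R].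
  exact: T0_level.
apply: (@le_trans _ _ ((K * (eta * m W))%:E + (K * (2 * (eta * m W)))%:E + (eta * m W)%:E)).
  apply: (le_trans (measureU2 _ _ _)) => //; first exact: measurableU.
  apply: leeD; last exact: T_weak.
  by apply: (le_trans (measureU2 _ _ _)) => //; apply: leeD;
    [exact: heavy_measure|exact: wild_measure].
have h : (eta * m W <= K * (eta * m W))%R by rewrite ler_peMl// mulr_ge0// ltW.
by rewrite -!EFinD lee_fin; lra.
Qed.

(** One good point controls every ball through it, because the heavy and wild parts of [bad] are
    unions of entire balls. *)
Lemma good_ball f (W Z : set X) y : ~ bad f W y -> Bs Z -> Z y ->
  {ae mu, forall x, Z x -> (`|T (cut f (W `\` star Z)) x| <= cT * L * av f W)%R} /\
  (av (cut f W) Z <= thr * av f W)%R.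
Proof.
move=> by_ BZ Zy.
have light Z' : Bs Z' -> Z' y -> (av (cut f W) Z' <= thr * av f W)%R.
  move=> BZ' Zy'; rewrite leNgt; apply/negP => h; apply: by_; left; left.
  by exists Z'.
split; last exact: light.
apply: contrapT => h; apply: by_; left; right; exists Z => //; split => // Z' BZ' ZZ'.
by apply: light => //; exact: ZZ'.
Qed.

Lemma good_point f (W : set X) y : ~ bad f W y -> W y ->
  (`|T (cut f W) y| <= L0 * thr * av f W)%R.
Proof.
by move=> by_ Wy; rewrite leNgt; apply/negP => h; apply: by_; right.
Qed.

(* The pieces of [T f] cut around [Z] are compared with those cut around a larger
   ball [G] of comparable measure which contains a good point of [W]. *)
Lemma near_good (C : R) f (W Z G : set X) y : Lr f -> Bs W -> Bs Z -> Bs G ->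
  Z `<=` G -> (m G <= C * m Z)%R -> G y -> ~ bad f W y ->
  {ae mu, forall x, Z x -> (`|T (cut f (W `\` star Z)) x| <=
     (cT + (2 * (K * C)) `^ rho * thr) * L * av f W)%R}.
Proof.
move=> Lf BW BZ BG ZG mGZ Gy gy.
have mW := ball_mble bb BW; have mZ := ball_mble bb BZ; have mG := ball_mble bb BG.
have mSZ : measurable (star Z) by exact: star_mble.
have mSG : measurable (star G) by exact: star_mble.
have BH := hull_ball bb BG; have mH := ball_mble bb BH.
have SZG : star Z `<=` star G by exact: (star_mono bb).
have [good1 _] := good_ball gy BG Gy.
have [_ good2] := good_ball gy BH (sub_hull bb BG Gy).
pose D := W `&` (star G `\` star Z).
have mD : measurable D by apply: measurableI => //; exact: measurableD.
have mWG : measurable (W `\` star G) by exact: measurableD.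
have -> : W `\` star Z = (W `\` star G) `|` D.
  apply/seteqP; split => [x [Wx nx]|x [[Wx nx]|[Wx [Gx nx]]]].
  - by have [?|?] := pselect (star G x); [right|left].
  - by split => // /SZG.
  - by [].
have dis : (W `\` star G) `&` D = set0.
  by rewrite -subset0 => x [[_ nG] [_ [Gx _]]].
have split2 := T_split Lf mWG mD dis.
have jmp : {ae mu, forall x, Z x -> (`|T (cut f D) x| <=
    (2 * (K * C)) `^ rho * L * av (cut f D) (hull mu Bs K G))%R}.
  apply: (T_jump (Lr_cut r0 mD Lf) BZ BH).
  - by apply: subset_trans ZG _; exact: (sub_hull bb).
  - by apply: (le_trans (hull_le bb BG)); rewrite -mulrA ler_pM2l.
  - rewrite cut_cut setIidl// => x [Wx [Gx nx]]; split => //.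
    exact: (star_hull bb BG).
have avD : (av (cut f D) (hull mu Bs K G) <= thr * av f W)%R.
  by apply: le_trans good2; apply: (av_cut_mono r0 rho0 vrho_ge Lf mH mD mW) => x [_ []].
apply: filterS3 split2 good1 jmp => x s1 g1 j1 Zx.
apply: (le_trans s1); have {}g1 := g1 (ZG _ Zx); have {}j1 := j1 Zx.
have -> : ((cT + (2 * (K * C)) `^ rho * thr) * L * av f W =
  cT * L * av f W + (2 * (K * C)) `^ rho * L * (thr * av f W))%R by ring.
apply: (lerD g1 (le_trans j1 _)).
exact: (ler_wpM2l (mulr_ge0 (powR_ge0 _ _) (ltW L_gt0)) avD).
Qed.

(** [c1] and [c4] come from [near_good] at the ratios [2 * K ^+ 3] and [2 * K ^+ 5]; [c2] adds the
    T2 ring to [c1]; [c3] and [c5] add to [c2] a [T_jump] inside the smaller node. *)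
Definition c1 : R := (cT + (2 * (K * (2 * K ^+ 3))) `^ rho * thr)%R.
Definition c2 : R := (c1 + (2 * K ^+ 4) `^ rho * thr)%R.
Definition c3 : R := (c2 + (2 * K) `^ rho)%R.
Definition c4 : R := (cT + (2 * (K * (2 * K ^+ 5))) `^ rho * thr)%R.
Definition c5 : R := (c2 + (2 * K ^+ 2) `^ rho)%R.
Definition cJ : R := (c3 + c4 + c5)%R.

Lemma c_ge0 : [/\ 0 <= c1, 0 <= c2, 0 <= c3, 0 <= c4 & 0 <= c5]%R.
Proof.
have h p : (0 <= p `^ rho * thr)%R by rewrite mulr_ge0 ?powR_ge0 ?(ltW thr_gt0).
have c := ltW cT_gt0.
by split; rewrite ?addr_ge0 ?powR_ge0.
Qed.

Lemma c3_le : (c3 <= cJ)%R.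
Proof. by have [_ _ _ h4 h5] := c_ge0; rewrite /cJ -addrA lerDl; exact: addr_ge0. Qed.

Lemma c4_le : (c4 <= cJ)%R.
Proof.
have [_ _ h3 _ h5] := c_ge0; rewrite /cJ addrAC lerDr; exact: addr_ge0.
Qed.

Lemma c5_le : (c5 <= cJ)%R.
Proof. by have [_ _ h3 h4 _] := c_ge0; rewrite /cJ lerDr; exact: addr_ge0. Qed.

(** * Passing from a node [W2] to its parent [W1] near a body [Y] of [W2] *)

Section Jump.
Variables (f : X -> U) (W1 W2 Y G : set X).
Hypotheses (Lf : Lr f) (BW1 : Bs W1) (BW2 : Bs W2) (W21 : W2 `<=` W1)
  (W2T : W2 <> setT) (BY : Bs Y) (YW : Y `<=` W2) (SYW : star Y `<=` W2)
  (mWY : (m W2 <= K * m Y)%R) (BG : Bs G) (GW : G `&` W2 !=set0)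
  (Gy : exists2 y, G y & ~ bad f W1 y)
  (Gmin : forall G', Bs G' -> Y `<` G' -> (m G <= 2 * m G')%R).

(** By [Gmin] the ball [Z] is at least half as large as [G], and [W2] has measure at most [K * m Z];
    so merging [W2], [Z] and [G] costs a bounded factor and brings in the good point of [G]. *)
Lemma good_around (Z : set X) : Bs Z -> Y `<` Z -> exists G1, [/\ Bs G1,
  Z `<=` G1, (m G1 <= 2 * K ^+ 3 * m Z)%R & exists2 y, G1 y & ~ bad f W1 y].
Proof.
move=> BZ YZ; have mGZ := Gmin BZ YZ; have [y0 Yy0] := ball_neq0 bb BY.
have Z0 := ball_gt0 bb BZ.
have [|D [BD WD ZD mD]] := ball_merge K1 bb BW2 BZ.
  by exists y0; split; [exact: YW|exact: YZ.1].
have {}mD : (m D <= K * (K * m Z))%R.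
  apply: (le_trans mD); rewrite ler_pM2l// ge_max ler_peMl ?(ltW Z0)// andbT.
  by apply: (le_trans mWY); rewrite ler_pM2l//; exact: (ball_le bb BY BZ YZ.1).
have [|G1 [BG1 DG1 GG1 mG1]] := ball_merge K1 bb BD BG.
  by case: GW => z [Gz Wz]; exists z; split => //; exact: WD.
exists G1; split => //; first exact: subset_trans ZD DG1.
  apply: (le_trans mG1).
  have -> : (2 * K ^+ 3 * m Z = K * (K * (K * m Z) * 2))%R by ring.
  have KK : (m Z <= K * (K * m Z))%R.
    by rewrite mulrA ler_peMl ?(ltW Z0)// mulr_ege1.
  by rewrite ler_pM2l// ge_max; apply/andP; split; lra.
by case: Gy => y gy ny; exists y => //; exact: GG1.
Qed.

(** The ball [Z] of T2 has uncontrolled size but strictly contains [Y], so [good_around] applies to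
    it. Beyond [star Z] the bound is [near_good], and the ring between [star Y] and [star Z] is
    T2. *)
Lemma jump_star : {ae mu, forall x, Y x ->
  (`|T (cut f (W1 `\` star Y)) x| <= c2 * L * av f W1)%R}.
Proof.
have mW1 := ball_mble bb BW1; have LF := Lr_cut r0 mW1 Lf.
have [|Z [BZ YZ T2]] := T2_ae LF BY; first by move=> E; apply: W2T; rewrite -subTset -E.
have [G1 [BG1 ZG1 mG1 [y G1y gy]]] := good_around BZ YZ.
have mSY : measurable (star Y) by exact: star_mble.
have mSZ : measurable (star Z) by exact: star_mble.
have BH := hull_ball bb BG1; have mH := ball_mble bb BH.
have SYZ : star Y `<=` star Z by apply: (star_mono bb) => //; exact: YZ.1.
have SZH : star Z `<=` hull mu Bs K G1.
  by apply: subset_trans (star_hull bb BG1); exact: (star_mono bb).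
have nG := near_good Lf BW1 BZ BG1 ZG1 mG1 G1y gy.
have [_ good2] := good_ball gy BH (sub_hull bb BG1 G1y).
have Z0 := ball_gt0 bb BZ.
have mSZ0 : (m Z <= m (star Z))%R.
  apply: fine_le; [exact: (ball_fin bb BZ)| |].
    rewrite ge0_fin_numE// (le_lt_trans _ (ltry (m (hull mu Bs K G1))))//.
    by rewrite -(ball_muE bb BH); apply: le_measure; rewrite ?inE.
  by apply: le_measure; rewrite ?inE//; [exact: (ball_mble bb BZ)|exact: (star_ge bb)].
(* T2 bounds by the average over [star Z], which need not be a ball; it is compared with the hull of
   [G1], of measure at most [2 * K ^+ 4 * m Z]. *)
have avZ : (av (cut f W1) (star Z) <= (2 * K ^+ 4) `^ rho * (thr * av f W1))%R.
  apply: (@le_trans _ _ ((2 * K ^+ 4) `^ rho * av (cut f W1) (hull mu Bs K G1))%R).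
    apply: av_le => //; [exact: lt_le_trans mSZ0|exact: (ball_gt0 bb BH)| |].
      apply: (le_trans (hull_le bb BG1)).
      apply: (@le_trans _ _ (K * (2 * K ^+ 3 * m Z))%R); first by rewrite ler_pM2l.
      have -> : (K * (2 * K ^+ 3 * m Z) = 2 * K ^+ 4 * m Z)%R by ring.
      by rewrite ler_pM2l// mulr_gt0// exprn_gt0.
    exact: (mass_le LF mSZ mH SZH).
  by apply: ler_wpM2l good2; exact: powR_ge0.
rewrite cut_cut in T2.
have mA : measurable (W1 `\` star Z) by exact: measurableD.
have mD : measurable (W1 `&` (star Z `\` star Y)).
  by apply: measurableI => //; exact: measurableD.
have -> : W1 `\` star Y = (W1 `\` star Z) `|` (W1 `&` (star Z `\` star Y)).
  apply/seteqP; split => [x [Vx nx]|x [[Vx nx]|[Vx [Gx nx]]]].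
  - by have [?|?] := pselect (star Z x); [right|left].
  - by split => // /SYZ.
  - by [].
have dis : (W1 `\` star Z) `&` (W1 `&` (star Z `\` star Y)) = set0.
  by rewrite -subset0 => x [[_ nG'] [_ [Gx _]]].
apply: filterS3 (T_split Lf mA mD dis) nG T2 => x s1 g1 j1 Yx.
apply: (le_trans s1); have {}g1 := g1 (YZ.1 _ Yx); have {}j1 := j1 Yx.
have -> : (c2 * L * av f W1 = c1 * L * av f W1 +
  L * ((2 * K ^+ 4) `^ rho * (thr * av f W1)))%R by rewrite /c2; ring.
exact: (lerD g1 (le_trans j1 (ler_wpM2l (ltW L_gt0) avZ))).
Qed.

(** The passage from [star Y] to [W2] as the removed set changes [f] only inside [W2] and off
    [star Y], which is the situation of [T_jump]. *)
Lemma jump : {ae mu, forall x, Y x ->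
  (`|T (cut f (W1 `\` W2)) x| <= c3 * L * (av f W1 + av f W2))%R}.
Proof.
have mW1 := ball_mble bb BW1; have mW2 := ball_mble bb BW2.
have mSY : measurable (star Y) by exact: star_mble.
have mD1 : measurable (W1 `\` W2) by exact: measurableD.
have mD : measurable (W1 `\` star Y) by exact: measurableD.
have sub : W1 `\` W2 `<=` W1 `\` star Y by move=> x [? n]; split => // /SYW.
have mDD : measurable ((W1 `\` star Y) `\` (W1 `\` W2)) by exact: measurableD.
have DD x : ((W1 `\` star Y) `\` (W1 `\` W2)) x -> W2 x /\ ~ star Y x.
  by move=> [[Vx nx] h]; split => //; apply: contrapT => nW; apply: h.
have jmp := @T_jump K (cut (negf f) ((W1 `\` star Y) `\` (W1 `\` W2))) Y W2
  (Lr_cut r0 mDD (Lr_opp Lf)) BY BW2 YW mWY.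
have {}jmp := jmp (esym (_ : cut (cut _ _) _ = _)).
have /jmp {}jmp : cut (cut (negf f) ((W1 `\` star Y) `\` (W1 `\` W2))) (W2 `\` star Y) =
    cut (negf f) ((W1 `\` star Y) `\` (W1 `\` W2)).
  by rewrite cut_cut setIidl// => x /DD.
apply: filterS3 (T_diff Lf mD1 mD sub) jump_star jmp => x s1 g1 j1 Yx.
apply: (le_trans s1); have {}g1 := g1 Yx; have {}j1 := j1 Yx.
have a1 := av_ge0 mu r vrho rho f W1; have a2 := av_ge0 mu r vrho rho f W2.
have l0 := ltW L_gt0; have [_ c20 _ _ _] := c_ge0.
have p0 : (0 <= (2 * K) `^ rho)%R by exact: powR_ge0.
have avH : (av (cut (negf f) ((W1 `\` star Y) `\` (W1 `\` W2))) W2 <= av f W2)%R.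
  have -> := av_cut_neg mu vrho rho r0 f mW2 mDD.
  exact: (av_cut_le r0 rho0 vrho_ge Lf mW2 mDD).
apply: (le_trans (lerD g1 (le_trans j1 (ler_wpM2l (mulr_ge0 p0 l0) avH)))).
exact: (sum_le_cross a1 a2 l0 c20 p0).
Qed.

Let a1 : (0 <= av f W1)%R. Proof. exact: av_ge0. Qed.
Let a2 : (0 <= av f W2)%R. Proof. exact: av_ge0. Qed.

Let cJ_bound (c u v : R) : (0 <= u)%R -> (0 <= v)%R -> (c <= cJ)%R ->
  (c * L * (u + v) <= cJ * L * (u + v))%R.
Proof.
move=> u0 v0 cc; apply: ler_wpM2r; first exact: addr_ge0.
by apply: ler_wpM2r => //; exact: ltW L_gt0.
Qed.

Lemma jump_split (D : set X) : measurable D -> D `<=` W2 ->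
  {ae mu, forall x, Y x -> (`|T (cut f (W1 `\` D)) x| <=
    `|T (cut f (W2 `\` D)) x| + cJ * L * (av f W1 + av f W2))%R}.
Proof.
move=> mD DW; have mW1 := ball_mble bb BW1; have mW2 := ball_mble bb BW2.
have m1 : measurable (W1 `\` W2) by exact: measurableD.
have m2 : measurable (W2 `\` D) by exact: measurableD.
have -> : W1 `\` D = (W1 `\` W2) `|` (W2 `\` D).
  apply/seteqP; split => [x [? ?]|x [[? n]|[/W21 ? ?]]] //.
    by have [?|?] := pselect (W2 x); [right|left].
  by split => // /DW.
have dis : (W1 `\` W2) `&` (W2 `\` D) = set0 by rewrite -subset0 => x [[_ n] [? _]].
apply: filterS2 (T_split Lf m1 m2 dis) jump => x s1 j1 Yx.
apply: (le_trans s1); rewrite addrC; apply: lerD => //; apply: (le_trans (j1 Yx)).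
exact: (cJ_bound a1 a2 c3_le).
Qed.

(** If [Z] is small, its hull lies in [star Y], hence [star Z] in [W2], and [jump_split] applies.
    Otherwise the left side is bounded by the averages alone: if the merge [Z'] of [Z] and [Y] lies
    in [Y], the piece between [star Z] and [star Y] is a [T_jump] and the rest is [jump_star]; if
    not, [Z'] strictly contains [Y], and [good_around] gives a good point for [near_good]. *)
Lemma trunc_step (Z : set X) : Bs Z ->
  {ae mu, forall x, Y x -> Z x -> (`|T (cut f (W1 `\` star Z)) x| <=
    `|T (cut f (W2 `\` star Z)) x| + cJ * L * (av f W1 + av f W2))%R}.
Proof.
move=> BZ; have [[z [Zz Yz]]|noYZ] := pselect (Z `&` Y !=set0); last first.
  by apply: aeW => x Yx Zx; case: noYZ; exists x.
have mW1 := ball_mble bb BW1; have mW2 := ball_mble bb BW2.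
have mSZ : measurable (star Z) by exact: star_mble.
have mSY : measurable (star Y) by exact: star_mble.
have Z0 := ball_gt0 bb BZ; have Y0 := ball_gt0 bb BY.
have [small|big] := leP (K * m Z)%R (2 * m Y)%R.
  have SZW : star Z `<=` W2.
    apply: subset_trans SYW; apply: subset_trans (star_hull bb BZ) _.
    apply: (sub_star bb) => //; [exact: (hull_ball bb)| |].
      by exists z; split => //; exact: (sub_hull bb BZ).
    exact: le_trans (hull_le bb BZ) small.
  by apply: filterS (jump_split mSZ SZW) => x h Yx _; exact: h.
have YKZ : (m Y <= K * m Z)%R by lra.
have [_ c20 c30 c40 c50] := c_ge0.
suff main : {ae mu, forall x, Y x -> Z x -> (`|T (cut f (W1 `\` star Z)) x| <=
    cJ * L * (av f W1 + av f W2))%R}.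
  by apply: filterS main => x h Yx Zx; apply: (le_trans (h Yx Zx)); rewrite lerDr.
have [|Z' [BZ' ZZ' YZ' mZ']] := ball_merge K1 bb BZ BY; first by exists z.
have {}mZ' : (m Z' <= K * (K * m Z))%R.
  apply: (le_trans mZ'); rewrite ler_pM2l// ge_max YKZ andbT ler_peMl//.
have [Z'Y|nZ'Y] := pselect (Z' `<=` Y).
  have ZY : Z `<=` Y by exact: subset_trans Z'Y.
  have SZY : star Z `<=` star Y by exact: (star_mono bb).
  pose D := W1 `&` (star Y `\` star Z).
  have mD : measurable D.
    by apply: measurableI => //; exact: measurableD.
  have mE : measurable (W1 `\` star Y) by exact: measurableD.
  have jmp : {ae mu, forall x, Z x -> (`|T (cut f D) x| <=
      (2 * K ^+ 2) `^ rho * L * av (cut f D) W2)%R}.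
    apply: (T_jump (Lr_cut r0 mD Lf) BZ BW2).
    - exact: subset_trans ZY YW.
    - by apply: (le_trans mWY); rewrite expr2 -mulrA ler_pM2l.
    - by rewrite cut_cut setIidl// => x [_ [Sx nx]]; split => //; exact: SYW.
  have avD := av_cut_le r0 rho0 vrho_ge Lf mW2 mD.
  have -> : W1 `\` star Z = (W1 `\` star Y) `|` D.
    apply/seteqP; split => [x [Vx nx]|x [[Vx nx]|[Vx [Gx nx]]]].
    - by have [?|?] := pselect (star Y x); [right|left].
    - by split => // /SZY.
    - by [].
  have dis : (W1 `\` star Y) `&` D = set0.
    by rewrite -subset0 => x [[_ n] [_ [? _]]].
  have p0 : (0 <= (2 * K ^+ 2) `^ rho)%R by exact: powR_ge0.
  apply: filterS3 (T_split Lf mE mD dis) jump_star jmp => x s1 g1 j1 Yx Zx.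
  apply: (le_trans s1).
  have l0 := ltW L_gt0.
  have j2 := le_trans (j1 Zx) (ler_wpM2l (mulr_ge0 p0 l0) avD).
  apply: (le_trans (lerD (g1 Yx) j2)).
  apply: (le_trans (sum_le_cross a1 a2 l0 c20 p0)).
  exact: (cJ_bound a1 a2 c5_le).
have [G1 [BG1 ZG1 mG1 [y G1y gy]]] := good_around BZ' (conj YZ' nZ'Y).
have mGZ : (m G1 <= 2 * K ^+ 5 * m Z)%R.
  apply: (le_trans mG1).
  have -> : (2 * K ^+ 5 * m Z = 2 * K ^+ 3 * (K * (K * m Z)))%R by ring.
  by rewrite ler_pM2l// mulr_gt0// exprn_gt0.
have nG := near_good Lf BW1 BZ BG1 (subset_trans ZZ' ZG1) mGZ G1y gy.
apply: filterS nG => x h _ Zx; apply: (le_trans (h Zx)); rewrite -/c4.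
have l0 := ltW L_gt0.
apply: (@le_trans _ _ (c4 * L * (av f W1 + av f W2))%R).
  by apply: ler_wpM2l; [exact: mulr_ge0|rewrite lerDl].
exact: (cJ_bound a1 a2 c4_le).
Qed.

End Jump.

End Operator.

(** * The nodes *)

Section Selection.
Context (R : realType) (d : measure_display) (X : measurableType d).
Variables (mu : {measure set X -> \bar R}) (Bs : set (set X)) (K : R).
Hypotheses (K1 : (1 <= K)%R) (bb : ball_basis mu Bs K) (sep : separable_balls Bs).

Local Notation m A := (fine (mu A)).
Local Notation star := (ball_star mu Bs).
Local Notation hull := (hull mu Bs K).

Let K0 : (0 < K)%R. Proof. exact: lt_le_trans K1. Qed.

(* Any ball containing [A] of measure at most [2 * K ^+ 3 * mu A] lies in [blow A],
   so that a ball strictly containing [blow A] is much larger than [A]. *)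
Definition blow_core (A : set X) : set X :=
  xget A [set b | [/\ Bs b, A `<=` b, (m b <= 2 * K ^+ 3 * m A)%R &
    forall G, Bs G -> A `<=` G -> (m G <= 2 * K ^+ 3 * m A)%R -> (m G < 2 * m b)%R]].

Definition blow A := hull (blow_core A).
Definition node A := hull (blow A).

Lemma K3_ge1 : (1 <= K ^+ 3)%R. Proof. exact: exprn_ege1. Qed.

Lemma blow_coreP A : Bs A ->
  [/\ Bs (blow_core A), A `<=` blow_core A, (m (blow_core A) <= 2 * K ^+ 3 * m A)%R &
    forall G, Bs G -> A `<=` G -> (m G <= 2 * K ^+ 3 * m A)%R ->
      (m G < 2 * m (blow_core A))%R].
Proof.
move=> BA; have A0 := ball_gt0 bb BA; rewrite /blow_core; case: xgetP => [b _ //|none].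
pose P := [set G | [/\ Bs G, A `<=` G & (m G <= 2 * K ^+ 3 * m A)%R]].
have [|G [BG AG mG]|b [Bb Ab mb] bmax] :=
  @near_max R (set X) P (fun G => m G) (2 * K ^+ 3 * m A)%R.
- exists A; split => //; have := K3_ge1; nra.
- by rewrite (ball_gt0 bb).
- by case: (none b); split => // G BG AG mG; apply: bmax.
Qed.

Lemma blow_ball A : Bs A -> Bs (blow A).
Proof. by move=> /blow_coreP[? _ _ _]; exact: hull_ball. Qed.

Lemma node_ball A : Bs A -> Bs (node A).
Proof. by move=> /blow_ball; exact: hull_ball. Qed.

Lemma sub_blow A : Bs A -> A `<=` blow A.
Proof.
move=> BA; have [Bb Ab _ _] := blow_coreP BA.
exact: subset_trans Ab (sub_hull bb Bb).
Qed.

Lemma blow_node A : Bs A -> blow A `<=` node A.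
Proof. by move=> BA; apply: (sub_hull bb (blow_ball BA)). Qed.

Lemma blow_absorb A G : Bs A -> Bs G -> A `<=` G -> (m G <= 2 * K ^+ 3 * m A)%R ->
  G `<=` blow A.
Proof.
move=> BA BG AG mG; have [Bb Ab _ bmax] := blow_coreP BA.
apply: (sub_hull2 bb) => //; last exact/ltW/bmax.
by have [x Ax] := ball_neq0 bb BA; exists x; split; [exact: AG|exact: Ab].
Qed.

Lemma blow_lt A G : Bs A -> Bs G -> blow A `<` G -> (2 * K ^+ 3 * m A < m G)%R.
Proof.
move=> BA BG [AG nGA]; rewrite ltNge; apply/negP => h; apply: nGA.
by apply: blow_absorb => //; apply: subset_trans AG; exact: sub_blow.
Qed.

Lemma node_le A : Bs A -> (m (node A) <= 2 * K ^+ 5 * m A)%R.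
Proof.
move=> BA; have [Bb Ab mb _] := blow_coreP BA.
have h1 := hull_le bb (blow_ball BA); have h2 := hull_le bb Bb.
apply: (le_trans h1); apply: (@le_trans _ _ (K * (K * (2 * K ^+ 3 * m A)))%R).
  by rewrite ler_pM2l//; apply: (le_trans h2); rewrite ler_pM2l.
by rewrite le_eqVlt; apply/orP; left; apply/eqP; ring.
Qed.

Variables (bd : set X -> set X) (B : set X).
Hypotheses (bd_mble : forall W, Bs W -> measurable (bd W))
  (bd_le : forall W, Bs W -> mu (bd W) <= ((8 * K ^+ 6)^-1 * m W)%:E).
Hypothesis BB : Bs B.

Let W0 := hull B.
Let BW0 : Bs W0. Proof. exact: hull_ball. Qed.

Definition majority (E A : set X) := Bs A /\ (m A <= 2 * m (A `&` E))%R.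

(** The default [set0] is not a ball: a failed selection is detected by [active] and removes nothing
    from [rest]. *)
Definition sel (E : set X) : set X := xget set0
  [set A | majority E A /\ forall A', majority E A' -> (m A' < 2 * m A)%R].

Fixpoint rest (n : nat) : set X :=
  if n is n'.+1 then rest n' `\` (sel (rest n') `&` rest n' `\` bd (node (sel (rest n'))))
  else bd W0.

Definition core n := sel (rest n).
Definition good n := core n `&` rest n `\` bd (node (core n)).
Definition active n := Bs (core n).

Lemma restS n : rest n.+1 = rest n `\` good n. Proof. by []. Qed.

Lemma nball0 : ~ Bs set0.
Proof. by move=> /(ball_neq0 bb)[]. Qed.

Lemma good_inactive n : ~ active n -> good n = set0.
Proof.
move=> na; suff c0 : core n = set0 by rewrite /good c0 set0I set0D.
by move: na; rewrite /active /core /sel; case: xgetP => [A _ [[]]|].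
Qed.

Lemma rest_le n k : (n <= k)%N -> rest k `<=` rest n.
Proof.
elim: k => [|k IH]; first by rewrite leqn0 => /eqP ->.
rewrite leq_eqVlt => /orP[/eqP->//|]; rewrite ltnS => /IH h.
by apply: subset_trans h; rewrite restS; exact: subDsetl.
Qed.

Lemma rest_mble n : measurable (rest n).
Proof.
elim: n => [|n IH]; first exact: bd_mble.
rewrite restS; have [a|na] := pselect (active n); last by rewrite good_inactive// setD0.
apply: measurableD => //; apply: measurableD.
  by apply: measurableI => //; exact: (ball_mble bb a).
by apply: bd_mble; exact: node_ball.
Qed.

Lemma good_mble n : measurable (good n).
Proof.
have [a|na] := pselect (active n); last by rewrite good_inactive.
apply: measurableD; last by apply: bd_mble; exact: node_ball.
by apply: measurableI; [exact: (ball_mble bb a)|exact: rest_mble].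
Qed.

Lemma rest_fin n : mu (rest n) < +oo.
Proof.
apply: (@le_lt_trans _ _ (mu (bd W0))).
  by apply: le_measure; rewrite ?inE; [exact: rest_mble|exact: bd_mble|exact: (@rest_le 0)].
by apply: le_lt_trans (bd_le BW0) (ltry _).
Qed.

Lemma m_mono (A C : set X) : measurable A -> measurable C -> mu C < +oo -> A `<=` C ->
  (m A <= m C)%R.
Proof.
move=> mA mC Coo AC; have le : mu A <= mu C by apply: le_measure; rewrite ?inE.
apply: fine_le => //; rewrite ge0_fin_numE//; exact: le_lt_trans Coo.
Qed.

Lemma ball_oo A : Bs A -> mu A < +oo.
Proof. by move=> BA; rewrite (ball_muE bb BA) ltry. Qed.

Lemma majority_mono E F A : measurable E -> measurable F -> E `<=` F ->
  majority E A -> majority F A.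
Proof.
move=> mE mF EF [BA h]; split => //; apply: (le_trans h); rewrite ler_pM2l//.
have mA := ball_mble bb BA; apply: m_mono; [exact: measurableI..| |exact: setIS].
by apply: le_lt_trans (ball_oo BA); apply: le_measure; rewrite ?inE//; exact: measurableI.
Qed.

Lemma activeP n A : majority (rest n) A -> active n /\ (m A < 2 * m (core n))%R.
Proof.
move=> mA.
have [|G [BG hG]|A' [BA' hA'] Amax] :=
  @near_max R (set X) (majority (rest n)) (fun G => m G) (2 * m (rest n))%R.
- by exists A.
- rewrite (ball_gt0 bb)//=; apply: (le_trans hG); rewrite ler_pM2l//; apply: m_mono.
  + by apply: measurableI; [exact: (ball_mble bb BG)|exact: rest_mble].
  + exact: rest_mble.
  + exact: rest_fin.
  + by move=> x [].
rewrite /active /core /sel; case: xgetP => [C _ [[BC _] /(_ _ mA)]//|none].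
by case: (none A').
Qed.

Lemma active_majority n : active n -> majority (rest n) (core n).
Proof.
rewrite /active /core /sel; case: xgetP => [C -> [] //|_ /nball0//].
Qed.

Lemma core_le_rest n : active n -> (m (core n) <= 2 * m (rest 0))%R.
Proof.
move=> a; have [_ h] := active_majority a; apply: (le_trans h); rewrite ler_pM2l//.
apply: m_mono; [|exact: rest_mble|exact: rest_fin|].
  by apply: measurableI; [exact: (ball_mble bb a)|exact: rest_mble].
by move=> x [_]; exact: (@rest_le 0).
Qed.

Lemma m_rest0 : (m (rest 0) <= (8 * K ^+ 6)^-1 * m W0)%R.
Proof.
by rewrite -lee_fin fineK; [exact: bd_le|rewrite ge0_fin_numE//; exact: (rest_fin 0)].
Qed.

(** The factor [(8 * K ^+ 6)^-1] absorbs the [2 * K ^+ 5] of the node, the [K] of the hull [W0] and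
    the 2 of the half-filled core. It makes nodes meeting [B] lie in [W0]. *)
Lemma node_lt n : active n -> (m (node (core n)) < m B)%R.
Proof.
move=> a; have B0 := ball_gt0 bb BB.
apply: (le_lt_trans (node_le a)).
have h1 : (m (core n) <= 2 * ((8 * K ^+ 6)^-1 * (K * m B)))%R.
  apply: (le_trans (core_le_rest a)); rewrite ler_pM2l//; apply: (le_trans m_rest0).
  by rewrite ler_pM2l ?invr_gt0 ?mulr_gt0 ?exprn_gt0//; exact: (hull_le bb).
apply: (@le_lt_trans _ _ (2 * K ^+ 5 * (2 * ((8 * K ^+ 6)^-1 * (K * m B))))%R).
  by rewrite ler_pM2l// mulr_gt0// exprn_gt0.
rewrite (_ : (_ * _ = m B / 2)%R); first lra.
by field; rewrite gt_eqF.
Qed.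

(** At least half of the core is still in [rest n], and the bad set of its node takes at most a
    quarter of the core. *)
Lemma good_le n : active n -> (m (core n) <= 4 * m (good n))%R.
Proof.
move=> a; have [_ h] := active_majority a; have mA := ball_mble bb a.
have A0 := ball_gt0 bb a.
have BN := node_ball a; have mb := bd_mble BN.
have mAR : measurable (core n `&` rest n) by apply: measurableI => //; exact: rest_mble.
have le : mu (core n `&` rest n) <= mu (good n) + mu (bd (node (core n))).
  apply: le_trans (measureU2 _ _ _) => //; last exact: good_mble.
  apply: le_measure; rewrite ?inE//; first by apply: measurableU => //; exact: good_mble.
  by move=> x Ax; have [?|?] := pselect (bd (node (core n)) x); [right|left].
have f1 : mu (core n `&` rest n) \is a fin_num.
  rewrite ge0_fin_numE// (le_lt_trans _ (ball_oo a))//; apply: le_measure; rewrite ?inE//.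
have f2 : mu (good n) \is a fin_num.
  rewrite ge0_fin_numE// (le_lt_trans _ (ball_oo a))//; apply: le_measure; rewrite ?inE//.
    exact: good_mble.
  by move=> x [[]].
have h2 : mu (bd (node (core n))) <= (m (core n) / 4)%:E.
  apply: (le_trans (bd_le BN)); rewrite lee_fin.
  apply: (@le_trans _ _ ((8 * K ^+ 6)^-1 * (2 * K ^+ 5 * m (core n)))%R).
    by rewrite ler_pM2l ?invr_gt0 ?mulr_gt0 ?exprn_gt0//; exact: node_le.
  have -> : ((8 * K ^+ 6)^-1 * (2 * K ^+ 5 * m (core n)) = m (core n) / 4 / K)%R.
    by field; rewrite gt_eqF.
  by rewrite ler_pdivrMr// ler_peMr// divr_ge0// ltW.
have : (m (core n `&` rest n) <= m (good n) + m (core n) / 4)%R.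
  rewrite -lee_fin EFinD !fineK//; apply: (le_trans le); exact: leeD.
lra.
Qed.

Lemma good_disjoint n k x : good n x -> good k x -> n = k.
Proof.
wlog nk : n k / (n < k)%N.
  move=> W gn gk; have [nk|nk|//] := ltngtP n k; first exact: W.
  by apply/esym/W.
by move=> gn [[_ /(rest_le nk)[_ /(_ gn)]]].
Qed.

Lemma good_bd n : good n `<=` bd W0.
Proof. by move=> x [[_ /(@rest_le 0 n (leq0n _))]]. Qed.

(** Otherwise some ball [A] is half filled by the remainder, hence by every [rest n]; each core then
    has more than half the measure of [A], and infinitely many disjoint sets [good n] of measure at
    least [m A / 8] would lie in [rest 0]. *)
Lemma rest_negligible : mu (\bigcap_n rest n) = 0.
Proof.
set Rinf := \bigcap_n rest n.
have mRi : measurable Rinf by apply: bigcap_measurable => // n _; exact: rest_mble.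
apply/eqP; apply: contrapT => /negP; rewrite -measure_gt0 => Rpos.
have Roo : mu Rinf < +oo.
  apply: le_lt_trans (rest_fin 0); apply: le_measure; rewrite ?inE//.
    exact: rest_mble.
  by move=> x; apply.
have [A BA hA] := majority_ball K1 bb sep mRi Rpos Roo.
have A0 := ball_gt0 bb BA.
have gA n : (m A / 8 <= m (good n))%R.
  have mA : majority (rest n) A.
    by apply: (@majority_mono Rinf) => //; [exact: rest_mble|move=> x; apply].
  have [a lt] := activeP mA; have := good_le a; lra.
have sum N : (N%:R * (m A / 8) <= m (rest 0))%R.
  apply: (@le_trans _ _ (\sum_(i <- iota 0 N) m (good i))%R).
    have -> : (N%:R * (m A / 8) = \sum_(i <- iota 0 N) m A / 8)%R.
      by rewrite big_const_seq count_predT size_iota iter_addr_0 mulr_natl.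
    by apply: ler_sum_mem => i _; exact: gA.
  apply: sum_measure_le.
  - exact: iota_uniq.
  - by move=> i j _ _ [x [gi gj]]; exact: good_disjoint gi gj.
  - by move=> i _; exact: good_mble.
  - exact: rest_mble.
  - exact: rest_fin.
  - by move=> i _; exact: good_bd.
pose N := (Num.truncn (m (rest 0) / (m A / 8))).+1.
have := sum N; rewrite -ler_pdivlMr ?divr_gt0// leNgt => /negP; apply.
exact: truncnS_gt.
Qed.

Lemma cover_ae : mu.-negligible (bd W0 `\` \bigcup_n good n).
Proof.
suff -> : bd W0 `\` \bigcup_n good n = \bigcap_n rest n.
  apply/negligibleP; last exact: rest_negligible.
  by apply: bigcap_measurable => // n _; exact: rest_mble.
apply/seteqP; split => [x [bx ng] n _|x rx]; last first.
  split; first exact: (rx 0%N).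
  by move=> [n _ gx]; have [_] := rx n.+1 Logic.I; apply.
elim: n => [//|n IH]; split => // gx; apply: ng; by exists n.
Qed.

(** A ball inside [bd W0] is a majority ball for [rest 0], but being twice as large as [core k] it
    is none for [rest k]. At the step [l] where this is lost, [good l] meets [G], and [G] was still
    a competitor of [core l]. *)
Lemma link G k : Bs G -> active k -> (2 * m (core k) <= m G)%R ->
  (exists2 y, G y & ~ bd W0 y) \/
  exists l y, [/\ active l, G y, good l y & (m G < 2 * m (core l))%R].
Proof.
move=> BG ak hk; have [GW0|] := pselect (G `<=` bd W0); last first.
  move=> h; left; apply: contrapT => none; apply: h => y Gy.
  by apply: contrapT => ny; apply: none; exists y.
right; have nmaj : ~ majority (rest k) G by move=> /activeP[_]; rewrite ltNge hk.
have maj0 : majority (rest 0) G.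
  by split => //; rewrite setIidl//; have := ball_gt0 bb BG; lra.
have [l [ml nml]] : exists l, majority (rest l) G /\ ~ majority (rest l.+1) G.
  elim: k nmaj {ak hk} => [//|k IH] nk.
  by have [mk|/IH//] := pselect (majority (rest k) G); exists k.
have [al lt] := activeP ml; exists l.
have [y [Gy gy]] : G `&` good l !=set0.
  apply: contrapT => none; apply: nml; split => //; case: ml => _ h.
  apply: (le_trans h); rewrite le_eqVlt; apply/orP; left; apply/eqP.
  congr (_ * fine (mu _))%R; apply/seteqP; split => [x [Gx rx]|x [Gx [rx _]]] //.
  by split => //; split => // gx; apply: none; exists x.
by exists y.
Qed.

Definition cls W := [set k | active k /\ node (core k) = W].
Definition stable W := exists2 k, cls W k & blow (core k) = W.
Definition bodies W := [set Y | exists2 k, cls W k &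
  Y = blow (core k) /\ (stable W -> Y = W)].
(** Since [bd W0] is not assumed to lie in [W0], cores may lie away from [B]; nodes that meet [B]
    are smaller than [B], hence contained in its hull [W0]. *)
Definition nodes := [set W | W = W0 \/ cls W !=set0 /\ W `&` B !=set0].

Lemma bodyP W Y : bodies W Y ->
  [/\ Bs Y, Y `<=` W, star Y `<=` W & (m W <= K * m Y)%R].
Proof.
move=> [k [ak <-] [-> _]]; have BY := blow_ball ak; split => //.
- exact: blow_node.
- exact: (star_hull bb).
- exact: (hull_le bb).
Qed.

Lemma body_blow W k : cls W k -> exists2 Y, bodies W Y & blow (core k) `<=` Y.
Proof.
move=> ck; have [st|nst] := pselect (stable W); last by exists (blow (core k)) => //; exists k.
have [j cj bj] := st; exists W; first by exists j.
by case: ck => ak <-; exact: blow_node.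
Qed.

Lemma body_lt W Y G : bodies W Y -> Bs G -> Y `<` G ->
  exists2 k, cls W k & (2 * K ^+ 3 * m (core k) < m G)%R.
Proof. by move=> [k ck [-> _]] BG YG; exists k => //; apply: blow_lt => //; case: ck. Qed.

Lemma cls_ball W : cls W !=set0 -> Bs W.
Proof. by move=> [k [ak <-]]; exact: node_ball. Qed.

Lemma node_W0 W : cls W !=set0 -> W `&` B !=set0 -> W `<=` W0 /\ (m W < m B)%R.
Proof.
move=> cW WB; have lt : (m W < m B)%R by case: cW => k [ak <-]; exact: node_lt.
split => //; apply: (sub_hull2 bb) => //; first exact: cls_ball.
have := ball_gt0 bb BB; lra.
Qed.

Lemma nodes_ball W : nodes W -> Bs W.
Proof. by move=> [->//|[/cls_ball]]. Qed.

Lemma nodes_W0 W : nodes W -> W `<=` W0.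
Proof. by move=> [->//|[cW /(node_W0 cW)[]]]. Qed.

(* The ball [G] below realises, up to a factor 2, the smallest scale at which a
   ball around a body of [W] sees points that are good for another node: below
   that scale there are no balls at all, and the node [V] seen by [G] is the
   parent of [W]. *)
Definition is_parent (W V G : set X) :=
  [/\ nodes V, W `<=` V, W <> V,
      V = W0 \/ exists2 Y, bodies V Y & W `<=` Y &
      [/\ Bs G, G `&` W !=set0, exists2 y, G y & ~ bd V y &
        forall Y G', bodies W Y -> Bs G' -> Y `<` G' -> (m G <= 2 * m G')%R] ].

(** By [body_lt], [G] is larger than [2 * K ^+ 3] times some core of [W], so [link] applies. If the
    point found is in [good l], then [G] is less than twice as large as [core l]; merging [W], [G]
    and [core l] stays within [2 * K ^+ 3] times [core l] and is absorbed by [blow (core l)]. *)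
Lemma parent_ex W : nodes W -> W <> W0 -> exists V G : set X, is_parent W V G.
Proof.
move=> [//|[cW WB]] nW0; have [WW0 ltWB] := node_W0 cW WB; have BW := cls_ball cW.
have BsubW0 : B `<=` W0 by exact: (sub_hull bb).
have ltW0 : (m W < m W0)%R by apply: lt_le_trans ltWB (ball_le bb BB BW0 BsubW0).
pose P : set (set X) := [set G | Bs G /\ exists2 Y, bodies W Y & Y `<` G].
have P0 : P !=set0.
  exists W0; split => //; case: cW => k ck; have [Y bY _] := body_blow ck.
  exists Y => //; have [BY YW _ _] := bodyP bY; split; first exact: subset_trans YW WW0.
  move=> /(ball_le bb BW0 BY); apply/negP; rewrite -ltNge.
  exact: le_lt_trans (ball_le bb BY BW YW) ltW0.
have W0pos := ball_gt0 bb BW.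
have [||G [BG [Y bY [YG nGY]]] Gmin] := @near_min R (set X) P (fun G => m G) (m W / K)%R P0.
- by rewrite divr_gt0.
- move=> G [BG [Y bY [YG _]]]; have [BY _ _ h] := bodyP bY.
  rewrite ler_pdivrMr// mulrC; apply: (le_trans h); rewrite ler_pM2l//.
  exact: (ball_le bb BY BG YG).
have {}Gmin : forall Y G', bodies W Y -> Bs G' -> Y `<` G' -> (m G <= 2 * m G')%R.
  by move=> Y' G' bY' BG' YG'; apply: Gmin; split => //; exists Y'.
have [BY YW _ mWY] := bodyP bY; have [y0 Yy0] := ball_neq0 bb BY.
have GW : G `&` W !=set0 by exists y0; split; [exact: YG|exact: YW].
have [k ck ltG] := body_lt bY BG (conj YG nGY).
have [ak nk] := ck.
have k0 := ball_gt0 bb ak.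
have K3 := K3_ge1.
have [|[y Gy ny]|[l [y [al Gy gy ltl]]]] := @link G k BG ak.
- apply: (le_trans _ (ltW ltG)); rewrite ler_pM2r//; lra.
- exists W0, G; split => //; [by left|by left|split => //; by exists y].
have l0 := ball_gt0 bb al; have G0 := ball_gt0 bb BG.
have [D1 [BD1 WD1 GD1 mD1]] : exists D, [/\ Bs D, W `<=` D, G `<=` D &
    (m D <= K * (K * m G))%R].
  have [|D [BD WD GD mD]] := ball_merge K1 bb BW BG; first by rewrite setIC.
  exists D; split => //; apply: (le_trans mD); rewrite ler_pM2l// ge_max.
  rewrite ler_peMl ?(ltW G0)// andbT; apply: (le_trans mWY); rewrite ler_pM2l//.
  exact: (ball_le bb BY BG YG).
have [D [BD DD lD mD]] : exists D, [/\ Bs D, D1 `<=` D, core l `<=` D &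
    (m D <= 2 * K ^+ 3 * m (core l))%R].
  have [|D [BD D1D lD mD]] := ball_merge K1 bb BD1 al.
    by exists y; split; [exact: GD1|case: gy => [[]]].
  exists D; split => //; apply: (le_trans mD).
  have -> : (2 * K ^+ 3 * m (core l) = K * (K * (K * (2 * m (core l)))))%R by ring.
  rewrite ler_pM2l// ge_max; apply/andP; split.
    by apply: (le_trans mD1); rewrite !ler_pM2l// ltW.
  rewrite !mulrA; rewrite ler_peMl ?(ltW l0)//.
  have KK : (1 <= K * K)%R by rewrite mulr_ege1.
  lra.
have DV : D `<=` blow (core l) by exact: blow_absorb.
have cl : cls (node (core l)) l by [].
have [Z bZ lZ] := body_blow cl.
have WZ : W `<=` blow (core l) by apply: subset_trans DV; exact: subset_trans DD.
have WV : W `<=` node (core l) by apply: subset_trans WZ _; exact: blow_node.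
exists (node (core l)), G; split => //.
- right; split; first by exists l.
  by case: WB => z [Wz Bz]; exists z; split => //; exact: WV.
(* If the node of [core l] were [W], then [W] would be stable and [Y = W]; but [G] lies in
   [blow (core l) = W] and not in [Y]. *)
- move=> WE; have bE : blow (core l) = W.
    by apply/seteqP; split => //; rewrite WE; exact: blow_node.
  have st : stable W by exists l => //; rewrite WE.
  case: bY => k' _ [_ /(_ st) YW']; apply: nGY; rewrite YW' -bE.
  by apply: subset_trans DV; exact: subset_trans DD.
- by right; exists Z => //; exact: subset_trans lZ.
- by split => //; exists y => //; case: gy.
Qed.

Lemma parents : exists par : set X -> set X, par W0 = W0 /\
  forall W, nodes W -> W <> W0 -> exists G, is_parent W (par W) G.
Proof.
have h W : exists V, (W = W0 -> V = W0) /\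
    (nodes W -> W <> W0 -> exists G, is_parent W V G).
  have [->|nW] := pselect (W = W0); first by exists W0.
  have [SW|nS] := pselect (nodes W); last by exists W0; split.
  by have [V [G hG]] := parent_ex SW nW; exists V; split => // _ _; exists G.
have [par hpar] := choice h; exists par; split; first exact: (hpar W0).1.
by move=> W; exact: (hpar W).2.
Qed.

Definition own (V : set X) : set X :=
  [set x | V = W0 /\ (W0 `\` bd W0) x] `|` \bigcup_(k in cls V) good k.

Lemma own_mble V : measurable (own V).
Proof.
apply: measurableU; last by apply: bigcup_measurable => k _; exact: good_mble.
have [E|nE] := pselect (V = W0); last first.
  by rewrite (_ : [set _ | _] = set0)// -subset0 => x [].
rewrite (_ : [set _ | _] = W0 `\` bd W0); last by apply/seteqP; split => x // [].
by apply: measurableD; [exact: (ball_mble bb BW0)|exact: bd_mble].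
Qed.

Lemma own_sub V : nodes V -> own V `<=` V.
Proof.
move=> SV x [[-> []]//|[k [ak <-] [[Ax _] _]]].
exact: (blow_node ak (sub_blow ak Ax)).
Qed.

Lemma own_not_bd V x : own V x -> ~ bd V x.
Proof. by move=> [[-> []]//|[k [ak <-] []]]. Qed.

Lemma own_body V x : V <> W0 -> own V x -> exists2 Y, bodies V Y & Y x.
Proof.
move=> nV [[]//|[k ck [[Ax _] _]]]; have [Y bY YY] := body_blow ck; exists Y => //.
by apply: YY; apply: sub_blow => //; case: ck.
Qed.

Let own_oo V : nodes V -> mu (own V) \is a fin_num.
Proof.
move=> SV; rewrite ge0_fin_numE// (le_lt_trans _ (ball_oo (nodes_ball SV)))//.
apply: le_measure; rewrite ?inE; [exact: own_mble| |exact: own_sub].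
exact: (ball_mble bb (nodes_ball SV)).
Qed.

(** A node is at most [2 * K ^+ 5] times its core and a core at most 4 times its treated part. For
    the root, [bd W0] removes at most one eighth. *)
Lemma own_le V : nodes V -> ((8 * K ^+ 5)^-1 * m V <= m (own V))%R.
Proof.
move=> SV; have K5 : (0 < 8 * K ^+ 5)%R by rewrite mulr_gt0// exprn_gt0.
case: (SV) => [E|[[k ck] _]].
  have mb := bd_mble BW0; have mW := ball_mble bb BW0.
  have W00 := ball_gt0 bb BW0.
  have h1 := mD bb BW0 mb.
  have h2 : (m (W0 `&` bd W0) <= m W0 / 8)%R.
    apply: (@le_trans _ _ (m (rest 0))).
      by apply: m_mono; [exact: measurableI|exact: bd_mble|exact: (rest_fin 0)|move=> x []].
    apply: (le_trans m_rest0); rewrite mulrC ler_pM2l// lef_pV2 ?posrE ?mulr_gt0 ?exprn_gt0//.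
    by rewrite ler_peMr// exprn_ege1.
  have h3 : ((8 * K ^+ 5)^-1 * m W0 <= m W0 / 8)%R.
    rewrite mulrC ler_pM2l// lef_pV2 ?posrE ?mulr_gt0 ?exprn_gt0//.
    by rewrite ler_peMr// exprn_ege1.
  rewrite E; apply: (@le_trans _ _ (m (W0 `\` bd W0))); first lra.
  apply: m_mono; [exact: measurableD|exact: own_mble| |by move=> x hx; left].
  by rewrite -ge0_fin_numE//; apply: own_oo; left.
have [ak nk] := ck; rewrite ler_pdivrMl//.
apply: (@le_trans _ _ (2 * K ^+ 5 * m (core k))%R); first by rewrite -{1}nk; exact: node_le.
apply: (@le_trans _ _ (2 * K ^+ 5 * (4 * m (own V)))%R); last first.
  by rewrite le_eqVlt; apply/orP; left; apply/eqP; ring.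
rewrite ler_pM2l ?mulr_gt0 ?exprn_gt0//; apply: (le_trans (good_le ak)).
rewrite ler_pM2l//; apply: m_mono; [exact: good_mble|exact: own_mble| |].
  by rewrite -ge0_fin_numE//; exact: own_oo.
by move=> x gx; right; exists k.
Qed.

Lemma own_disj : trivIset nodes own.
Proof.
move=> V V' SV SV' [x [h h']]; case: h => [[-> [_ nb]]|[k [ak <-] gk]].
  by case: h' => [[->//]|[k' _ /good_bd]].
case: h' => [[_ [_ nb]]|[k' [ak' <-] gk']]; first by case: nb; exact: good_bd gk.
by rewrite (good_disjoint gk gk').
Qed.

Lemma own_cover : {ae mu, forall x, B x -> exists2 W, nodes W & own W x}.
Proof.
apply: negligibleS cover_ae => x /= h; have [Bx none] : B x /\ ~ exists2 W, nodes W & own W x.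
  by split; apply: contrapT => h'; apply: h => // Bx; apply: contrapT => h2; apply: h'.
have W0x : W0 x by exact: (sub_hull bb BB Bx).
split.
  by apply: contrapT => nb; apply: none; exists W0; [left|left; split].
move=> [k _ gx]; have ak : active k.
  by apply: contrapT => na; move: gx; rewrite good_inactive.
apply: none; exists (node (core k)); last by right; exists k.
right; split; first by exists k.
exists x; split => //; case: gx => [[Ax _] _].
exact: (blow_node ak (sub_blow ak Ax)).
Qed.

(** Supplies the condition of T2 that the star of a body is not the whole space. *)
Lemma root_large W : nodes W -> W <> W0 -> W <> setT.
Proof.
move=> [//|[cW WB]] nW WT; have [WW0 lt] := node_W0 cW WB.
by apply: nW; apply/seteqP; split => // x _; rewrite WT.
Qed.

End Selection.

(** * The tree of nodes *)

Section Tree.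
Context (R : realType) (d : measure_display) (X : measurableType d).
Variables (mu : {measure set X -> \bar R}) (Bs : set (set X)) (K : R).
Hypotheses (K1 : (1 <= K)%R) (bb : ball_basis mu Bs K) (sep : separable_balls Bs).

Local Notation m A := (fine (mu A)).

Variables (S : set (set X)) (root : set X) (par own : set X -> set X) (gamma : R).
Hypotheses (gamma0 : (0 < gamma)%R) (SB : S `<=` Bs) (Sroot : S root)
  (S_root : forall W, S W -> W `<=` root).
Hypothesis ownP : forall W, S W ->
  [/\ measurable (own W), own W `<=` W & (gamma * m W <= m (own W))%R].
Hypothesis own_disj : trivIset S own.
Hypotheses (par_root : par root = root)
  (parP : forall W, S W -> W <> root -> [/\ S (par W), W `<=` par W & W <> par W]).

Lemma par_S W : S W -> S (par W).
Proof.
move=> SW; have [->|nr] := pselect (W = root); first by rewrite par_root.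
by have [] := parP SW nr.
Qed.

Lemma par_sub W : S W -> W `<=` par W.
Proof.
move=> SW; have [->|nr] := pselect (W = root); first by rewrite par_root.
by have [] := parP SW nr.
Qed.

Definition anc W V := exists n, V = iter n par W.

Lemma anc_S W V : S W -> anc W V -> S V /\ W `<=` V.
Proof.
move=> SW [n ->]; elim: n => [|n [Sn Wn]] /=; first by split.
split; first exact: (par_S Sn).
by apply: subset_trans Wn _; exact: par_sub.
Qed.

Lemma anc_trans W V V' : anc W V -> anc V V' -> anc W V'.
Proof. by move=> [n ->] [k ->]; exists (k + n)%N; rewrite iterD. Qed.

Lemma anc_total W V V' : anc W V -> anc W V' -> anc V V' \/ anc V' V.
Proof.
move=> [n ->] [k ->]; have [nk|/ltnW kn] := leqP n k; [left|right].
  by exists (k - n)%N; rewrite -iterD subnK.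
by exists (n - k)%N; rewrite -iterD subnK.
Qed.

Let cS : countable S.
Proof. exact: (sparse_countable bb gamma0 SB ownP own_disj (SB Sroot) S_root). Qed.

Lemma own_neq0 W : S W -> own W !=set0.
Proof.
move=> SW; apply/set0P/eqP => E; have [_ _] := ownP SW; rewrite E measure0 /= leNgt.
by move/negP; apply; rewrite mulr_gt0// (ball_gt0 bb (SB SW)).
Qed.

Let above W := \bigcup_(V in S `&` [set V | W `<=` V]) own V.

Let above_mble W : measurable (above W).
Proof.
apply: countable_bigcup_measurable; last by move=> V [/ownP[]].
by apply: sub_countable cS; apply: subset_card_le => V [].
Qed.

Let above_root W : above W `<=` root.
Proof.
move=> x [V [SV _] /(_ : own V `<=` root)]; apply.
by apply: subset_trans (S_root SV); have [] := ownP SV.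
Qed.

Let root_oo : mu root < +oo.
Proof. by rewrite (ball_muE bb (SB Sroot)) ltry. Qed.

Let fin_sub A : measurable A -> A `<=` root -> mu A \is a fin_num.
Proof.
move=> mA Ar; rewrite ge0_fin_numE// (le_lt_trans _ root_oo)//.
by apply: le_measure; rewrite ?inE//; exact: (ball_mble bb (SB Sroot)).
Qed.

Let above_own W : S W -> (gamma * m W <= m (above W))%R.
Proof.
move=> SW; have [mo oW h] := ownP SW; apply: (le_trans h); apply: fine_le.
- by apply: fin_sub => //; apply: subset_trans (S_root SW).
- exact: fin_sub.
- by apply: le_measure; rewrite ?inE// => x ox; exists W => //; split.
Qed.

Let above_par W : S W -> W <> root -> (gamma * m W + m (above (par W)) <= m (above W))%R.
Proof.
move=> SW nr; have [SV WV nWV] := parP SW nr; have [mo oW h] := ownP SW.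
have fo : mu (own W) \is a fin_num by apply: fin_sub => //; apply: subset_trans (S_root SW).
apply: (@le_trans _ _ (m (own W `|` above (par W)))).
  rewrite measureU//; last first.
    rewrite -subset0 => x [ox [V [SV' VV] ox']].
    have E : W = V by apply: own_disj => //; exists x.
    by apply: nWV; apply/seteqP; split => //; rewrite {2}E.
  by rewrite fineD//; [rewrite lerD2r|exact: fin_sub].
apply: fine_le.
- by apply: fin_sub; [exact: measurableU|move=> x [/oW/(S_root SW)|/above_root]].
- exact: fin_sub.
- apply: le_measure; rewrite ?inE//; first exact: measurableU.
  move=> x [ox|[V [SV' VV] ox]]; first by exists W => //; split.
  by exists V => //; split => //; exact: subset_trans VV.
Qed.

(* Each step towards the root removes a set of measure [>= gamma * mu W] from the
   union of the disjoint sets [own V] over the nodes [V] above [W]. *)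
Lemma reach_root W : S W -> anc W root.
Proof.
move=> SW.
suff main n : forall W, S W -> (m (above W) <= n%:R * (gamma * m W))%R -> anc W root.
  have W0 := ball_gt0 bb (SB SW); have gW : (0 < gamma * m W)%R by rewrite mulr_gt0.
  apply: (main (Num.truncn (m (above W) / (gamma * m W))).+1) => //.
  by rewrite -ler_pdivrMr// ltW// truncnS_gt.
elim: n => [|n IH] {}W {}SW h.
  have gW : (0 < gamma * m W)%R by rewrite mulr_gt0// (ball_gt0 bb (SB SW)).
  by have := above_own SW; move: h; rewrite mul0r; lra.
have [->|nr] := pselect (W = root); first by exists 0%N.
have [SV WV _] := parP SW nr.
apply: (@anc_trans _ (par W)); first by exists 1%N.
apply: IH => //; have := above_par SW nr.
have : (n%:R * (gamma * m W) <= n%:R * (gamma * m (par W)))%R.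
  rewrite ler_wpM2l// ler_pM2l//; exact: (ball_le bb (SB SW) (SB SV) WV).
move: h; rewrite -natr1 mulrDl mul1r; lra.
Qed.

Lemma tree_ind (Q : set X -> Prop) : Q root ->
  (forall W, S W -> W <> root -> Q (par W) -> Q W) -> forall W, S W -> Q W.
Proof.
move=> Q0 QS W SW; have [n] := reach_root SW; elim: n W SW => [|n IH] W SW /= E.
  by rewrite -E.
have [->//|nr] := pselect (W = root); have [SV _ _] := parP SW nr.
by apply: QS => //; apply: IH => //; rewrite -iterSr.
Qed.

Definition bar V := \bigcup_(W in S `&` [set W | anc W V]) own W.

Lemma bar_mble V : measurable (bar V).
Proof.
apply: countable_bigcup_measurable; last by move=> W [/ownP[]].
by apply: sub_countable cS; apply: subset_card_le => W [].
Qed.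

Lemma bar_sub V : bar V `<=` V.
Proof. by move=> x [W [SW aW] ox]; apply: (anc_S SW aW).2; have [_ + _] := ownP SW; apply. Qed.

Lemma own_bar W V x : S W -> anc W V -> own W x -> bar V x.
Proof. by move=> SW aW ox; exists W. Qed.

Lemma bar_anc V V' : anc V V' -> bar V `<=` bar V'.
Proof. by move=> a x [W [SW aW] ox]; exists W => //; split => //; exact: anc_trans a. Qed.

(** A common point is owned by a single node, which descends from both; the ancestors of one node
    form a chain. *)
Lemma bar_martingale : martingale_type (bar @` S).
Proof.
move=> _ _ [V SV <-] [V' SV' <-].
have [[x [[W [SW aW] ox] [W' [SW' aW'] ox']]]|none] := pselect (bar V `&` bar V' !=set0).
  have E : W = W' by apply: own_disj => //; exists x.
  rewrite -E in aW'; have [a|a] := anc_total aW aW'.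
    by constructor 2; exact: bar_anc.
  by constructor 3; exact: bar_anc.
by constructor 1; rewrite -subset0 => x hx; apply: none; exists x.
Qed.

(** A point of [own V], which is nonempty, recovers [V]: if it lies in [bar V'], then [V] descends
    from [V']. *)
Lemma bar_inj : set_inj S bar.
Proof.
have key V V' : S V -> S V' -> bar V = bar V' -> V `<=` V'.
  move=> SV SV' E; have [x ox] := own_neq0 SV.
  have : bar V x by apply: (@own_bar V) => //; exists 0%N.
  rewrite E => -[W [SW aW] ox'].
  have EW : V = W by apply: own_disj => //; exists x.
  by rewrite EW; exact: (anc_S SW aW).2.
by move=> V V' /set_mem SV /set_mem SV' E; apply/seteqP; split; exact: key.
Qed.

Lemma bar_subordinate : subordinate bar (bar @` S) S.
Proof. by split; [exact: inj_bij bar_inj|move=> V _; exact: bar_sub]. Qed.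

End Tree.

Lemma ae_countable (R : realType) (d : measure_display) (X : measurableType d)
    (mu : {measure set X -> \bar R}) (I : pointedType) (D : set I) (P : I -> X -> Prop) :
  countable D -> (forall i, D i -> {ae mu, forall x, P i x}) ->
  {ae mu, forall x, forall i, D i -> P i x}.
Proof.
move=> /countable_enum[J [k [kD _ kS]]] h.
have /ae_foralln : forall n : nat, {ae mu, forall x, J n -> P (k n) x}.
  move=> n; have [Jn|nJ] := pselect (J n); last by apply: aeW => x /nJ.
  by apply: filterS (h _ (kD _ Jn)) => x.
by apply: filterS => x hx i /kS[n Jn <-]; exact: hx.
Qed.

(** * Domination *)

Section Truncated.
Context (R : realType) (d : measure_display) (X : measurableType d).
Variables (mu : {measure set X -> \bar R}) (Bs : set (set X)) (K : R).
Hypotheses (bb : ball_basis mu Bs K) (sep : separable_balls Bs).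
Variables (U V : completeNormedModType R) (r vrho rho : R).
Hypothesis (r0 : (0 < r)%R).
Variables (T : (X -> U) -> (X -> V)) (L0 L1 L2 : R).
Hypothesis BO : BO_operator mu Bs r vrho rho T L0 L1 L2.

Local Notation star := (ball_star mu Bs).

(** [ess_sup_balls] shows that [xget] finds a least upper bound instead of falling back on [+oo]. *)
Lemma truncated_le (f : X -> U) (k : X -> \bar R) : Lr_fun mu r f ->
  measurable_fun setT k ->
  (forall Z, Bs Z ->
    {ae mu, forall x, Z x -> `|T (cut f (~` star Z)) x|%:E <= k x}) ->
  {ae mu, forall x, truncated mu Bs T f x <= k x}.
Proof.
move=> Lf mk hk.
have mg Z : Bs Z -> measurable_fun setT (fun x => `|T (cut f (~` star Z)) x|%R).
  move=> BZ; apply: (T_norm_mble BO); apply: Lr_cut => //.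
  by apply: measurableC; exact: star_mble.
have [h [mh uh lh]] := ess_sup_balls bb sep mg.
have [_] : is_truncated mu Bs T f (truncated mu Bs T f).
  by apply: xgetPex; exists h; split => [//|l [_ ul]]; exact: lh.
by apply.
Qed.

End Truncated.

Section Transfer.
Context (R : realType) (d : measure_display) (X : measurableType d).
Variables (mu : {measure set X -> \bar R}) (Bs : set (set X)) (K : R).
Hypotheses (bb : ball_basis mu Bs K) (sep : separable_balls Bs).
Variables (U V : completeNormedModType R) (r vrho rho : R).
Hypotheses (r0 : (0 < r)%R) (rho0 : (0 < rho)%R).
Variables (T : (X -> U) -> (X -> V)) (L0 L1 L2 : R).
Hypothesis BO : BO_operator mu Bs r vrho rho T L0 L1 L2.
Local Notation star := (ball_star mu Bs).

(* The truncations that make up T^* at the points of [Z] cut off [D = star Z];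
   [Z = setT] with [D = set0] stands for T itself. *)
Definition cutter (Z D : set X) := (Bs Z /\ D = star Z) \/ (Z = setT /\ D = set0).

Lemma T_cut_support (f : X -> U) (B W D : set X) : Lr_fun mu r f ->
  {ae mu, forall x, ~ B x -> f x = 0%R} -> B `<=` W -> measurable W -> measurable D ->
  {ae mu, forall x, T (cut f D) x = T (cut f (W `&` D)) x}.
Proof.
move=> Lf f0 BW mW mD'; apply: (operator_ae (BO_operator_LrL0 BO)).
- exact: Lr_cut.
- by apply: Lr_cut => //; exact: measurableI.
apply: filterS f0 => x f0; rewrite setIC -cut_cut.
have [Wx|nW] := pselect (W x); first by rewrite (cut_id _ Wx).
by rewrite (cut_out _ nW) /cut f0 ?scaler0// => /BW.
Qed.

Lemma cutter_mble (Z D : set X) : cutter Z D -> measurable D.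
Proof. by move=> [[BZ ->]|[_ ->]] //; exact: star_mble. Qed.

Lemma dominate (f : X -> U) (B : set X) (k : X -> \bar R) : Lr_fun mu r f -> measurable B ->
  measurable_fun setT k ->
  (forall Z D, cutter Z D ->
    {ae mu, forall x, B x -> Z x -> `|T (cut f (~` D)) x|%:E <= k x}) ->
  {ae mu, forall x, B x -> `|T f x|%:E <= k x} /\
  {ae mu, forall x, B x -> truncated mu Bs T f x <= k x}.
Proof.
move=> Lf mB mk hk; split.
  have fE : cut f (~` set0) = f.
    by rewrite setC0; apply/funext => x; rewrite cut_id.
  have := hk setT set0 (or_intror (conj erefl erefl)); rewrite fE.
  by apply: filterS => x h Bx; exact: h.
(* The bound is known on [B] only, while [truncated_le] asks for it on entire balls [Z]; the value
   [+oo] off [B] makes it trivial there. *)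
pose k' x := if x \in B then k x else +oo.
have := @truncated_le _ _ _ mu Bs K bb sep _ _ r vrho rho r0 T L0 L1 L2 BO f k' Lf.
move=> /(_ _ _) h; suff : {ae mu, forall x, truncated mu Bs T f x <= k' x}.
  by apply: filterS => x + Bx; rewrite /k' mem_set.
apply: h => [|Z BZ].
  apply: measurable_fun_if => //.
  - by apply: (measurable_fun_bool true); rewrite setTI preimage_mem_true.
  - exact: measurable_funS mk.
have := hk Z (star Z) (or_introl (conj BZ erefl)).
apply: filterS => x h Zx; rewrite /k'; case: ifPn => [/set_mem Bx|_]; first exact: h.
by rewrite leey.
Qed.

(** For [L0 = 0], T0 makes the level sets null at every positive level; the level tends to 0. *)
Lemma T_ball_null (g : X -> U) (A : set X) : L0 = 0%R -> Lr_fun mu r g -> Bs A ->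
  {ae mu, forall x, A x -> `|T (cut g A) x|%R = 0%R}.
Proof.
move=> L00 Lg BA; have mA := ball_mble bb BA.
have [T0 _ _] := BO_conditions BO Lg.
have h n : {ae mu, forall x, A x ->
    (`|T (cut g A) x| <= n.+1%:R^-1 * av mu r vrho rho g A)%R}.
  have n0 : (0 < n.+1%:R^-1 :> R)%R by [].
  have := T0 _ BA _ n0.
  rewrite L00 mul0r powR0 ?invr_eq0 ?gt_eqF// mul0e avgE// => h0.
  exists [set x | A x /\ (n.+1%:R^-1 * av mu r vrho rho g A < `|T (cut g A) x|)%R].
  split; [exact: (T0_level bb r0 BO)|by apply/eqP; rewrite -measure_le0|].
  move=> x /= nx; apply: contrapT => nN; apply: nx => Ax; rewrite leNgt.
  by apply/negP => lt; apply: nN.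
have := ae_foralln h; apply: filterS => x {}h Ax.
have a0 := av_ge0 mu r vrho rho g A.
apply/eqP; rewrite -normr_le0 normr_id; apply/ler_addgt0Pl => e e0; rewrite addr0.
have [n ne] := ex_natSinv_lt (divr_gt0 e0 (ltr_pwDr ltr01 a0)).
apply: (le_trans (h n Ax)).
have a1 : (0 < av mu r vrho rho g A + 1)%R by exact: ltr_pwDr.
apply: (@le_trans _ _ (n.+1%:R^-1 * (av mu r vrho rho g A + 1))%R).
  by rewrite ler_wpM2l// lerDl.
by rewrite -ler_pdivlMr// ltW.
Qed.

End Transfer.

(** The conclusion of the theorem with its constants as parameters, shared by the cases [0 < L0] and
    [L0 = 0]. *)
Definition sparse_dominated (R : realType) (d : measure_display) (X : measurableType d)
    (mu : {measure set X -> \bar R}) (Bs : set (set X)) (U V : completeNormedModType R)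
    (r vrho rho : R) (T : (X -> U) -> (X -> V)) (gamma c C1 C2 C : R)
    (f : X -> U) (B : set X) :=
  exists (B' : set X) (S Sbar : set (set X)) (bar : set X -> set X),
  [/\ Bs B' /\ B `<=` B',
      S `<=` Bs /\ sparse mu gamma S,
      [/\ martingale_type Sbar, forall A, Sbar A -> measurable A & subordinate bar Sbar S] &
      \bigcup_(G in S) G `<=` B' /\ mu B' <= C1%:E * mu B] /\
  [/\ forall lambda : R, (0 < lambda)%R ->
        mu [set x | lambda%:E < \esum_(G in S) (\1_(bar G) x)%:E]
          <= (C2 * expR (- (c * lambda)))%:E * mu B,
      {ae mu, forall x, B x -> `|T f x|%:E <= C%:E *
          \esum_(G in S) (avg mu r vrho rho f G * (\1_(bar G) x)%:E)} &
      {ae mu, forall x, B x -> truncated mu Bs T f x <= C%:E *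
          \esum_(G in S) (avg mu r vrho rho f G * (\1_(bar G) x)%:E)}].

Section Domination.
Context (R : realType) (d : measure_display) (X : measurableType d).
Variables (mu : {measure set X -> \bar R}) (Bs : set (set X)) (K : R).
Hypotheses (K1 : (1 <= K)%R) (bb : ball_basis mu Bs K) (sep : separable_balls Bs).
Variables (U V : completeNormedModType R) (r vrho rho : R).
Hypotheses (r0 : (0 < r)%R) (rho0 : (0 < rho)%R) (vrho_ge : (rho <= vrho)%R).
Variables (T : (X -> U) -> (X -> V)) (L0 L1 L2 : R).
Hypothesis BO : BO_operator mu Bs r vrho rho T L0 L1 L2.
Hypothesis L0_gt0 : (0 < L0)%R.
Variables (f : X -> U) (B : set X).
Hypotheses (Lf : Lr_fun mu r f) (BB : Bs B).

Local Notation m A := (fine (mu A)).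
Local Notation star := (ball_star mu Bs).
Local Notation av := (av mu r vrho rho).
Local Notation L := (L0 + L1 + L2)%R.
Local Notation cutter := (cutter mu Bs).

(** Turns the proportion [4 * K * eta] of [bad_measure] into the [(8 * K ^+ 6)^-1] that the
    selection of nodes requires. *)
Definition eta_of : R := ((32 * K ^+ 7)^-1)%R.
Local Notation eta := eta_of.
Local Notation bd := (bad mu Bs K r vrho rho T L0 L1 L2 eta f).
Local Notation W0 := (hull mu Bs K B).
Local Notation S := (nodes mu Bs K bd B).
Local Notation own := (own mu Bs K bd B).
Local Notation CT := (cT K rho eta).
Local Notation CJ := (cJ K rho eta).

Let K0 : (0 < K)%R. Proof. exact: lt_le_trans K1. Qed.

Let eta0 : (0 < eta)%R.
Proof. by rewrite invr_gt0 mulr_gt0// exprn_gt0. Qed.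

Let bd_mble W : Bs W -> measurable (bd W).
Proof. exact: (bad_mble bb sep r0 BO). Qed.

Let bd_le W : Bs W -> mu (bd W) <= ((8 * K ^+ 6)^-1 * m W)%:E.
Proof.
move=> BW; have := bad_measure K1 bb sep r0 rho0 vrho_ge BO L0_gt0 eta0 Lf BW.
have -> // : (4 * K * eta = (8 * K ^+ 6)^-1)%R.
by rewrite /eta_of; field; rewrite gt_eqF.
Qed.

Let L_ge0 : (0 <= L)%R. Proof. exact: ltW (L_gt0 BO L0_gt0). Qed.

Lemma cutter_end Z D W : cutter Z D -> S W -> {ae mu, forall x, own W x -> Z x ->
  (`|T (cut f (W `\` D)) x| <= CT * L * av f W)%R}.
Proof.
move=> [[BZ ->]|[-> ->]] SW.
  have [[y [oy Zy]]|none] := pselect (own W `&` Z !=set0); last first.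
    by apply: aeW => x ox Zx; case: none; exists x.
  have [h _] := good_ball (own_not_bd oy) BZ Zy.
  by apply: filterS h => x h _ Zx; exact: h.
apply: aeW => x ox _; rewrite setD0.
have := good_point (own_not_bd ox) (own_sub K1 bb SW ox).
move=> /le_trans; apply; apply: ler_wpM2r; first exact: av_ge0.
have t0 := ltW (thr_gt0 rho eta0).
have p0 : (0 <= (2 * K) `^ rho)%R by exact: powR_ge0.
have [h1 h2 h3] := BO_constants BO.
apply: (@le_trans _ _ (L * thr rho eta)%R).
  by apply: ler_wpM2r => //; rewrite -addrA lerDl; exact: addr_ge0.
rewrite mulrC; apply: ler_wpM2r => //; rewrite /cT ler_peMr//.
by rewrite lerDl.
Qed.

Lemma cutter_step Z D W V' Y G : cutter Z D -> S W -> W <> W0 ->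
  is_parent mu Bs K bd B W V' G -> bodies mu Bs K bd B W Y ->
  {ae mu, forall x, Y x -> Z x -> (`|T (cut f (V' `\` D)) x| <=
    `|T (cut f (W `\` D)) x| + CJ * L * (av f V' + av f W))%R}.
Proof.
move=> cZ SW nW [SV WV _ _ [BG GW Gy Gmin]] bY.
have [BY YW SYW mWY] := bodyP K1 bb bY.
have BW := nodes_ball K1 bb BB SW; have BV := nodes_ball K1 bb BB SV.
have WT := root_large K1 bb bd_mble bd_le BB SW nW.
have Gmin' G' : Bs G' -> Y `<` G' -> (m G <= 2 * m G')%R by exact: Gmin.
case: cZ => [[BZ ->]|[-> ->]].
  exact: (trunc_step K1 bb sep r0 rho0 vrho_ge BO L0_gt0 eta0 Lf BV BW WV WT BY
    YW SYW mWY BG GW Gy Gmin' BZ).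
have := jump_split K1 bb sep r0 rho0 vrho_ge BO L0_gt0 eta0 Lf BV BW WV WT BY
    YW SYW mWY BG GW Gy Gmin' measurable0 (@sub0set _ _).
by apply: filterS => x h Yx _; exact: h.
Qed.

Local Notation gamma := ((8 * K ^+ 5)^-1)%R.

Let gamma0 : (0 < gamma)%R.
Proof. by rewrite invr_gt0 mulr_gt0// exprn_gt0. Qed.

Let SB : S `<=` Bs. Proof. by move=> W; exact: (nodes_ball K1 bb BB). Qed.

Let Sroot : S W0. Proof. by left. Qed.

Let S_W0 W : S W -> W `<=` W0.
Proof. by move=> SW; exact: (nodes_W0 K1 bb bd_mble bd_le BB SW). Qed.

Let ownP W : S W ->
  [/\ measurable (own W), own W `<=` W & (gamma * m W <= m (own W))%R].
Proof.
move=> SW; split; [exact: (own_mble K1 bb bd_mble BB)|exact: (own_sub K1 bb SW)|].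
exact: (own_le K1 bb bd_mble bd_le BB SW).
Qed.

Let own_dj : trivIset S own. Proof. exact: own_disj. Qed.

Section Parent.
Variable par : set X -> set X.
Hypotheses (par_root : par W0 = W0) (par_parent : forall W, S W -> W <> W0 ->
  exists G, is_parent mu Bs K bd B W (par W) G).

Let parP W : S W -> W <> W0 -> [/\ S (par W), W `<=` par W & W <> par W].
Proof. by move=> SW nW; have [G []] := par_parent SW nW. Qed.

Local Notation bar := (bar S par own).

(** Each step costs the averages of both a node and its parent, so an inner node of the branch is
    charged twice. The extra term on the left is the second charge of [W], kept in reserve for the
    step to its child. *)
Lemma chain_dom Z D x : cutter Z D -> Z x ->
  (forall W, S W -> W <> W0 -> forall Y, bodies mu Bs K bd B W Y -> Y x ->
    (`|T (cut f (par W `\` D)) x| <=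
    `|T (cut f (W `\` D)) x| + CJ * L * (av f (par W) + av f W))%R) ->
  forall W, S W -> (W = W0 \/ exists2 Y, bodies mu Bs K bd B W Y & Y x) ->
  exists s : seq (set X), [/\ uniq s, W \in s,
    forall V', V' \in s -> S V' /\ anc par W V' &
    (`|T (cut f (W0 `\` D)) x| + CJ * L * av f W <=
     `|T (cut f (W `\` D)) x| + 2 * (CJ * L * \sum_(V' <- s) av f V'))%R].
Proof.
move=> cZ Zx step.
have c0 : (0 <= CJ * L)%R.
  have [_ _ c3 c4 c5] := c_ge0 K rho eta0.
  by apply: mulr_ge0 => //; rewrite /cJ addr_ge0// addr_ge0.
apply: (tree_ind bb gamma0 SB Sroot S_W0 ownP own_dj parP).
  move=> _; exists [:: W0]; split => //; first by rewrite mem_seq1.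
    by move=> V'; rewrite mem_seq1 => /eqP ->; split => //; exists 0%N.
  rewrite big_seq1 lerD2l mulr_natl mulr2n lerDl; apply: mulr_ge0 => //; exact: av_ge0.
move=> W SW nW IH [//|[Y bY Yx]].
have [SP WP nWP] := parP SW nW; have [G [_ _ _ hP _]] := par_parent SW nW.
have Wx : W x by have [_ YW _ _] := bodyP K1 bb bY; exact: YW.
have [|s [us sP sS hs]] := IH.
  by case: hP => [->|[Y' bY' WY']]; [left|right; exists Y' => //; exact: WY'].
have Ws : W \notin s.
  apply/negP => /sS[_ aPW]; apply: nWP; apply/seteqP; split => //.
  exact: (anc_S Sroot par_root parP SP aPW).2.
exists (W :: s); split.
- by rewrite /= Ws.
- by rewrite mem_head.
- move=> V'; rewrite inE => /orP[/eqP ->|V's]; first by split => //; exists 0%N.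
  have [SV aV] := sS _ V's; split => //.
  by apply: anc_trans aV; exists 1%N.
- have h := step W SW nW Y bY Yx; rewrite big_cons.
  move: h hs; move: (`|_|%R) (`|_|%R) (`|_|%R) (av f W) (av f (par W)).
  move: (\sum_(_ <- s) _)%R (CJ * L)%R.
  by move=> q l a b c w p; lra.
Qed.

Lemma domination Z D : cutter Z D -> {ae mu, forall x, B x -> Z x ->
  (`|T (cut f (W0 `\` D)) x|%:E <= ((CT + 2 * CJ) * L)%:E *
     \esum_(G in S) (avg mu r vrho rho f G * (\1_(bar G) x)%:E))}.
Proof.
move=> cZ.
have cS := sparse_countable bb gamma0 SB ownP own_dj (SB Sroot) S_W0.
have cb W : countable (bodies mu Bs K bd B W).
  apply: (@sub_countable _ _ _ (range (fun k => blow mu Bs K (core mu Bs K bd B k)))).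
    by apply: subset_card_le => Y [k _ [-> _]]; exists k.
  exact: (sub_countable (card_image_le _ _) (countableP _)).
(* Nodes and bodies are countably many, so one null set serves all steps of all branches. *)
have step : {ae mu, forall x W, S W -> forall Y, bodies mu Bs K bd B W Y ->
    W <> W0 -> Y x -> Z x -> (`|T (cut f (par W `\` D)) x| <=
    `|T (cut f (W `\` D)) x| + CJ * L * (av f (par W) + av f W))%R}.
  apply: ae_countable => // W SW; apply: ae_countable => // Y bY.
  have [->|nW] := pselect (W = W0); first by apply: aeW => x /(_ erefl).
  have [G hG] := par_parent SW nW.
  by have := cutter_step cZ SW nW hG bY; apply: filterS => x h _; exact: h.
have last : {ae mu, forall x W, S W -> own W x -> Z x ->
    (`|T (cut f (W `\` D)) x| <= CT * L * av f W)%R}.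
  by apply: ae_countable => // W SW; exact: cutter_end.
apply: filterS3 step last (own_cover K1 bb sep bd_mble bd_le BB) => x h1 h2 h3 Bx Zx.
have [W SW ox] := h3 Bx.
have [||s [us sW sS hs]] := @chain_dom Z D x cZ Zx _ W SW.
- by move=> W' SW' nW' Y bY Yx; exact: (h1 W' SW' Y bY nW' Yx Zx).
- by have [->|nW] := pselect (W = W0); [left|right; exact: (own_body K1 bb nW ox)].
have {}h2 := h2 W SW ox Zx.
have l0 : (0 <= CJ * L)%R.
  have [_ _ c3 c4 c5] := c_ge0 K rho eta0.
  by apply: mulr_ge0 => //; rewrite /cJ addr_ge0// addr_ge0.
have le1 : (av f W <= \sum_(V' <- s) av f V')%R.
  rewrite (big_rem _ sW) /= lerDl; apply: sumr_ge0 => V' _; exact: av_ge0.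
have le2 : (`|T (cut f (W0 `\` D)) x| <= (CT + 2 * CJ) * L * \sum_(V' <- s) av f V')%R.
  have p1 := mulr_ge0 l0 (av_ge0 mu r vrho rho f W).
  have t0 : (0 <= CT * L)%R := mulr_ge0 (ltW (cT_gt0 K rho eta0)) L_ge0.
  have p2 := ler_wpM2l t0 le1.
  rewrite (_ : ((CT + 2 * CJ) * L = CT * L + 2 * (CJ * L))%R); last by rewrite mulrDl mulrA.
  move: hs h2 p1 p2; move: (`|_|%R) (`|_|%R) (\sum_(_ <- s) _)%R (av f W).
  by move: (CT * L)%R (CJ * L)%R => u v a b q w; lra.
apply: (@le_trans _ _ (((CT + 2 * CJ) * L)%:E * (\sum_(V' <- s) av f V')%:E)).
  by rewrite -EFinM lee_fin.
apply: lee_wpmul2l.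
  rewrite lee_fin mulrDl addr_ge0//; last by rewrite -mulrA mulr_ge0.
  by apply: mulr_ge0 => //; exact: ltW (cT_gt0 K rho eta0).
apply: esum_ge; exists [set` s].
  by split; [exact: finite_seq|move=> V' /= /sS[]].
rewrite -fsbig_seq// -sumEFin le_eqVlt; apply/orP; left; apply/eqP.
apply: eq_big_seq => V' V's; have [SV aV] := sS _ V's.
rewrite indicE mem_set; last exact: (own_bar SW aV ox).
by rewrite mule1 avgE//; exact: (ball_mble bb (SB SV)).
Qed.

End Parent.

Lemma sparse_domination_pos : {ae mu, forall x, ~ B x -> f x = 0%R} ->
  sparse_dominated mu Bs r vrho rho T gamma (gamma * ln 2 / (4 * K)) K (2 * K)
    ((CT + 2 * CJ) * L) f B.
Proof.
move=> f0; have [par [par_root par_parent]] := parents K1 bb bd_mble bd_le BB.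
have parP W : S W -> W <> W0 -> [/\ S (par W), W `<=` par W & W <> par W].
  by move=> SW nW; have [G []] := par_parent W SW nW.
have BW0 : Bs W0 := hull_ball bb BB.
have cS := sparse_countable bb gamma0 SB ownP own_dj BW0 S_W0.
have mbar W : S W -> measurable (bar S par own W).
  by move=> _; exact: (bar_mble bb par gamma0 SB Sroot S_W0 ownP own_dj W).
have sbar W : bar S par own W `<=` W by exact: (bar_sub Sroot ownP par_root parP).
pose k x := ((CT + 2 * CJ) * L)%:E *
  \esum_(G in S) (avg mu r vrho rho f G * (\1_(bar S par own G) x)%:E).
have mk : measurable_fun setT k.
  apply: measurable_funeM; apply: (measurable_esum cS) => [G x|G SG].
    apply: mule_ge0; last by rewrite lee_fin.
    by apply: mule_ge0; [rewrite lee_fin; exact: powR_ge0|exact: poweR_ge0].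
  apply: measurable_funeM; apply/measurable_EFinP; apply: measurable_indic; exact: mbar.
have dom := dominate bb sep r0 BO Lf (ball_mble bb BB) mk.
have {}dom : {ae mu, forall x, B x -> `|T f x|%:E <= k x} /\
    {ae mu, forall x, B x -> truncated mu Bs T f x <= k x}.
  apply: dom => Z D cZ; have mD' := cutter_mble sep cZ.
  have h1 := T_cut_support r0 BO Lf f0 (sub_hull bb BB) (ball_mble bb BW0) (measurableC mD').
  have h2 := domination par_root par_parent cZ.
  apply: filterS2 h1 h2 => x -> h2 Bx Zx; rewrite -setDE; exact: h2.
exists W0, S, (bar S par own @` S), (bar S par own); split; split.
- by split => //; exact: (sub_hull bb).
- split => //; split; first by move=> W /SB; exact: (ball_mble bb).
  exists own; split => // W SW; have [mo so go] := ownP SW; split => //.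
  have fo : mu (own W) \is a fin_num.
    rewrite ge0_fin_numE//; apply: (@le_lt_trans _ _ (mu W)).
      by apply: le_measure => //; rewrite inE//; exact: (ball_mble bb (SB SW)).
    by rewrite (ball_muE bb (SB SW)) ltry.
  by rewrite (ball_muE bb (SB SW)) -(fineK fo) -EFinM lee_fin.
- split; first exact: (bar_martingale own_dj).
    by move=> _ [W SW <-]; exact: mbar.
  exact: (bar_subordinate bb gamma0 SB Sroot ownP own_dj par_root parP).
- split; first exact: bigcup_sub.
  by rewrite (ball_muE bb BB) (ball_muE bb BW0) -EFinM lee_fin; exact: hull_le.
- move=> l l0.
  have := sparse_exp K1 bb sep gamma0 SB ownP own_dj BW0 S_W0 mbar (fun W _ => @sbar W) l0.
  move=> /le_trans; apply.
  rewrite (ball_muE bb BB) (ball_muE bb BW0) -!EFinM lee_fin.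
  have := ler_wpM2l (expR_ge0 (- (gamma * ln 2 / (4 * K) * l))) (hull_le bb BB).
  by move: (expR _) (m _) (m _) => *; lra.
- by case: dom.
- by case: dom.
Qed.

End Domination.

(** * The case [L0 = 0] *)

Section Vanishing.
Context (R : realType) (d : measure_display) (X : measurableType d).
Variables (mu : {measure set X -> \bar R}) (Bs : set (set X)) (K : R).
Hypotheses (K1 : (1 <= K)%R) (bb : ball_basis mu Bs K) (sep : separable_balls Bs).
Variables (U V : completeNormedModType R) (r vrho rho : R).
Hypotheses (r0 : (0 < r)%R) (rho0 : (0 < rho)%R).
Variables (T : (X -> U) -> (X -> V)) (L1 L2 : R).
Hypothesis BO : BO_operator mu Bs r vrho rho T 0 L1 L2.

Lemma sparse_domination_zero (gamma c C C2 : R) (f : X -> U) (B : set X) :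
  (0 <= C2)%R -> Lr_fun mu r f -> Bs B -> {ae mu, forall x, ~ B x -> f x = 0%R} ->
  sparse_dominated mu Bs r vrho rho T gamma c K C2 C f B.
Proof.
move=> C20 Lf BB f0; have mB := ball_mble bb BB.
have dom : {ae mu, forall x, B x -> `|T f x|%:E <= 0} /\
    {ae mu, forall x, B x -> truncated mu Bs T f x <= 0}.
  apply: (dominate bb sep r0 BO Lf mB (measurable_cst _)) => Z D cZ.
  have mD' := measurableC (cutter_mble sep cZ).
  have h1 := T_cut_support r0 BO Lf f0 (@subset_refl _ B) mB mD'.
  have h2 := T_ball_null bb r0 rho0 BO erefl (Lr_cut r0 mD' Lf) BB.
  apply: filterS2 h1 h2 => x -> h2 Bx Zx.
  by rewrite setIC -cut_cut h2.
exists B, set0, set0, id; split; split.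
- by split.
- by split => //; split => //; exists id; split => // ? ? [].
- by split => //; split => //; split => // A B' [].
- split; first by rewrite bigcup_set0.
  by rewrite (ball_muE bb BB) -EFinM lee_fin ler_peMl// ltW// (ball_gt0 bb BB).
- move=> l l0; rewrite (_ : [set _ | _] = set0).
    rewrite measure0 (ball_muE bb BB) -EFinM lee_fin.
    by rewrite mulr_ge0// ?mulr_ge0 ?expR_ge0// ltW// (ball_gt0 bb BB).
  by rewrite -subset0 => x /=; rewrite esum_set0 lte_fin ltNge ltW.
- by case: dom => + _; apply: filterS => x; rewrite esum_set0 mule0.
- by case: dom => _; apply: filterS => x; rewrite esum_set0 mule0.
Qed.

End Vanishing.

Lemma ball_basis_le (R : realType) (d : measure_display) (X : measurableType d)
    (mu : {measure set X -> \bar R}) (Bs : set (set X)) (K K' : R) :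
  (K <= K')%R -> ball_basis mu Bs K -> ball_basis mu Bs K'.
Proof.
move=> KK' [b1 b2 b3 b4 b5]; split => // B BB; have [H [BH sH hH]] := b5 B BB.
by exists H; split => //; apply: le_trans hH _; apply: lee_wpmul2r => //; rewrite lee_fin.
Qed.

Theorem theorem1p1 (R : realType) (K r vrho rho : R)
    (hK : (0 < K)%R) (hr : (0 < r)%R) (hrho : (0 < rho)%R)
    (hvrho : (rho <= vrho)%R) :
  exists gamma c C1 C2 C3 : R,
    [/\ (0 < gamma < 1)%R, (0 < c)%R, (0 < C1)%R, (0 < C2)%R & (0 < C3)%R] /\
    forall (d : measure_display) (X : measurableType d)
      (mu : {measure set X -> \bar R}) (Bs : set (set X))
      (U V : completeNormedModType R)
      (T : (X -> U) -> (X -> V)) (L0 L1 L2 : R),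
    ball_basis mu Bs K -> separable_balls Bs ->
    BO_operator mu Bs r vrho rho T L0 L1 L2 ->
    forall (f : X -> U) (B : set X),
    Lr_fun mu r f -> Bs B -> {ae mu, forall x, ~ B x -> f x = 0%R} ->
    exists (B' : set X) (S Sbar : set (set X)) (bar : set X -> set X),
      [/\ Bs B' /\ B `<=` B',
          S `<=` Bs /\ sparse mu gamma S,
          [/\ martingale_type Sbar, forall A, Sbar A -> measurable A &
              subordinate bar Sbar S] &
          \bigcup_(G in S) G `<=` B' /\ mu B' <= C1%:E * mu B] /\
      [/\ forall lambda : R, (0 < lambda)%R ->
            mu [set x | lambda%:E < \esum_(G in S) (\1_(bar G) x)%:E]
              <= (C2 * expR (- (c * lambda)))%:E * mu B,
          {ae mu, forall x, B x ->
            `|T f x|%:E <= (C3 * (L0 + L1 + L2))%:E *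
              \esum_(G in S) (avg mu r vrho rho f G * (\1_(bar G) x)%:E)} &
          {ae mu, forall x, B x ->
            truncated mu Bs T f x <= (C3 * (L0 + L1 + L2))%:E *
              \esum_(G in S) (avg mu r vrho rho f G * (\1_(bar G) x)%:E)}].
Proof.
(* The constants are chosen before the space, so no ball is at hand to show [1 <= K]; enlarging [K]
   only weakens (B4). *)
pose K' := Num.max K 1%R.
have K1 : (1 <= K')%R by rewrite le_max lexx orbT.
have K0 : (0 < K')%R := lt_le_trans ltr01 K1.
have eta0 : (0 < eta_of K')%R by rewrite invr_gt0 mulr_gt0// exprn_gt0.
have g0 : (0 < (8 * K' ^+ 5)^-1)%R by rewrite invr_gt0 mulr_gt0// exprn_gt0.
exists (8 * K' ^+ 5)^-1%R, ((8 * K' ^+ 5)^-1 * ln 2 / (4 * K'))%R, K', (2 * K')%R,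
  (cT K' rho (eta_of K') + 2 * cJ K' rho (eta_of K'))%R; split.
  split => //.
  - rewrite g0 invf_lt1 ?mulr_gt0 ?exprn_gt0//.
    by have := exprn_ege1 5 K1; move: (K' ^+ 5)%R => y; lra.
  - by rewrite divr_gt0 ?mulr_gt0// ln_gt0// ltr1n.
  - by rewrite mulr_gt0.
  - apply: ltr_wpDr; last exact: cT_gt0.
    have [_ _ h3 h4 h5] := c_ge0 K' rho eta0.
    by rewrite mulr_ge0// addr_ge0// addr_ge0.
move=> d X mu Bs U V T L0 L1 L2 bb0 sep BO f B Lf BB f0.
have bb : ball_basis mu Bs K' by apply: ball_basis_le bb0; rewrite le_max lexx.
have [L0_ge0 _ _] := BO_constants BO.
have [E|L0n] := eqVneq L0 0%R.
  move: BO; rewrite E => BO.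
  by apply: (sparse_domination_zero K1 bb sep hr hrho BO) => //; rewrite mulr_ge0// ltW.
have L0_gt0 : (0 < L0)%R by rewrite lt_neqAle eq_sym L0n.
exact: (sparse_domination_pos K1 bb sep hr hrho hvrho BO L0_gt0 Lf BB f0).
Qed.
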